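(* Assume that the list $\Phi$ of vectors of $V_{\mathbb Q}$ generates $V$, and let $\mathcal R$ be the set of $\Phi$-admissible subspaces of $V$. Let $f$ be a smooth function on $V$, rapidly decreasing with rapidly decreasing derivatives. Then $$\sum_{\lambda\in\Lambda}f(\lambda)=\sum_{\mathfrak s\in\mathcal R}(-1)^{|\Phi\setminus\mathfrak s|}\int_V\mathcal B(\Phi/\mathfrak s)(v)\,\Bigl(\bigl(\prod_{\phi\in\Phi\setminus\mathfrak s}\partial_\phi\bigr)f\Bigr)(v)\,dv.$$
   Context: Let $V_{\mathbb Q}$ be a finite-dimensional $\mathbb Q$-vector space, $V=V_{\mathbb Q}\otimes_{\mathbb Q}\mathbb R$, $U$ the dual of $V$, $\Lambda\subset V_{\mathbb Q}$ a lattice in $V$, and $\Gamma=\{\gamma\in U:\langle\gamma,\Lambda\rangle\subset\mathbb Z\}$. $dv$ is the Lebesgue measure on $V$ giving measure $1$ to a fundamental domain of $\Lambda$; it is used to identify distributions and generalized functions. $\Phi$ is a finite sequence considered as a multiset. A subspace of $V$ is $\Phi$-admissible if it is generated by a subset of elements of $\Phi$ (in particular $V$ and $\{0\}$ are $\Phi$-admissible). For $\mathfrak s\in\mathcal R$, $\Phi\setminus\mathfrak s$ is the list of elements of $\Phi$ (with multiplicity) not lying in $\mathfrak s$, and $|\Phi\setminus\mathfrak s|$ is its cardinality. $\partial_\phi$ is the derivative in the direction $\phi$. $\mathcal B(\Phi/\mathfrak s)$ is the function on $V$ given by the series (convergent in the sense of generalized functions) $$\mathcal B(\Phi/\mathfrak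 s)(v)=\sum_{\gamma\in\Gamma_{\mathrm{reg}}(\Phi/\mathfrak s)}\frac{e^{2i\pi\langle v,\gamma\rangle}}{\prod_{\phi\in\Phi\setminus\mathfrak s}2i\pi\langle\phi,\gamma\rangle},$$ where $\Gamma_{\mathrm{reg}}(\Phi/\mathfrak s)=\{\gamma\in\Gamma:\langle\gamma,s\rangle=0\ \forall s\in\mathfrak s,\ \langle\gamma,\phi\rangle\neq0\ \forall\phi\in\Phi\setminus\mathfrak s\}$. It is periodic with respect to $\Lambda$, piecewise polynomial, and constant along the affine spaces $v+\mathfrak s$; for $\mathfrak s=V$ it is identically $1$. *)

(* Defs.v *)
From HB Require Import structures.
From mathcomp Require Import all_boot all_order all_algebra finmap.
From mathcomp Require Import all_classical all_reals all_analysis.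
From mathcomp.real_closed Require Export complex.

Set Implicit Arguments.
Unset Strict Implicit.
Unset Printing Implicit Defensive.

Import Order.TTheory GRing.Theory Num.Theory.
Import numFieldNormedType.Exports.

Local Open Scope classical_set_scope.
Local Open Scope ring_scope.
Local Open Scope complex_scope.

Section lebesgue_tuple.
Context {R : realType}.
Local Notation mR := (measurableTypeR R).

Section step.
Variables (n : nat) (m : {sigma_finite_measure set (n.-tuple mR) -> \bar R}).

Definition cons_pair (p : mR * n.-tuple mR) : n.+1.-tuple mR :=
  [the n.+1.-tuple mR of p.1 :: p.2].

Lemma measurable_cons_pair : measurable_fun [set: mR * n.-tuple mR] cons_pair.
Proof. exact: measurable_cons. Qed.

Definition lebesgue_tuple_step : set (n.+1.-tuple mR) -> \bar R :=
  pushforward (@lebesgue_measure R \x m)%E cons_pair.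

Let step0 : lebesgue_tuple_step set0 = 0%E.
Proof. by rewrite /lebesgue_tuple_step /pushforward preimage_set0 measure0. Qed.

Let step_ge0 A : (0 <= lebesgue_tuple_step A)%E.
Proof. by rewrite /lebesgue_tuple_step /pushforward measure_ge0. Qed.

Let step_sigma_additive : semi_sigma_additive lebesgue_tuple_step.
Proof.
pose nu : {measure set (n.+1.-tuple mR) -> \bar R} :=
  measure_function_pushforward__canonical__measure_function_Measure
    (@lebesgue_measure R \x m)%E measurable_cons_pair.
exact: (@measure_semi_sigma_additive _ _ _ nu).
Qed.

HB.instance Definition _ := isMeasure.Build _ _ _ lebesgue_tuple_step
  step0 step_ge0 step_sigma_additive.

Let step_sigma_finite : sigma_finite setT lebesgue_tuple_step.
Proof.
have /sigma_finiteP[F [FT ndF Foo]] := sigma_finiteT (@lebesgue_measure R).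
have /sigma_finiteP[G [GT ndG Goo]] := sigma_finiteT m.
pose H k := [set t : n.+1.-tuple mR |
  F k (tnth t ord0) /\ G k [tuple of behead t]].
have bE p : [tuple of behead (cons_pair p)] = p.2 by apply: val_inj.
have HE k : cons_pair @^-1` H k = F k `*` G k.
  by apply/funext => p; rewrite /H /preimage /mkset bE.
exists H.
  apply/seteqP; split=> // t _.
  have [i _ Fi] : (\bigcup_k F k) (tnth t ord0) by rewrite -FT.
  have [j _ Gj] : (\bigcup_k G k) [tuple of behead t] by rewrite -GT.
  exists (maxn i j) => //; split.
    by move: Fi; apply/subsetPset/ndF/leq_maxl.
  by move: Gj; apply/subsetPset/ndG/leq_maxr.
move=> k; have [mF Fk] := Foo k; have [mG Gk] := Goo k; split.
  apply: measurableI; rewrite -[X in measurable X]setTI.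
    exact: (@measurable_tnth _ mR n.+1 ord0).
  exact: (@measurable_behead _ mR n).
rewrite /lebesgue_tuple_step /pushforward HE product_measure1E//.
by rewrite lte_mul_pinfty// ge0_fin_numE.
Qed.

HB.instance Definition _ := Measure_isSigmaFinite.Build _ _ _
  lebesgue_tuple_step step_sigma_finite.

End step.

(* The n-fold product of the Lebesgue measure of R, on R^n seen as [n.-tuple R]. *)
Fixpoint lebesgue_tuple (n : nat) :
    {sigma_finite_measure set (n.-tuple mR) -> \bar R} :=
  if n is n'.+1 then lebesgue_tuple_step (lebesgue_tuple n')
  else @dirac _ (0.-tuple mR) [tuple] R.

End lebesgue_tuple.

(* Unconditional convergence: no enumeration of the index set A is chosen. *)
Definition has_sum (R : realType) (T : choiceType) (A : set T) (F : T -> R[i])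
    (l : R[i]) : Prop :=
  forall e : R, 0 < e -> exists J0 : {fset T}, [set` J0] `<=` A /\
    forall J : {fset T}, (J0 `<=` J)%fset -> [set` J] `<=` A ->
      `| \sum_(j <- J) F j - l | < e%:C.

Definition expi2pi (R : realType) (t : R) : R[i] :=
  cos (2 * pi * t) +i* sin (2 * pi * t).

Section calculus.
Context {R : realType} {V : normedModType R}.
Implicit Types (f : V -> R[i]) (phi x : V) (vs : seq V).

(* The library has no normed R-module structure on R[i]. *)
Definition derivec phi f : V -> R[i] := fun x =>
  'D_phi (fun y => complex.Re (f y)) x +i* 'D_phi (fun y => complex.Im (f y)) x.

Definition derivecs vs f : V -> R[i] := foldr derivec f vs.

Definition smooth f : Prop := forall vs x,
  differentiable (fun y => complex.Re (derivecs vs f y)) x /\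
  differentiable (fun y => complex.Im (derivecs vs f y)) x.

Definition rapidly_decreasing f : Prop :=
  forall k : nat, exists M : R, forall x, `|f x| * (`|x| ^+ k)%:C <= M%:C.

Definition schwartz f : Prop :=
  smooth f /\ forall vs, rapidly_decreasing (derivecs vs f).

Definition test_function f : Prop :=
  smooth f /\ exists M : R, forall x, M < `|x| -> f x = 0.

End calculus.

Section bernoulli.
Context {R : realType} {VQ : vectType rat}.

(* V_Q \otimes R, in the coordinates of the basis [vbasis fullv] of V_Q *)
Local Notation V := 'rV[R]_(\dim {:VQ}).
Local Notation U := 'Hom(V, R^o).

Definition extend_scalars (x : VQ) : V :=
  \row_i ratr (coord (vbasis {:VQ}) i x).

Definition lattice_basis (Lambda : set VQ) (n : nat) (b : n.-tuple VQ) : Prop :=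
  basis_of {:VQ} b /\
  Lambda = [set \sum_(i < n) tnth b i *~ z i | z in [set: 'I_n -> int]].

Definition dual_lattice (Lambda : set VQ) : set U :=
  [set gamma | forall l, Lambda l ->
     (gamma (extend_scalars l) : R) \is a Num.int].

Definition admissible (Phi : seq V) : set {vspace V} :=
  [set s | exists2 X : seq V, {subset X <= Phi} & s = <<X>>%VS].

Definition outside (Phi : seq V) (s : {vspace V}) : seq V :=
  [seq phi <- Phi | phi \notin s].

Definition regular_dual (Lambda : set VQ) (Phi : seq V) (s : {vspace V}) : set U :=
  [set gamma | [/\ dual_lattice Lambda gamma,
     forall v, v \in s -> gamma v = 0 &
     forall phi, phi \in outside Phi s -> gamma phi != 0]].

Section basis.
Variables (n : nat) (b : n.-tuple VQ).

Definition lattice_coord (x : n.-tuple R) : V :=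
  \sum_(i < n) tnth x i *: extend_scalars (tnth b i).

(* dv is the image under [lattice_coord] of the Lebesgue measure of R^n, so the
   fundamental domain spanned by b, the image of [0, 1[^n, has measure 1. *)
Definition integral_dv (h : V -> R[i]) : R[i] :=
  (\int[lebesgue_tuple n]_x complex.Re (h (lattice_coord x))) +i*
  (\int[lebesgue_tuple n]_x complex.Im (h (lattice_coord x))).

Definition locally_integrable_dv (h : V -> R[i]) : Prop := forall M : R,
  let D := [set x : n.-tuple (measurableTypeR R) |
              forall i, `|tnth x i| <= M] in
  (lebesgue_tuple n).-integrable D (fun x => (complex.Re (h (lattice_coord x)))%:E) /\
  (lebesgue_tuple n).-integrable D (fun x => (complex.Im (h (lattice_coord x)))%:E).

Definition bernoulli_term (Phi : seq V) (s : {vspace V}) (gamma : U) (v : V) : R[i] :=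
  expi2pi (gamma v : R) /
  \prod_(phi <- outside Phi s) (0 +i* (2 * pi * (gamma phi : R))).

(* B represents the series of the [bernoulli_term]s, which is only assumed to
   converge in the sense of generalized functions, that is, after pairing with
   any compactly supported smooth function. *)
Definition is_bernoulli (Lambda : set VQ) (Phi : seq V) (s : {vspace V})
    (B : V -> R[i]) : Prop :=
  [/\ forall l v, Lambda l -> B (v + extend_scalars l) = B v,
      locally_integrable_dv B &
      forall g, test_function g ->
        has_sum (regular_dual Lambda Phi s)
          (fun gamma => integral_dv (fun v => bernoulli_term Phi s gamma v * g v))
          (integral_dv (fun v => B v * g v))].

(* [is_bernoulli] determines a function up to equality almost everywhere, and a
   representative is chosen. *)
Definition bernoulli (Lambda : set VQ) (Phi : seq V) (s : {vspace V}) : V -> R[i] :=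
  xget (fun=> 0) (is_bernoulli Lambda Phi s).

End basis.
End bernoulli.

(* Main.v *)
From HB Require Import structures.
Require Import Defs.
From mathcomp Require Import all_boot all_order all_algebra finmap.
From mathcomp Require Import all_classical all_reals all_analysis.
From mathcomp Require Import ring lra measurable_realfun.

Set Implicit Arguments.
Unset Strict Implicit.
Unset Printing Implicit Defensive.

Import Order.TTheory GRing.Theory Num.Theory.
Import numFieldNormedType.Exports.
Import Normc.

Local Open Scope classical_set_scope.
Local Open Scope ring_scope.
Local Open Scope complex_scope.

(** The formula is the Poisson summation formula
      sum over Lambda of f = sum over gamma in Gamma of \int e^(2 i pi <v, gamma>) f (v) dv
    with the right-hand side split according to the vectors of Phi that gamma kills.
    These generate an admissible subspace s, and gamma is regular for s and for no
    other admissible subspace ([regular_dual_span], [regular_dual_admissible]): Gamma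
    is the disjoint union of the sets Gamma_reg (Phi / s).

    The part of the sum over Gamma_reg (Phi / s) is the term of index s. Indeed each
    derivative along phi multiplies the Fourier coefficient of f at gamma by
    - 2 i pi <phi, gamma> ([coef_derivecs]), and the product of these factors cancels
    the denominator of the term of index gamma of the Bernoulli series, up to the sign
    (-1)^|Phi \ s|. The pairing of the Bernoulli function with the derivative of f is
    the sum over gamma of the products of their Fourier coefficients ([pairing],
    [is_bernoulli_pairing]).

    The Bernoulli function is an arbitrary representative of its series as a
    generalized function, so two facts about it are needed. A representative exists:
    on the regular points the numbers <phi, gamma>, for phi outside s, are nonzero
    rationals with a bounded denominator, and they determine gamma because Phi spans
    V; hence the coefficients are square-summable ([summable_bernoulli_coef]), and
    [riesz_fischer] applies. Moreover every representative has the expected Fourier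
    coefficients, which are read off by pairing with a character multiplied by a
    smooth bump whose integral translates sum to 1 ([mean_bump_chr]).

    All the analysis takes place in the coordinates given by a basis of Lambda, where
    V is R^n and both Lambda and Gamma are Z^n. The Poisson formula and the pairing
    rest on the periodization of a function that is bounded by a product of factors
    (1 + |x_i|)^-2: its Fourier series converges absolutely, and a continuous periodic
    function without nonzero Fourier coefficients is 0 ([fourier_uniqueness]). Integrals
    over R^n become integrals over the unit cube by unfolding ([unfolding]), and the
    effect of a derivative on Fourier coefficients is obtained from translations by
    dominated convergence, without integration by parts. *)

(** * Complex numbers *)

Section complex_numbers.
Context {R : realType}.
Implicit Types z w : R[i].

Lemma cReD z w : complex.Re (z + w) = complex.Re z + complex.Re w.
Proof. by case: z; case: w. Qed.

Lemma cImD z w : complex.Im (z + w) = complex.Im z + complex.Im w.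
Proof. by case: z; case: w. Qed.

Lemma cReM z w : complex.Re (z * w) =
  complex.Re z * complex.Re w - complex.Im z * complex.Im w.
Proof. by case: z; case: w. Qed.

Lemma cImM z w : complex.Im (z * w) =
  complex.Re z * complex.Im w + complex.Im z * complex.Re w.
Proof. by case: z; case: w. Qed.

Lemma cRe_sum I (r : seq I) (F : I -> R[i]) :
  complex.Re (\sum_(i <- r) F i) = \sum_(i <- r) complex.Re (F i).
Proof. by exact: (big_morph _ cReD). Qed.

Lemma cIm_sum I (r : seq I) (F : I -> R[i]) :
  complex.Im (\sum_(i <- r) F i) = \sum_(i <- r) complex.Im (F i).
Proof. by exact: (big_morph _ cImD). Qed.

Lemma normc_ge0 z : 0 <= normc z.
Proof. by case: z => a b; exact: sqrtr_ge0. Qed.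

Lemma le_Re_normc z : `|complex.Re z| <= normc z.
Proof.
case: z => a b /=; rewrite -sqrtr_sqr ler_sqrt ?addr_ge0 ?sqr_ge0//.
by rewrite lerDl sqr_ge0.
Qed.

Lemma le_Im_normc z : `|complex.Im z| <= normc z.
Proof.
case: z => a b /=; rewrite -sqrtr_sqr ler_sqrt ?addr_ge0 ?sqr_ge0//.
by rewrite lerDr sqr_ge0.
Qed.

Lemma normc_le_ReIm z : normc z <= `|complex.Re z| + `|complex.Im z|.
Proof.
case: z => a b /=; rewrite -[leRHS]ger0_norm ?addr_ge0// -sqrtr_sqr.
rewrite ler_sqrt ?sqr_ge0// sqrrD !real_normK ?num_real//.
by rewrite addrAC lerDl mulrn_wge0// mulr_ge0.
Qed.

Lemma normc_sum I (r : seq I) (F : I -> R[i]) :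
  normc (\sum_(i <- r) F i) <= \sum_(i <- r) normc (F i).
Proof.
elim: r => [|i r IH]; first by rewrite !big_nil normc0.
by rewrite !big_cons (le_trans (le_normcD _ _))// lerD.
Qed.

Lemma normc_prod I (r : seq I) (F : I -> R[i]) :
  normc (\prod_(i <- r) F i) = \prod_(i <- r) normc (F i).
Proof. exact: (big_morph _ (@normcM R) (normc1 R)). Qed.

Lemma normcB z w : normc (z - w) = normc (w - z).
Proof. by rewrite -normcN opprB. Qed.

Lemma le_normcB (x y z : R[i]) : normc (x - z) <= normc (x - y) + normc (y - z).
Proof. by rewrite -[x - z](subrKA y) le_normcD. Qed.

Lemma normc_real (a : R) : normc a%:C = `|a|.
Proof. by rewrite /= expr0n/= addr0 sqrtr_sqr. Qed.

Lemma normc_lt_eq0 z : (forall e, 0 < e -> normc z < e) -> z = 0.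
Proof.
move=> h; apply: eq0_normc; apply/eqP; rewrite eq_le normc_ge0 andbT.
by apply/ler_addgt0Pr => e e0; rewrite add0r ltW// h.
Qed.

Lemma normc_lt z (e : R) : (`|z| < e%:C) = (normc z < e).
Proof. by rewrite -ltcR. Qed.

End complex_numbers.

(** * Unconditional sums *)

Lemma fset_filter_sum (T : choiceType) (V : nmodType) (J : {fset T})
    (P : pred T) (F : T -> V) :
  \sum_(j <- [fset t in J | P t]%fset) F j = \sum_(j <- J | P j) F j.
Proof. by rewrite -big_fset_condE. Qed.

Section has_sum_theory.
Context {R : realType} {T : choiceType}.
Implicit Types (A : set T) (F : T -> R[i]) (J : {fset T}) (l : R[i]).

Lemma has_sum_unique A F l l' : has_sum A F l -> has_sum A F l' -> l = l'.
Proof.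
move=> h h'; apply/subr0_eq/normc_lt_eq0 => e e0.
have e2 : 0 < e / 2 by rewrite divr_gt0.
have [J [JA hJ]] := h _ e2; have [J' [JA' hJ']] := h' _ e2.
have UA : [set` (J `|` J')%fset] `<=` A.
  by move=> t /=; rewrite inE => /orP[/JA|/JA'].
have := hJ _ (fsubsetUl J J') UA; rewrite normc_lt => h1.
have := hJ' _ (fsubsetUr J J') UA; rewrite normc_lt => h2.
rewrite (le_lt_trans (le_normcB _ (\sum_(j <- (J `|` J')%fset) F j) _))//.
by rewrite [e]splitr ltrD// normcB.
Qed.

Lemma eq_has_sum A F F' l : (forall t, A t -> F t = F' t) ->
  has_sum A F l -> has_sum A F' l.
Proof.
move=> e h eps e0; have [J [JA hJ]] := h _ e0; exists J; split=> // J' JJ' JA'.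
rewrite (_ : \sum_(j <- J') F' j = \sum_(j <- J') F j); first exact: hJ.
by apply: eq_big_seq => j jJ; rewrite e//; apply: JA'.
Qed.

Lemma has_sum_restrict A F l :
  has_sum setT (fun t => if t \in A then F t else 0) l -> has_sum A F l.
Proof.
move=> h e e0; have [J [_ hJ]] := h _ e0.
exists [fset t in J | t \in A]%fset; split.
  by move=> t /=; rewrite !inE => /andP[_ /set_mem].
move=> J' JJ' J'A.
have := hJ (J `|` J')%fset (fsubsetUl _ _) (@subsetT _ _).
suff -> : \sum_(j <- (J `|` J')%fset) (if j \in A then F j else 0) =
          \sum_(j <- J') F j by [].
rewrite [RHS](@eq_big_seq _ _ _ _ _ _ (fun j => if j \in A then F j else 0)).
  apply/esym/big_fset_incl; first exact: fsubsetUr.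
  move=> t; rewrite inE => /orP[tJ tJ'|->//]; case: ifPn => // tA.
  by case/negP: tJ'; apply: (fsubsetP JJ'); rewrite !inE tJ.
by move=> j jJ; rewrite ifT//; apply/mem_set/J'A.
Qed.

Lemma has_sum_reindex (T' : choiceType) (B : set T') (phi : T -> T')
    (psi : T' -> T) A (F : T' -> R[i]) l :
  (forall t, A t -> B (phi t)) -> (forall t, B t -> A (psi t)) ->
  (forall t, A t -> psi (phi t) = t) -> (forall t, B t -> phi (psi t) = t) ->
  has_sum A (F \o phi) l -> has_sum B F l.
Proof.
move=> AB BA pp' p'p h e e0; have [J [JA hJ]] := h _ e0.
exists [fset phi t | t in J]%fset; split.
  by move=> t /= /imfsetP[s /= sJ ->]; apply/AB/JA.
move=> J' JJ' J'B.
have h1 : (J `<=` [fset psi t | t in J'])%fset.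
  apply/fsubsetP => t tJ; apply/imfsetP; exists (phi t) => /=.
    by apply: (fsubsetP JJ'); apply/imfsetP; exists t.
  by rewrite pp'//; apply: JA.
have h2 : [set` [fset psi t | t in J']%fset] `<=` A.
  by move=> t /= /imfsetP[s /= sJ ->]; apply/BA/J'B.
have := hJ _ h1 h2; rewrite big_imfset/=.
  congr (`| _ - _ | < _); apply: eq_big_seq => j jJ /=.
  by rewrite p'p//; apply: J'B.
move=> s t sJ tJ /(congr1 phi); rewrite !p'p//; exact: J'B.
Qed.

Lemma has_sumZ A F l c : has_sum A F l -> has_sum A (fun t => c * F t) (c * l).
Proof.
move=> h e e0.
have c1 : 0 < normc c + 1 by rewrite ltr_wpDl// normc_ge0.
have [|J [JA hJ]] := h (e / (normc c + 1)); first exact: divr_gt0.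
exists J; split=> // J' JJ' JA'.
have := hJ _ JJ' JA'; rewrite !normc_lt -mulr_sumr -mulrBr normcM.
rewrite ltr_pdivlMr// mulrC => /(le_lt_trans _); apply.
by rewrite ler_wpM2r ?normc_ge0// lerDl.
Qed.

Lemma has_sum_single A F t : A t -> (forall s, A s -> s != t -> F s = 0) ->
  has_sum A F (F t).
Proof.
move=> At h e e0; exists [fset t]%fset; split.
  by move=> s /=; rewrite inE => /eqP ->.
move=> J tJ JA; rewrite normc_lt.
rewrite (_ : \sum_(j <- J) F j = F t) ?subrr ?normc0//.
have -> : F t = \sum_(j <- [fset t]%fset) F j by rewrite big_seq_fset1.
apply/esym/big_fset_incl => // s sJ; rewrite inE; exact/h/JA.
Qed.

Lemma has_sum0 A F : (forall s, A s -> F s = 0) -> has_sum A F 0.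
Proof.
move=> h e e0; exists fset0; split=> [s//|J _ JA].
rewrite normc_lt big1_seq ?subrr ?normc0// => i /= iJ; exact/h/JA.
Qed.

Lemma has_sum_bigcup (I : choiceType) (r : seq I) (A : I -> set T) B F
    (l : I -> R[i]) : uniq r ->
  (forall t, B t -> exists2 i, i \in r & A i t) ->
  (forall i t, i \in r -> A i t -> B t) ->
  (forall i j t, i \in r -> j \in r -> A i t -> A j t -> i = j) ->
  (forall i, i \in r -> has_sum (A i) F (l i)) ->
  has_sum B F (\sum_(i <- r) l i).
Proof.
move=> ur BA AB disj h e e0.
(* Each piece gets an equal share of the error; the successor makes the share
   positive when r is empty. *)
pose d := e / (size r).+1%:R.
have d0 : 0 < d by rewrite divr_gt0.
have /boolp.choice[J0 hJ0] : forall i, exists J0 : {fset T}, i \in r ->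
    [set` J0] `<=` A i /\ forall J : {fset T}, (J0 `<=` J)%fset ->
      [set` J] `<=` A i -> normc (\sum_(j <- J) F j - l i) < d.
  move=> i; case: (boolP (i \in r)) => ir; last by exists fset0.
  have [J [JA hJ]] := h i ir d d0; exists J => _; split=> // J' JJ' JA'.
  by rewrite -normc_lt; exact: hJ.
exists (\bigcup_(i <- r) J0 i)%fset; split.
  move=> t /= /bigfcupP[i /andP[ir _] ti]; apply: (AB i) => //.
  by apply: (hJ0 i ir).1.
move=> J J0J JB; rewrite normc_lt.
have -> : \sum_(j <- J) F j =
    \sum_(i <- r) \sum_(j <- [fset t in J | t \in A i]%fset) F j.
  transitivity (\sum_(i <- r) \sum_(j <- J | j \in A i) F j); last first.
    by apply: eq_bigr => i _; rewrite fset_filter_sum.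
  under [RHS]eq_bigr do rewrite big_mkcond/=.
  rewrite exchange_big/=; apply: eq_big_seq => t tJ.
  have [i ir Ait] := BA _ (JB _ tJ).
  rewrite -big_mkcond/= (big_rem i ir)/= ifT ?mem_set//.
  rewrite big1_seq ?addr0// => j /andP[/set_mem jA].
  rewrite mem_rem_uniq// !inE => /andP[/eqP ji jr].
  by case: ji; apply: (disj _ _ t).
rewrite -sumrB (le_lt_trans (normc_sum _ _))//.
apply: (@le_lt_trans _ _ (\sum_(i <- r) d)).
  rewrite big_seq [leRHS]big_seq; apply: ler_sum => i ir.
  apply/ltW/(hJ0 i ir).2 => [|t /=]; last by rewrite !inE => /andP[_ /set_mem].
  apply/fsubsetP => t tJ; rewrite !inE; apply/andP; split.
    by apply/(fsubsetP J0J)/bigfcupP; exists i; rewrite ?ir.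
  by apply/mem_set/(hJ0 i ir).1.
rewrite big_const_seq count_predT iter_addr_0 -mulr_natr.
by rewrite /d mulrAC ltr_pdivrMr// ltr_pM2l// ltr_nat.
Qed.

End has_sum_theory.

(** * Dominated sums *)

Section dominated_sums.
Context {R : realType} {T : choiceType}.
Implicit Types (M : T -> R) (J : {fset T}).

Definition finite_sums M : set R := [set \sum_(t <- J) M t | J in [set: {fset T}]].

(** The bound on all finite sums replaces an enumeration of the index set. *)
Definition summable_weight M :=
  (forall t, 0 <= M t) /\ exists K, forall J, \sum_(t <- J) M t <= K.

(** What the sum of M still gains outside J. All convergence statements about a
    family dominated by M are made as multiples of this number, and therefore
    hold uniformly in any parameter that does not occur in M. *)
Definition tail M J : R := sup (finite_sums M) - \sum_(t <- J) M t.

Lemma fset_sum_mono M J J' : (forall t, 0 <= M t) -> (J `<=` J')%fset ->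
  \sum_(t <- J) M t <= \sum_(t <- J') M t.
Proof.
move=> M0 JJ'.
rewrite [leRHS](big_fsetID _ (mem J))/=.
rewrite (_ : [fset x in J' | x \in J]%fset = J) ?lerDl ?sumr_ge0//.
by apply/fsetP => t; rewrite !inE; apply/andb_idl => /(fsubsetP JJ').
Qed.

Lemma finite_sums_has_sup M : summable_weight M -> has_sup (finite_sums M).
Proof.
case=> M0 [K MK]; split; first by exists (\sum_(t <- fset0) M t), fset0.
by exists K => _ [J _ <-].
Qed.

Lemma tail_ge0 M J : summable_weight M -> 0 <= tail M J.
Proof.
move=> hM; rewrite subr_ge0; apply: ub_le_sup; last by exists J.
by have [] := finite_sums_has_sup hM.
Qed.

Lemma tail_anti M J J' : summable_weight M -> (J `<=` J')%fset ->
  tail M J' <= tail M J.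
Proof. by move=> [M0 _] JJ'; rewrite lerB// fset_sum_mono. Qed.

Lemma tail_small M e : summable_weight M -> 0 < e ->
  exists J0 : {fset T}, forall J, (J0 `<=` J)%fset -> tail M J < e.
Proof.
move=> hM e0; have [_ [J0 _ <-] h] := sup_adherent e0 (finite_sums_has_sup hM).
exists J0 => J /(tail_anti hM)/le_lt_trans; apply.
by rewrite ltrBlDr -ltrBlDl.
Qed.

(** Both the weight and the shifted family [F + M] have nonnegative terms, so
    that their sums are suprema of finite sums; the sum of F is the difference. *)
Lemma real_dominated_sum M (F : T -> R) : summable_weight M ->
  (forall t, `|F t| <= M t) ->
  exists l, forall J, `|\sum_(t <- J) F t - l| <= tail M J.
Proof.
move=> hM FM; have [M0 [K MK]] := hM.
pose a t := F t + M t.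
have a0 t : 0 <= a t by have := FM t; rewrite ler_norml /a; lra.
have a2 t : a t <= 2 * M t by have := FM t; rewrite ler_norml /a; lra.
have ha : summable_weight a.
  split=> //; exists (2 * K) => J; rewrite (@le_trans _ _ (2 * \sum_(t <- J) M t))//.
    by rewrite mulr_sumr ler_sum.
  by rewrite ler_pM2l.
exists (sup (finite_sums a) - sup (finite_sums M)) => J.
have h1 := tail_ge0 J ha.
have h2 : tail a J <= 2 * tail M J.
  rewrite lerBlDr; apply: ge_sup => [|_ [J' _ <-]].
    by exists (\sum_(t <- fset0) a t), fset0.
  apply: le_trans (fset_sum_mono a0 (fsubsetUl J' J)) _.
  rewrite -lerBlDr; apply: (@le_trans _ _
     (2 * (\sum_(t <- (J' `|` J)%fset) M t - \sum_(t <- J) M t))); last first.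
    by rewrite ler_pM2l// lerB// -subr_ge0; exact: tail_ge0.
  have split_sum (G : T -> R) : \sum_(t <- (J' `|` J)%fset) G t - \sum_(t <- J) G t =
      \sum_(t <- (J' `\` J)%fset) G t.
    rewrite (big_fsetID _ (mem J))/= (_ : [fset x in _ | x \in J]%fset = J).
      rewrite addrAC subrr add0r; apply: eq_fbigl => t.
      by rewrite !inE; case: (t \in J); rewrite ?andbF ?orbF ?andbT.
    by apply/fsetP => t; rewrite !inE; case: (t \in J); rewrite ?andbF ?orbT.
  by rewrite !split_sum mulr_sumr ler_sum.
move: h1 h2; rewrite /tail /a big_split/= ler_norml => h1 h2.
by apply/andP; split; lra.
Qed.

Lemma dominated_sum M (F : T -> R[i]) : summable_weight M ->
  (forall t, normc (F t) <= M t) ->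
  exists l, forall J, normc (\sum_(t <- J) F t - l) <= 2 * tail M J.
Proof.
move=> hM FM.
have [|a ha] := real_dominated_sum hM (F := fun t => complex.Re (F t)).
  by move=> t; exact: le_trans (le_Re_normc _) (FM t).
have [|b hb] := real_dominated_sum hM (F := fun t => complex.Im (F t)).
  by move=> t; exact: le_trans (le_Im_normc _) (FM t).
exists (a +i* b) => J; rewrite (le_trans (normc_le_ReIm _))//.
have -> : complex.Re (\sum_(t <- J) F t - (a +i* b)) =
  \sum_(t <- J) complex.Re (F t) - a by rewrite cReD cRe_sum.
have -> : complex.Im (\sum_(t <- J) F t - (a +i* b)) =
  \sum_(t <- J) complex.Im (F t) - b by rewrite cImD cIm_sum.
by rewrite mulr_natl mulr2n lerD.
Qed.

Lemma tailZ_le M (c : R) J : summable_weight M -> 0 <= c ->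
  tail (fun t => c * M t) J <= c * tail M J.
Proof.
move=> hM c0; rewrite /tail mulrBr -mulr_sumr lerD2r.
apply: ge_sup => [|_ [J' _ <-]]; first by exists (\sum_(t <- fset0) c * M t), fset0.
by rewrite -mulr_sumr ler_wpM2l// -subr_ge0; exact: tail_ge0.
Qed.

Lemma tail_has_sum M (F : T -> R[i]) l (c : R) : summable_weight M -> 0 <= c ->
  (forall J, normc (\sum_(t <- J) F t - l) <= c * tail M J) -> has_sum setT F l.
Proof.
move=> hM c0 h e e0.
have c1 : 0 < c + 1 by rewrite ltr_wpDl.
have [|J0 hJ0] := tail_small (e := e / (c + 1)) hM; first exact: divr_gt0.
exists J0; split=> // J J0J _; rewrite normc_lt (le_lt_trans (h J))//.
have := hJ0 _ J0J; rewrite ltr_pdivlMr// mulrC => /(le_lt_trans _); apply.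
by rewrite ler_wpM2r ?tail_ge0// lerDl.
Qed.

Lemma summable_weight_bound M M' (c : R) : summable_weight M -> 0 <= c ->
  (forall t, 0 <= M' t <= c * M t) -> summable_weight M'.
Proof.
move=> [M0 [K hK]] c0 h; split=> [t|]; first by case/andP: (h t).
exists (c * K) => J; rewrite (@le_trans _ _ (c * \sum_(t <- J) M t))//.
  by rewrite mulr_sumr ler_sum// => t _; case/andP: (h t).
by rewrite ler_wpM2l.
Qed.

(** Compares a family with one over another index set, along a map that need only
    be injective where the family matters. *)
Lemma sum_inj_le (T' : choiceType) (A : pred T') (M : T -> R) (K : R)
    (M' : T' -> R) (phi : T' -> T) : (forall t, 0 <= M t) ->
  (forall J, \sum_(t <- J) M t <= K) ->
  (forall s t, A s -> A t -> phi s = phi t -> s = t) ->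
  (forall t, A t -> M' t <= M (phi t)) ->
  forall J : {fset T'}, \sum_(t <- J | A t) M' t <= K.
Proof.
move=> M0 hK inj hA J; rewrite -fset_filter_sum.
apply: le_trans (hK [fset phi t | t in [fset t in J | A t]]%fset).
rewrite [leRHS]big_imfset/=; last first.
  by move=> s t; rewrite !inE => /andP[_ As] /andP[_ At]; exact: inj.
by rewrite !fset_filter_sum; apply: ler_sum => t; exact: hA.
Qed.

End dominated_sums.

Lemma sum_prod_le (R : realType) (T T' : choiceType) (M : T -> R) (M' : T' -> R)
    (K K' : R) : (forall t, 0 <= M t) -> (forall t, 0 <= M' t) ->
  (forall J : {fset T}, \sum_(t <- J) M t <= K) ->
  (forall J : {fset T'}, \sum_(t <- J) M' t <= K') ->
  forall J : {fset T * T'}, \sum_(p <- J) M p.1 * M' p.2 <= K * K'.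
Proof.
move=> M0 M'0 hK hK' J.
have K'0 : 0 <= K' by have := hK' fset0; rewrite big_seq_fset0.
pose J1 := [fset p.1 | p in J]%fset.
apply: (@le_trans _ _ (\sum_(a <- J1) M a * K')); last first.
  by rewrite -mulr_suml ler_wpM2r.
have -> : \sum_(p <- J) M p.1 * M' p.2 =
    \sum_(a <- J1) M a * \sum_(p <- J | p.1 == a) M' p.2.
  under [RHS]eq_bigr do rewrite big_mkcond mulr_sumr/=.
  rewrite exchange_big/=; apply: eq_big_seq => p pJ.
  rewrite (big_fsetD1 p.1) /=; last by apply/imfsetP; exists p.
  rewrite eqxx big1_seq ?addr0// => a /andP[_]; rewrite !inE => /andP[ap _].
  by rewrite eq_sym (negbTE ap) mulr0.
apply: ler_sum => a _; rewrite ler_wpM2l//.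
apply: (@sum_inj_le _ _ _ _ M' _ _ snd) => //.
by move=> [s1 s2] [t1 t2] /= /eqP -> /eqP -> ->.
Qed.

(** * The weights (1 + |x|)^-2 *)

Section weight.
Context {R : realType}.

Definition weight1 (t : R) : R := (1 + `|t|) ^- 2.

(** A product over the coordinates, rather than a power of the norm: sums over
    Z^n then reduce to sums over Z. *)
Definition weight n (x : n.-tuple R) : R := \prod_(i < n) weight1 (tnth x i).

Definition intr_tuple n (z : n.-tuple int) : n.-tuple R :=
  [tuple (tnth z i)%:~R | i < n].

Lemma weight1_gt0 t : 0 < weight1 t.
Proof. by rewrite invr_gt0 exprn_gt0// ltr_wpDr. Qed.

Lemma weight_gt0 n (x : n.-tuple R) : 0 < weight x.
Proof. by apply: prodr_gt0 => i _; exact: weight1_gt0. Qed.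

Lemma sum_nat_weight1_le (J : {fset nat}) : \sum_(k <- J) weight1 k%:R <= 2.
Proof.
(* The right-hand side telescopes: (1 + a)^-2 is at most a^-1 - (1 + a)^-1. *)
have h N : \sum_(k < N.+1) weight1 k%:R <= 2 - N.+1%:R^-1.
  elim: N => [|N IH].
    by rewrite big_ord_recl big_ord0 /weight1 normr0 !addr0 expr1n invr1; lra.
  rewrite big_ord_recr/=; apply: (le_trans (lerD IH (lexx _))).
  rewrite /weight1 ger0_norm// -[N.+2%:R]nat1r.
  set a := N.+1%:R; have a0 : 0 < a by rewrite /a.
  have a1 : 0 < 1 + a by lra.
  rewrite -subr_ge0.
  have -> : 2 - (1 + a)^-1 - (2 - a^-1 + (1 + a) ^- 2) = (a * (1 + a) ^+ 2)^-1.
    by field; apply/andP; split; apply: lt0r_neq0.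
  by rewrite invr_ge0 mulr_ge0 ?sqr_ge0// ltW.
pose N := \max_(k <- J) k.
apply: (@le_trans _ _ (\sum_(k <- [fset k | k in iota 0 N.+1]%fset) weight1 k%:R)).
  apply: fset_sum_mono => [k|]; first exact/ltW/weight1_gt0.
  apply/fsubsetP => k kJ; apply/imfsetP; exists k => //=.
  by rewrite -[_ :: _]/(iota 0 N.+1) mem_iota/= add0n ltnS /N (big_rem _ kJ)/= leq_maxl.
rewrite big_imfset// -[enum_finmem _]/(undup (iota 0 N.+1)) undup_id ?iota_uniq//.
rewrite -[iota 0 N.+1]/(index_iota 0 N.+1) big_mkord.
by rewrite (le_trans (h N))// gerBl invr_ge0.
Qed.

Lemma sum_int_weight1_le (J : {fset int}) : \sum_(k <- J) weight1 k%:~R <= 4.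
Proof.
rewrite (bigID (fun k : int => 0 <= k))/= [leRHS](_ : _ = 2 + 2); last by lra.
apply: lerD.
  apply: (@sum_inj_le _ _ _ _ (fun k : nat => weight1 k%:R) _ _ absz) => //.
  - by move=> t; exact/ltW/weight1_gt0.
  - exact: sum_nat_weight1_le.
  - by move=> [s|s] [t|t] //= _ _ ->.
  - by move=> [t|t].
apply: (@sum_inj_le _ _ _ _ (fun k : nat => weight1 k%:R) _ _ absz) => //.
- by move=> t; exact/ltW/weight1_gt0.
- exact: sum_nat_weight1_le.
- by move=> [s|s] [t|t] //= _ _ [->].
- by move=> [t|t] //= _; rewrite /weight1 NegzE mulrNz normrN.
Qed.

Lemma sum_weight_le n (J : {fset n.-tuple int}) :
  \sum_(z <- J) weight (intr_tuple z) <= 4 ^+ n.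
Proof.
elim: n J => [|n IH] J.
  apply: (@le_trans _ _ (\sum_(z <- J) 1)).
    by apply: ler_sum => z _; rewrite /weight big_ord0.
  have -> : 4 ^+ 0 = \sum_(z <- [fset ([tuple] : 0.-tuple int)]%fset) 1 :> R.
    by rewrite big_seq_fset1.
  apply: fset_sum_mono => //.
  by apply/fsubsetP => t _; rewrite !inE tuple0.
apply: (@le_trans _ _ (\sum_(z <- J | predT z)
    weight1 (thead z)%:~R * weight (intr_tuple [tuple of behead z]))).
  apply: ler_sum => z _; rewrite {1}/weight big_ord_recl tnth_mktuple.
  rewrite ler_wpM2l//; first exact/ltW/weight1_gt0.
  rewrite le_eqVlt; apply/orP; left; apply/eqP/eq_bigr => i _.
  rewrite !tnth_mktuple tnth_behead (_ : inord i.+1 = lift ord0 i)//.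
  by apply: val_inj; rewrite /= inordK// ltnS.
rewrite exprS.
apply: (@sum_inj_le _ _ _ _ (fun p => weight1 p.1%:~R * weight (intr_tuple p.2))
  _ _ (fun z => (thead z, [tuple of behead z]))) => //.
- by move=> p; rewrite mulr_ge0// ltW ?weight1_gt0 ?weight_gt0.
- apply: (@sum_prod_le _ _ _ (fun a : int => weight1 a%:~R)
    (fun z : n.-tuple int => weight (intr_tuple z))) => //.
  + by move=> t; exact/ltW/weight1_gt0.
  + by move=> t; exact/ltW/weight_gt0.
  + exact: sum_int_weight1_le.
- move=> s t _ _ [h1 h2]; apply: val_inj.
  by rewrite /= (tuple_eta s) (tuple_eta t)/= h1 h2.
Qed.

Lemma summable_weight_int n :
  summable_weight (fun z : n.-tuple int => weight (intr_tuple z)).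
Proof.
split=> [z|]; first exact/ltW/weight_gt0.
by exists (4 ^+ n) => J; exact: sum_weight_le.
Qed.

End weight.

(** * Integrals of complex functions *)

Section complex_integral.
Context d (T : measurableType d) {R : realType}.
Variable mu : {measure set T -> \bar R}.
Implicit Types (D : set T) (f g h : T -> R[i]).

Definition cmeasurable D h :=
  measurable_fun D (fun x => complex.Re (h x)) /\
  measurable_fun D (fun x => complex.Im (h x)).

Definition cintegrable D h :=
  mu.-integrable D (fun x => (complex.Re (h x))%:E) /\
  mu.-integrable D (fun x => (complex.Im (h x))%:E).

Definition cint D h : R[i] :=
  (\int[mu]_(x in D) complex.Re (h x)) +i* (\int[mu]_(x in D) complex.Im (h x)).

(** A real integrable majorant of the modulus whose measurability is immediate. *)
Definition norm1 (z : R[i]) : R := `|complex.Re z| + `|complex.Im z|.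

Definition cvgc (u : nat -> R[i]) (l : R[i]) :=
  forall e, 0 < e -> exists K, forall k, (K <= k)%N -> normc (u k - l) < e.

Lemma cmeasurableD D f g : cmeasurable D f -> cmeasurable D g ->
  cmeasurable D (fun x => f x + g x).
Proof.
move=> [f1 f2] [g1 g2]; split.
  by under eq_fun do rewrite cReD; exact: measurable_funD.
by under eq_fun do rewrite cImD; exact: measurable_funD.
Qed.

Lemma cmeasurableM D f g : cmeasurable D f -> cmeasurable D g ->
  cmeasurable D (fun x => f x * g x).
Proof.
move=> [f1 f2] [g1 g2]; split.
  by under eq_fun do rewrite cReM; apply: measurable_funB; exact: measurable_funM.
by under eq_fun do rewrite cImM; apply: measurable_funD; exact: measurable_funM.
Qed.

Lemma cmeasurable_cst D c : cmeasurable D (fun=> c).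
Proof. by split; exact: measurable_cst. Qed.

Lemma cmeasurable_sum D I (s : seq I) (F : I -> T -> R[i]) :
  (forall i, cmeasurable D (F i)) -> cmeasurable D (fun x => \sum_(i <- s) F i x).
Proof.
move=> hF; elim: s => [|i s IH].
  by under eq_fun do rewrite big_nil; exact: cmeasurable_cst.
by under eq_fun do rewrite big_cons; exact: cmeasurableD.
Qed.

Lemma cmeasurableS D E h : measurable E -> D `<=` E -> cmeasurable E h ->
  cmeasurable D h.
Proof. by move=> mE DE [h1 h2]; split; apply: (measurable_funS mE DE). Qed.

Lemma cvgc_Re u l : cvgc u l -> (complex.Re (u k)) @[k --> \oo] --> complex.Re l.
Proof.
move=> h; apply/cvgrPdist_lt => e e0; have [K hK] := h e e0.
near=> k; rewrite distrC (_ : _ - _ = complex.Re (u k - l)); last first.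
  by rewrite cReD; case: (l).
apply: le_lt_trans (le_Re_normc _) _; apply: hK; near: k.
exact: nbhs_infty_ge.
Unshelve. all: by end_near. Qed.

Lemma cvgc_Im u l : cvgc u l -> (complex.Im (u k)) @[k --> \oo] --> complex.Im l.
Proof.
move=> h; apply/cvgrPdist_lt => e e0; have [K hK] := h e e0.
near=> k; rewrite distrC (_ : _ - _ = complex.Im (u k - l)); last first.
  by rewrite cImD; case: (l).
apply: le_lt_trans (le_Im_normc _) _; apply: hK; near: k.
exact: nbhs_infty_ge.
Unshelve. all: by end_near. Qed.

Lemma cvgc_ReIm u l : (complex.Re (u k)) @[k --> \oo] --> complex.Re l ->
  (complex.Im (u k)) @[k --> \oo] --> complex.Im l -> cvgc u l.
Proof.
move=> h1 h2 e e0; have e2 : 0 < e / 2 by rewrite divr_gt0.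
move/cvgrPdist_lt: h1 => /(_ _ e2) [K1 _ hK1].
move/cvgrPdist_lt: h2 => /(_ _ e2) [K2 _ hK2].
exists (maxn K1 K2) => k; rewrite geq_max => /andP[k1 k2].
apply: le_lt_trans (normc_le_ReIm _) _; rewrite [e]splitr ltrD//.
  have := hK1 _ k1; rewrite distrC; congr (`| _ | < _).
  by rewrite cReD; case: (l).
have := hK2 _ k2; rewrite distrC; congr (`| _ | < _).
by rewrite cImD; case: (l).
Qed.

Lemma cvgc_unique u l l' : cvgc u l -> cvgc u l' -> l = l'.
Proof.
move=> h h'; apply/eqP; rewrite eq_complex; apply/andP; split; apply/eqP.
  by apply: (@cvg_unique R) (cvgc_Re h) (cvgc_Re h').
by apply: (@cvg_unique R) (cvgc_Im h) (cvgc_Im h').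
Qed.

Lemma cmeasurable_cvg D (F : nat -> T -> R[i]) f :
  (forall k, cmeasurable D (F k)) ->
  (forall x, D x -> cvgc (F ^~ x) (f x)) -> cmeasurable D f.
Proof.
move=> mF Ff; split.
  apply: (@measurable_fun_cvg _ _ _ _ (fun k x => complex.Re (F k x))) => [k|x Dx].
    by case: (mF k).
  exact: cvgc_Re (Ff x Dx).
apply: (@measurable_fun_cvg _ _ _ _ (fun k x => complex.Im (F k x))) => [k|x Dx].
  by case: (mF k).
exact: cvgc_Im (Ff x Dx).
Qed.

Lemma eq_cint D f g : (forall x, D x -> f x = g x) -> cint D f = cint D g.
Proof.
by move=> fg; congr (_ +i* _); apply: eq_Rintegral => x /set_mem Dx /=; rewrite fg.
Qed.

Lemma cint_indic D h : cint D h = cint setT (fun x => (\1_D x)%:C * h x).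
Proof.
congr (_ +i* _); rewrite Rintegral_mkcond; apply: eq_Rintegral => x _.
  by rewrite cReM /patch indicE; case: (x \in D); rewrite ?mul1r ?mul0r subr0.
by rewrite cImM /patch indicE; case: (x \in D); rewrite ?mul1r ?mul0r addr0.
Qed.

Section measurable_domain.
Variable D : set T.
Hypothesis mD : measurable D.

Lemma eq_cintegrable f g : (forall x, D x -> f x = g x) ->
  cintegrable D f -> cintegrable D g.
Proof.
move=> fg [h1 h2]; split.
  by apply: (@eq_integrable _ _ _ _ _ mD _ _ _ h1) => x /set_mem Dx /=; rewrite fg.
by apply: (@eq_integrable _ _ _ _ _ mD _ _ _ h2) => x /set_mem Dx /=; rewrite fg.
Qed.

Lemma cintegrable_measurable h : cintegrable D h -> cmeasurable D h.
Proof.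
by move=> [/measurable_int h1 /measurable_int h2]; split; exact/measurable_EFinP.
Qed.

Lemma cintegrable_dominated h (k : T -> R) : cmeasurable D h ->
  mu.-integrable D (fun x => (k x)%:E) -> (forall x, D x -> normc (h x) <= k x) ->
  cintegrable D h.
Proof.
move=> [m1 m2] ik hk; split.
  apply: (le_integrable mD _ _ ik) => //; first exact/measurable_EFinP.
  move=> x Dx /=; rewrite lee_fin (le_trans (le_Re_normc _))//.
  by rewrite (le_trans (hk x Dx))// ler_norm.
apply: (le_integrable mD _ _ ik) => //; first exact/measurable_EFinP.
move=> x Dx /=; rewrite lee_fin (le_trans (le_Im_normc _))//.
by rewrite (le_trans (hk x Dx))// ler_norm.
Qed.

Lemma integrable_norm1 h : cintegrable D h ->
  mu.-integrable D (fun x => (norm1 (h x))%:E).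
Proof.
move=> [h1 h2]; rewrite /norm1; under eq_fun do rewrite EFinD.
by apply: integrableD => //; exact: integrable_norm.
Qed.

Lemma le_normc_cint h (k : T -> R) : cintegrable D h ->
  mu.-integrable D (fun x => (k x)%:E) -> (forall x, D x -> normc (h x) <= k x) ->
  normc (cint D h) <= 2 * \int[mu]_(x in D) k x.
Proof.
move=> [i1 i2] ik hk; rewrite mulr_natl mulr2n.
apply: le_trans (normc_le_ReIm _) _; apply: lerD.
  apply: le_trans (le_normr_Rintegral _ _) _ => //.
  apply: le_Rintegral => //; first exact: integrable_norm.
  by move=> x Dx; apply: le_trans (le_Re_normc _) (hk x Dx).
apply: le_trans (le_normr_Rintegral _ _) _ => //.
apply: le_Rintegral => //; first exact: integrable_norm.
by move=> x Dx; apply: le_trans (le_Im_normc _) (hk x Dx).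
Qed.

Lemma cintegrableD f g : cintegrable D f -> cintegrable D g ->
  cintegrable D (fun x => f x + g x).
Proof.
move=> [f1 f2] [g1 g2]; split.
  by under eq_fun do rewrite cReD EFinD; exact: integrableD.
by under eq_fun do rewrite cImD EFinD; exact: integrableD.
Qed.

Lemma cintD f g : cintegrable D f -> cintegrable D g ->
  cint D (fun x => f x + g x) = cint D f + cint D g.
Proof.
move=> [f1 f2] [g1 g2]; rewrite /cint -[RHS]/(_ +i* _); congr (_ +i* _).
  by rewrite -RintegralD//; apply: eq_Rintegral => x _; rewrite cReD.
by rewrite -RintegralD//; apply: eq_Rintegral => x _; rewrite cImD.
Qed.

Lemma cintegrableZ c f : cintegrable D f -> cintegrable D (fun x => c * f x).
Proof.
move=> [f1 f2]; split.
  under eq_fun do rewrite cReM EFinB !EFinM.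
  by apply: integrableB => //; exact: integrableZl.
under eq_fun do rewrite cImM EFinD !EFinM.
by apply: integrableD => //; exact: integrableZl.
Qed.

Lemma cintZ c f : cintegrable D f -> cint D (fun x => c * f x) = c * cint D f.
Proof.
move=> [f1 f2]; case: c => a b; rewrite /cint -[RHS]/(_ +i* _); congr (_ +i* _).
  rewrite -!RintegralZl// -RintegralB//; last 2 first.
  - exact: (integrableZl mD _ f1).
  - exact: (integrableZl mD _ f2).
  by apply: eq_Rintegral => x _; rewrite cReM.
rewrite -!RintegralZl// -RintegralD//; last 2 first.
- exact: (integrableZl mD _ f2).
- exact: (integrableZl mD _ f1).
by apply: eq_Rintegral => x _; rewrite cImM.
Qed.

Lemma cintegrable0 : cintegrable D (fun=> 0).
Proof. by split; exact: integrable0. Qed.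

Lemma cint0 : cint D (fun=> 0) = 0.
Proof. by rewrite /cint /= !Rintegral_cst// !mul0r. Qed.

Lemma cintegrableB f g : cintegrable D f -> cintegrable D g ->
  cintegrable D (fun x => f x - g x).
Proof.
move=> hf /(cintegrableZ (-1)) hg; have := cintegrableD hf hg.
by apply: eq_cintegrable => x _; rewrite mulN1r.
Qed.

Lemma cintB f g : cintegrable D f -> cintegrable D g ->
  cint D (fun x => f x - g x) = cint D f - cint D g.
Proof.
move=> hf hg; rewrite -[- cint D g]mulN1r -cintZ// -cintD//; last exact: cintegrableZ.
by apply: eq_cint => x _; rewrite mulN1r.
Qed.

Lemma cintegrable_sum I (s : seq I) (F : I -> T -> R[i]) :
  (forall i, cintegrable D (F i)) -> cintegrable D (fun x => \sum_(i <- s) F i x).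
Proof.
move=> hF; elim: s => [|i s IH].
  by under eq_fun do rewrite big_nil; exact: cintegrable0.
by under eq_fun do rewrite big_cons; exact: cintegrableD.
Qed.

Lemma cint_sum I (s : seq I) (F : I -> T -> R[i]) :
  (forall i, cintegrable D (F i)) ->
  cint D (fun x => \sum_(i <- s) F i x) = \sum_(i <- s) cint D (F i).
Proof.
move=> hF; elim: s => [|i s IH].
  by under eq_fun do rewrite big_nil; rewrite big_nil cint0.
under eq_fun do rewrite big_cons.
by rewrite big_cons cintD ?IH//; exact: cintegrable_sum.
Qed.

Lemma cintegrable_bounded f h (c : R) : cintegrable D f -> cmeasurable D h ->
  (forall x, D x -> normc (h x) <= c) -> cintegrable D (fun x => f x * h x).
Proof.
move=> hf mh hc; have := integrable_norm1 hf; move=> /(integrableZl mD c) ik.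
apply: (@cintegrable_dominated _ (fun x => c * norm1 (f x))) => //.
  by apply: cmeasurableM => //; exact: cintegrable_measurable.
move=> x Dx; rewrite normcM mulrC ler_pM ?normc_ge0 ?hc//.
exact: normc_le_ReIm.
Qed.

Lemma le_normc_cintM f h (c : R) : cintegrable D f -> cmeasurable D h ->
  (forall x, D x -> normc (h x) <= c) ->
  normc (cint D (fun x => f x * h x)) <=
  2 * (c * \int[mu]_(x in D) norm1 (f x)).
Proof.
move=> hf mh hc; have i1 := integrable_norm1 hf.
rewrite -RintegralZl//; apply: le_normc_cint.
- exact: (@cintegrable_bounded _ _ c).
- exact: (integrableZl mD _ i1).
- move=> x Dx; rewrite normcM mulrC ler_pM ?normc_ge0 ?hc//.
  exact: normc_le_ReIm.
Qed.

(** Dominated convergence for the real and imaginary parts together. *)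
Lemma cint_cvg (F : nat -> T -> R[i]) f (k : T -> R) :
  (forall j, cmeasurable D (F j)) -> mu.-integrable D (fun x => (k x)%:E) ->
  (forall j x, D x -> normc (F j x) <= k x) ->
  (forall x, D x -> cvgc (F ^~ x) (f x)) ->
  cintegrable D f /\ cvgc (fun j => cint D (F j)) (cint D f).
Proof.
move=> mF ik Fk Ff; have [mf1 mf2] := cmeasurable_cvg mF Ff.
have [||||i1 _ c1] := @dominated_convergence _ _ _ mu D mD
    (fun j x => (complex.Re (F j x))%:E) (fun x => (complex.Re (f x))%:E) _ _ _ _ ik.
- by move=> j; apply/measurable_EFinP; case: (mF j).
- exact/measurable_EFinP.
- by apply/aeW => x Dx; apply/fine_cvgP; split; [exact: nearW|exact: cvgc_Re (Ff x Dx)].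
- apply/aeW => x j Dx; rewrite lee_fin.
  exact: le_trans (le_Re_normc _) (Fk j x Dx).
have [||||i2 _ c2] := @dominated_convergence _ _ _ mu D mD
    (fun j x => (complex.Im (F j x))%:E) (fun x => (complex.Im (f x))%:E) _ _ _ _ ik.
- by move=> j; apply/measurable_EFinP; case: (mF j).
- exact/measurable_EFinP.
- by apply/aeW => x Dx; apply/fine_cvgP; split; [exact: nearW|exact: cvgc_Im (Ff x Dx)].
- apply/aeW => x j Dx; rewrite lee_fin.
  exact: le_trans (le_Im_normc _) (Fk j x Dx).
split; first by split.
apply: cvgc_ReIm; apply: fine_cvg; rewrite fineK//; exact: integrable_fin_num.
Qed.

Section dominated_sum_integral.
Variables (I : choiceType) (M : I -> R) (F : I -> T -> R[i]) (S : T -> R[i]) (c : R).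
Hypotheses (hM : summable_weight M) (c0 : 0 <= c).
Hypothesis mF : forall t, cmeasurable D (F t).
Hypothesis FS : forall x (J : {fset I}), D x -> normc (\sum_(t <- J) F t x - S x) <= c * tail M J.

Lemma cmeasurable_dominated_sum : cmeasurable D S.
Proof.
have /boolp.choice[J hJ] : forall k : nat, exists J : {fset I}, tail M J < k.+1%:R^-1.
  move=> k; have [//|J hJ] := @tail_small _ _ _ k.+1%:R^-1 hM.
  by exists J; exact: hJ.
apply: (@cmeasurable_cvg _ (fun k x => \sum_(t <- J k) F t x)) => [k|x Dx e e0].
  exact: cmeasurable_sum.
have c1 : 0 < c + 1 by rewrite ltr_wpDl.
have [K] := ltr_add_invr (y := 0) (x := e / (c + 1)) (divr_gt0 e0 c1).
rewrite add0r => hK; exists K => k Kk.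
apply: le_lt_trans (FS _ Dx) _.
apply: (@lt_le_trans _ _ ((c + 1) * (e / (c + 1)))); last by rewrite mulrC divfK ?gt_eqF.
rewrite ltr_pM//; first 1 [exact: tail_ge0].
  by rewrite ltrDl.
apply: lt_trans (hJ k) _; apply: le_lt_trans hK.
by rewrite lef_pV2 ?posrE// ler_nat ltnS.
Qed.

Lemma dominated_sum_bounded x : D x -> normc (S x) <= c * tail M fset0.
Proof. by move=> /(FS fset0); rewrite big_seq_fset0 sub0r normcN. Qed.

Lemma cint_dominated_sum f (J : {fset I}) : cintegrable D f ->
  normc (\sum_(t <- J) cint D (fun x => f x * F t x) - cint D (fun x => f x * S x))
  <= 2 * (c * \int[mu]_(x in D) norm1 (f x)) * tail M J.
Proof.
move=> hf; have mS := cmeasurable_dominated_sum.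
have iS : cintegrable D (fun x => f x * S x).
  by apply: (cintegrable_bounded hf mS) => x; exact: dominated_sum_bounded.
have iF t : cintegrable D (fun x => f x * F t x).
  apply: (@cintegrable_bounded _ _ (c * tail M [fset t]%fset + c * tail M fset0) hf) => //.
  move=> x Dx; have := FS [fset t]%fset Dx; rewrite big_seq_fset1 => h.
  rewrite -[F t x](subrK (S x)) (le_trans (le_normcD _ _))// lerD//.
  exact: dominated_sum_bounded.
rewrite -cint_sum// -cintB//; last exact: cintegrable_sum.
rewrite (_ : cint _ _ = cint D (fun x => f x * (\sum_(t <- J) F t x - S x))); last first.
  by apply: eq_cint => x _; rewrite mulrBr mulr_sumr.
rewrite -mulrA [X in _ * X]mulrAC; apply: le_normc_cintM => //.
  under eq_fun do rewrite -mulN1r; apply: cmeasurableD; first exact: cmeasurable_sum.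
  by apply: cmeasurableM => //; exact: cmeasurable_cst.
by move=> x Dx; exact: FS.
Qed.

(** On D the partial sums approach S uniformly, at the rate of the tail of M, so
    integration against any integrable f commutes with the sum. *)
Lemma has_sum_cint f : cintegrable D f ->
  has_sum setT (fun t => cint D (fun x => f x * F t x)) (cint D (fun x => f x * S x)).
Proof.
move=> hf; apply: (@tail_has_sum _ _ M _ _ (2 * (c * \int[mu]_(x in D) norm1 (f x)))) => //.
  by rewrite !mulr_ge0// Rintegral_ge0// => x _; rewrite addr_ge0.
by move=> J; exact: cint_dominated_sum.
Qed.

End dominated_sum_integral.

End measurable_domain.

End complex_integral.

(** * Lebesgue measure on R^n *)

Section lebesgue_translation.
Context {R : realType}.
Local Notation mR := (measurableTypeR R).
Local Open Scope ereal_scope.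

Lemma ge0_integral_lebesgue_translation (c : R) (f : mR -> \bar R) :
  measurable_fun [set: mR] f -> (forall x, 0 <= f x) ->
  \int[@lebesgue_measure R]_x f (x + c)%R = \int[@lebesgue_measure R]_x f x.
Proof.
move=> mf f0.
pose phi : mR -> mR := fun x : R => (x + c)%R.
have mphi : measurable_fun [set: mR] phi.
  by apply: measurable_funD => //; exact: measurable_cst.
transitivity (\int[pushforward (@lebesgue_measure R) phi]_x f x).
  by rewrite ge0_integral_pushforward// preimage_setT.
apply: eq_measure_integral => A mA _; apply/esym.
apply: (@lebesgue_measure_unique R
  (measure_function_pushforward__canonical__measure_function_Measure
    (@lebesgue_measure R) mphi)) => //= _ [[a b] _ <-].
rewrite /pushforward (_ : phi @^-1` _ = `](a - c)%R, (b - c)%R]%classic).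
  rewrite !lebesgue_measure_itv/= !lte_fin ltrD2r -!EFinB.
  by rewrite (_ : (b - c - (a - c) = b - a)%R)//; ring.
by apply/seteqP; split => x /=; rewrite !in_itv/= lerBrDr ltrBlDr.
Qed.

Lemma ge0_integral_lebesgue_tuple_cons n (f : n.+1.-tuple mR -> \bar R) :
  measurable_fun [set: n.+1.-tuple mR] f -> (forall x, 0 <= f x) ->
  \int[lebesgue_tuple n.+1]_x f x =
  \int[@lebesgue_measure R]_a \int[lebesgue_tuple n]_t f (cons_pair (a, t)).
Proof.
move=> mf f0.
rewrite -[LHS]/(\int[pushforward (@lebesgue_measure R \x lebesgue_tuple n)
   (@cons_pair R n)]_x f x) ge0_integral_pushforward//; last exact: measurable_cons_pair.
rewrite preimage_setT fubini_tonelli1//; last by move=> x; exact: f0.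
by apply: measurableT_comp => //; exact: measurable_cons_pair.
Qed.

Definition addt n (x y : n.-tuple R) : n.-tuple R :=
  [tuple (tnth x i + tnth y i)%R | i < n].

Lemma measurable_addt n (y : n.-tuple R) :
  measurable_fun [set: n.-tuple mR] (fun x : n.-tuple mR => addt x y : n.-tuple mR).
Proof.
apply/measurable_fun_tnthP => i.
rewrite (_ : _ \o _ = (fun x : n.-tuple mR => (tnth x i + tnth y i)%R : R)).
  apply: measurable_funD; last exact: measurable_cst.
  exact: (@measurable_tnth _ mR n i).
by apply/funext => x /=; rewrite tnth_mktuple.
Qed.

(** Translate one coordinate at a time, using Tonelli's theorem. *)
Lemma ge0_integral_lebesgue_tuple_translation n (y : n.-tuple R)
    (f : n.-tuple mR -> \bar R) :
  measurable_fun [set: n.-tuple mR] f -> (forall x, 0 <= f x) ->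
  \int[lebesgue_tuple n]_x f (addt x y) = \int[lebesgue_tuple n]_x f x.
Proof.
elim: n y f => [|n IH] y f mf f0.
  by apply: eq_integral => x _; rewrite (tuple0 x) (tuple0 (addt _ _)).
have maddt := measurable_addt y.
have mfa : measurable_fun [set: n.+1.-tuple mR] (fun x : n.+1.-tuple mR => f (addt x y)).
  exact: measurableT_comp mf maddt.
rewrite (ge0_integral_lebesgue_tuple_cons mf f0).
rewrite (ge0_integral_lebesgue_tuple_cons mfa (fun x => f0 (addt x y))).
have mf' : measurable_fun [set: mR * n.-tuple mR] (f \o @cons_pair R n).
  by apply: measurableT_comp => //; exact: measurable_cons_pair.
pose F (a : mR) := \int[lebesgue_tuple n]_t f (cons_pair (a, t)).
transitivity (\int[@lebesgue_measure R]_a F (a + thead y)%R); last first.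
  apply: ge0_integral_lebesgue_translation => [|a]; last exact: integral_ge0.
  exact: (@measurable_fun_fubini_tonelli_F _ _ _ _ _ (lebesgue_tuple n) _ mf'
    (fun x => f0 (cons_pair x))).
apply: eq_integral => a _; rewrite /F.
rewrite -(IH [tuple of behead y] (fun t => f (cons_pair ((a + thead y)%R, t)))) //.
- apply: eq_integral => t _; congr f; apply: eq_from_tnth => i.
  rewrite tnth_mktuple; have [->|i0] := eqVneq i ord0; first by rewrite !tnth0.
  have i1 : (i.-1 < n)%N by rewrite prednK ?lt0n// -ltnS.
  rewrite (_ : i = lift ord0 (Ordinal i1)); last first.
    by apply: val_inj; rewrite /= /bump/= add1n prednK// lt0n.
  rewrite !tnthS tnth_mktuple; congr (_ + _)%R.
  by rewrite [in LHS](tuple_eta y) tnthS.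
- apply: (measurableT_comp mf'); exact: measurable_pair1.
Qed.

Lemma measurable_box n (F : 'I_n -> set R) : (forall i, measurable (F i : set mR)) ->
  measurable ([set x | forall i, F i (tnth x i)] : set (n.-tuple mR)).
Proof.
move=> mF; rewrite (_ : mkset _ = \bigcap_(i in [set: 'I_n])
    ((fun x : n.-tuple mR => tnth x i) @^-1` F i)).
  apply: fin_bigcap_measurable => // i _; rewrite -[X in measurable X]setTI.
  exact: (@measurable_tnth _ mR n i).
by apply/seteqP; split => x /= h i; [move=> _|]; exact: h.
Qed.

Lemma lebesgue_tuple_box n (F : 'I_n -> set R) : (forall i, measurable (F i : set mR)) ->
  lebesgue_tuple n [set x : n.-tuple mR | forall i, F i (tnth x i)] =
  \prod_(i < n) @lebesgue_measure R (F i).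
Proof.
elim: n F => [|n IH] F mF.
  by rewrite big_ord0 /= diracE mem_set//= => -[].
rewrite big_ord_recl -(IH (fun i => F (lift ord0 i)))//.
rewrite -product_measure1E//; last first.
  exact: (@measurable_box n (fun i => F (lift ord0 i))).
rewrite -[LHS]/((@lebesgue_measure R \x lebesgue_tuple n)
  (@cons_pair R n @^-1` [set x | forall i, F i (tnth x i)])).
congr (_ _); apply/seteqP; split=> -[a t] /=.
  by move=> h; split=> [|i]; [exact: (h ord0)|have := h (lift ord0 i); rewrite tnthS].
move=> [Fa Ft] i; case: (unliftP ord0 i) => [j ->|->]; last by rewrite tnth0.
by rewrite tnthS; exact: Ft.
Qed.

Lemma pushforward_addt n (y : n.-tuple R) (A : set (n.-tuple mR)) : measurable A ->
  pushforward (lebesgue_tuple n) (fun x : n.-tuple mR => addt x y : n.-tuple mR) A =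
  lebesgue_tuple n A.
Proof.
move=> mA; have my := measurable_addt y.
have mi : measurable_fun [set: n.-tuple mR] (fun x => (\1_A x)%:E : \bar R).
  by apply/measurable_EFinP; exact: measurable_indic.
have mA' : measurable ((fun x : n.-tuple mR => addt x y : n.-tuple mR) @^-1` A).
  by rewrite -[X in measurable X]setTI; exact: my.
transitivity (\int[lebesgue_tuple n]_x (\1_A (addt x y : n.-tuple mR))%:E).
  rewrite -[LHS]/(lebesgue_tuple n
    ((fun x : n.-tuple mR => addt x y : n.-tuple mR) @^-1` A)).
  by rewrite -[X in _ X = _]setIT -integral_indic.
rewrite (ge0_integral_lebesgue_tuple_translation y mi); last first.
  by move=> x; rewrite lee_fin.
by rewrite integral_indic// setIT.
Qed.

Lemma ge0_integral_addt n (y : n.-tuple R) (D : set (n.-tuple mR))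
    (f : n.-tuple mR -> \bar R) : measurable D ->
  measurable_fun [set: n.-tuple mR] f -> (forall x, 0 <= f x) ->
  \int[lebesgue_tuple n]_(x in D) f x =
  \int[lebesgue_tuple n]_(x in [set x : n.-tuple mR | D (addt x y)]) f (addt x y).
Proof.
move=> mD mf f0; have my := measurable_addt y.
rewrite -[RHS](ge0_integral_pushforward my)//; last exact: measurable_funTS.
by apply: eq_measure_integral => A mA _; exact/esym/pushforward_addt.
Qed.

End lebesgue_translation.

Section lebesgue_tuple_theory.
Context {R : realType}.
Local Notation mR := (measurableTypeR R).
Implicit Types (n : nat).

Definition oppt n (x : n.-tuple R) : n.-tuple R := [tuple - tnth x i | i < n].

Lemma addtK n (x y : n.-tuple R) : addt (addt x y) (oppt y) = x.
Proof. by apply: eq_from_tnth => i; rewrite !tnth_mktuple addrK. Qed.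

Lemma addtNK n (x y : n.-tuple R) : addt (addt x (oppt y)) y = x.
Proof. by apply: eq_from_tnth => i; rewrite !tnth_mktuple addrNK. Qed.

Lemma addtC n (x y : n.-tuple R) : addt x y = addt y x.
Proof. by apply: eq_from_tnth => i; rewrite !tnth_mktuple addrC. Qed.

Lemma cmeasurable_addt n (y : n.-tuple R) (h : n.-tuple mR -> R[i]) :
  cmeasurable setT h -> cmeasurable setT (fun x : n.-tuple mR => h (addt x y)).
Proof.
have my := measurable_addt y; move=> [h1 h2]; split.
  exact: (measurableT_comp h1 my).
exact: (measurableT_comp h2 my).
Qed.

Lemma cint_addt n (y : n.-tuple R) (D : set (n.-tuple mR)) (h : n.-tuple mR -> R[i])
    (D' := [set x : n.-tuple mR | D (addt x y)]) : measurable D ->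
  cmeasurable setT h ->
  cintegrable (lebesgue_tuple n) D' (fun x => h (addt x y)) ->
  cintegrable (lebesgue_tuple n) D h /\
  cint (lebesgue_tuple n) D h = cint (lebesgue_tuple n) D' (fun x => h (addt x y)).
Proof.
move=> mD [/measurable_EFinP m1 /measurable_EFinP m2] [i1 i2].
have my := measurable_addt y.
have tr (f : n.-tuple mR -> R) : measurable_fun setT (fun x => (f x)%:E) ->
    (lebesgue_tuple n).-integrable D' (fun x => (f (addt x y))%:E) ->
    (lebesgue_tuple n).-integrable D (fun x => (f x)%:E) /\
    \int[lebesgue_tuple n]_(x in D) f x = \int[lebesgue_tuple n]_(x in D') f (addt x y).
  move=> mf iff.
  have e := @eq_measure_integral _ _ _ D (pushforward (lebesgue_tuple n)
    (fun x : n.-tuple mR => addt x y : n.-tuple mR)) (lebesgue_tuple n).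
  split; last first.
    rewrite /Rintegral; congr fine.
    rewrite -(integral_pushforward my (f := fun x => (f x)%:E) mf iff mD).
    by apply: eq_measure_integral => A mA _; exact/esym/pushforward_addt.
  apply/integrableP; split; first exact: measurable_funTS.
  move/integrableP : iff => -[_].
  by rewrite (ge0_integral_addt y mD)//; exact: measurableT_comp.
have [j1 e1] := tr _ m1 i1; have [j2 e2] := tr _ m2 i2.
by split; [split|congr (_ +i* _)].
Qed.

Lemma tint_addt n (y : n.-tuple R) (h : n.-tuple mR -> R[i]) :
  cintegrable (lebesgue_tuple n) setT h ->
  cintegrable (lebesgue_tuple n) setT (fun x : n.-tuple mR => h (addt x y)) /\
  cint (lebesgue_tuple n) setT (fun x : n.-tuple mR => h (addt x y)) =
  cint (lebesgue_tuple n) setT h.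
Proof.
move=> ih; have mh := cintegrable_measurable ih.
have my := cmeasurable_addt y mh.
have := cint_addt (y := oppt y) measurableT my.
have -> : [set x : n.-tuple mR | [set: n.-tuple mR] (addt x (oppt y))] = setT by [].
under eq_fun do rewrite addtNK.
by move=> /(_ ih).
Qed.

Definition continuous_tuple n (h : n.-tuple R -> R[i]) := forall x e, 0 < e ->
  exists2 d, 0 < d & forall y, (forall i, `|tnth y i - tnth x i| < d) ->
    normc (h y - h x) < e.

Lemma floor_box_measurable (k : nat) (z : int) :
  measurable ([set x | Num.floor (x * k.+1%:R) = z] : set mR).
Proof.
rewrite (_ : mkset _ = `[z%:~R / k.+1%:R, (z + 1)%:~R / k.+1%:R[%classic) //.
apply/seteqP; split => x /=; rewrite in_itv/= ler_pdivrMr// ltr_pdivlMr//.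
  by move=> <-; exact: floor_itv.
exact: floor_def.
Qed.

(** Rounding to a fine grid turns a continuous function into functions that are
    constant on the countably many boxes of a partition. *)
Lemma cmeasurable_continuous n (h : n.-tuple R -> R[i]) : continuous_tuple h ->
  cmeasurable setT (h : n.-tuple mR -> R[i]).
Proof.
move=> ch.
pose g k (z : n.-tuple int) : n.-tuple R := [tuple (tnth z i)%:~R / k.+1%:R | i < n].
pose fl k (x : n.-tuple R) : n.-tuple int := [tuple Num.floor (tnth x i * k.+1%:R) | i < n].
have mcell k z : measurable ([set x | fl k x = z] : set (n.-tuple mR)).
  rewrite (_ : mkset _ = [set x : n.-tuple mR | forall i,
      [set t | Num.floor (t * k.+1%:R) = tnth z i] (tnth x i)]).
    apply: (@measurable_box _ _ (fun i => [set t | Num.floor (t * k.+1%:R) = tnth z i])).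
    by move=> i; exact: floor_box_measurable.
  apply/seteqP; split=> x /= h1 => [i|]; first by rewrite -h1 tnth_mktuple.
  by apply: eq_from_tnth => i; rewrite tnth_mktuple h1.
have mstep k (u : n.-tuple int -> R) : measurable_fun setT (fun x : n.-tuple mR => u (fl k x)).
  move=> _ Y mY; rewrite setTI (_ : _ @^-1` _ = \bigcup_z
    (if u z \in Y then [set x : n.-tuple mR | fl k x = z] else set0)).
    apply: countable_bigcupT_measurable => // z; case: ifP => _ //; exact: mcell.
  apply/seteqP; split => x /=.
    by move=> Yx; exists (fl k x) => //=; rewrite mem_set.
  by move=> [z _]; case: ifPn => [/set_mem Yz /= ->|].
apply: (@cmeasurable_cvg _ _ _ _ (fun k x => h (g k (fl k x)))) => [k|x _ e e0].
  split; first exact: (mstep k (fun z => complex.Re (h (g k z)))).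
  exact: (mstep k (fun z => complex.Im (h (g k z)))).
have [d d0 hd] := ch x e e0.
have [K] := ltr_add_invr (y := 0) (x := d) d0; rewrite add0r => hK.
exists K => k Kk; apply: hd => i; rewrite !tnth_mktuple.
have k0 : 0 < k.+1%:R :> R by [].
have := floor_itv (tnth x i * k.+1%:R); rewrite intrD => /andP[f1 f2].
rewrite distrC ger0_norm ?subr_ge0 ?ler_pdivrMr//.
apply: (@le_lt_trans _ _ k.+1%:R^-1); last first.
  by apply: le_lt_trans hK; rewrite lef_pV2 ?posrE// ler_nat ltnS.
rewrite lerBlDr -[X in _ <= X + _]mul1r -mulrDl ler_pdivlMr// addrC ltW//.
Qed.

End lebesgue_tuple_theory.

(** * Periodic functions *)

Section periodic.
Context {R : realType}.
Local Notation mR := (measurableTypeR R).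
Variable n : nat.
Local Notation W := (n.-tuple mR).
Local Notation mu := (@lebesgue_tuple R n).
Implicit Types (B h : W -> R[i]) (x y : n.-tuple R) (z : n.-tuple int).

Definition floor_tuple x : n.-tuple int := [tuple Num.floor (tnth x i) | i < n].

Definition cube : set W := [set x : W | forall i, `[0, 1[%classic (tnth x i : R)].

Definition zperiodic B := forall (x : n.-tuple R) z, B (addt x (intr_tuple z)) = B x.

Definition mean B := cint mu cube B.

Lemma floor_tuple_addt x z :
  floor_tuple (addt x (intr_tuple z)) = z <-> cube x.
Proof.
split=> [h i|h]; last first.
  apply: eq_from_tnth => i; have := h i; rewrite !tnth_mktuple /= in_itv/= => /andP[h0 h1].
  by apply: floor_def; rewrite intrD lerDr h0/= addrC ltrD2l.
have := congr1 (fun t => tnth t i) h; rewrite !tnth_mktuple /= => e.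
have := floor_itv (tnth x i + (tnth z i)%:~R); rewrite e intrD lerDr => /andP[h0 h1].
by rewrite in_itv/= h0 addrC ltrD2l in h1 *.
Qed.

Lemma cube_floor x : cube (addt x (oppt (intr_tuple (floor_tuple x)))).
Proof.
move=> i; rewrite /= !tnth_mktuple in_itv/= subr_ge0 ltrBlDl.
by have := floor_itv (tnth x i); rewrite intrD.
Qed.

Lemma measurable_cube : measurable cube.
Proof.
apply: (@measurable_box R n (fun=> `[0, 1[%classic)) => i; exact: measurable_itv.
Qed.

Lemma lebesgue_cube : mu cube = 1%E.
Proof.
rewrite (@lebesgue_tuple_box R n (fun=> `[0, 1[%classic)) => [|i]; last first.
  exact: measurable_itv.
by rewrite big1// => i _; rewrite lebesgue_measure_itv/= lte_fin ltr01 -EFinB subr0.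
Qed.

Lemma integrable_cube_cst (c : R) : mu.-integrable cube (fun=> c%:E).
Proof.
apply/integrableP; split; first exact: measurable_cst.
rewrite integral_cst; last exact: measurable_cube.
by rewrite [X in (_ * X)%E]lebesgue_cube mule1 ltry.
Qed.

Lemma Rintegral_cube_cst (c : R) : \int[mu]_(x in cube) c = c.
Proof.
rewrite Rintegral_cst; last exact: measurable_cube.
by rewrite [X in fine X]lebesgue_cube mulr1.
Qed.

Definition cell z : set W := [set x : W | floor_tuple x = z].

Lemma measurable_cell z : measurable (cell z).
Proof.
rewrite (_ : cell z = [set x : W | forall i, [set t : R | Num.floor t = tnth z i] (tnth x i)]).
  apply: (@measurable_box R n (fun i => [set t : R | Num.floor t = tnth z i])) => i.
  have := @floor_box_measurable R 0 (tnth z i).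
  by under eq_set do rewrite mulr1.
apply/seteqP; split=> x /= h1 => [i|]; first by rewrite -h1 tnth_mktuple.
by apply: eq_from_tnth => i; rewrite tnth_mktuple h1.
Qed.

Lemma cell_addt z : [set x : W | cell z (addt x (intr_tuple z))] = cube.
Proof. by apply/seteqP; split=> x hx; apply/(floor_tuple_addt x z). Qed.

(** Turns the directed family of finite sets into a sequence, as the theorems on
    monotone and dominated convergence require. *)
Lemma fset_exhaust : exists J : nat -> {fset n.-tuple int},
  (forall k k', (k <= k')%N -> (J k `<=` J k')%fset) /\ forall z, exists k, z \in J k.
Proof.
exists (fun k => [fset z in pmap choice.unpickle (iota 0 k)]%fset); split=> [k k' kk'|z].
  apply/fsubsetP => z; rewrite !inE !mem_pmap => /mapP[j]; rewrite mem_iota => /= jk e.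
  by apply/mapP; exists j => //; rewrite mem_iota/= (leq_trans jk).
exists (choice.pickle z).+1; rewrite !inE mem_pmap -(choice.pickleK z).
by apply: map_f; rewrite mem_iota/= add0n.
Qed.

Lemma ge0_integral_cells_le (G : W -> \bar R) (K : \bar R) :
  measurable_fun setT G -> (forall x, 0 <= G x)%E ->
  (forall J : {fset n.-tuple int},
    \sum_(z <- J) \int[mu]_(x in cube) G (addt x (intr_tuple z)) <= K)%E ->
  (\int[mu]_x G x <= K)%E.
Proof.
move=> mG G0 hK; have [J [Jnd Jex]] := fset_exhaust.
pose E k := \big[setU/set0]_(z <- J k) cell z.
have mE k : measurable (E k) by apply: bigsetU_measurable => z _; exact: measurable_cell.
have <- : \bigcup_k E k = setT.
  apply/seteqP; split=> // x _; have [k hk] := Jex (floor_tuple x).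
  by exists k => //; rewrite /E -bigcup_seq; exists (floor_tuple x).
have ndE : nondecreasing_seq E.
  move=> k k' kk'; apply/subsetPset => x; rewrite /E -!bigcup_seq => -[z zJ zx].
  by exists z => //; apply: (fsubsetP (Jnd _ _ kk')).
have := @ge0_nondecreasing_set_cvg_integral _ _ _ E G mu ndE mE.
move=> /(_ (fun i => measurable_funTS mG) (fun i x _ => G0 x)) c.
rewrite -(cvg_lim _ c)//; apply: lime_le; first by apply/cvg_ex; eexists; exact: c.
apply: nearW => k; apply: le_trans (hK (J k)).
rewrite /E ge0_integral_bigsetU//=; last 3 first.
- exact: measurable_cell.
- by move=> z z' _ _ [x [<- <-]].
- exact: measurable_funTS.
rewrite le_eqVlt; apply/orP; left; apply/eqP/eq_bigr => z _.
by rewrite (ge0_integral_addt (intr_tuple z) (measurable_cell z) mG G0) cell_addt.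
Qed.

Lemma weight1_addt_le (a b : R) : `|a| <= 1 -> weight1 (a + b) <= 4 * weight1 b.
Proof.
move=> a1; rewrite /weight1.
have h1 : 0 < 1 + `|a + b| by rewrite ltr_wpDr.
have h2 : 0 < 1 + `|b| by rewrite ltr_wpDr.
rewrite ler_pdivlMr ?exprn_gt0// mulrC ler_pdivrMr ?exprn_gt0//.
rewrite (_ : 4 = 2 ^+ 2) -?exprMn; last by ring.
apply: lerXn2r; rewrite ?nnegrE ?mulr_ge0 ?(ltW h1) ?(ltW h2)//.
have h3 : `|b| <= `|a + b| + `|a|.
  by rewrite -[b in leLHS](addKr a) addrC (le_trans (ler_normD _ _))// normrN.
by have := normr_ge0 (a + b); lra.
Qed.

Lemma weight_addt_le x y : (forall i, `|tnth x i| <= 1) ->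
  weight (addt x y) <= 4 ^+ n * weight y.
Proof.
move=> hx; rewrite -[n in 4 ^+ n]card_ord -prodr_const -big_split/=.
apply: ler_prod => i _; rewrite tnth_mktuple; apply/andP; split.
  exact/ltW/weight1_gt0.
exact: weight1_addt_le.
Qed.

Lemma cube_le1 x i : cube x -> `|tnth x i| <= 1.
Proof.
by move=> /(_ i); rewrite /= in_itv/= => /andP[h0 h1]; rewrite ger0_norm// ltW.
Qed.

Lemma measurable_weight : measurable_fun setT (fun x : W => weight (x : n.-tuple R)).
Proof.
rewrite /weight; apply: measurable_prod => i _.
apply: (@measurableT_comp _ _ _ _ _ _ (@weight1 R) _ (fun x : W => tnth x i)).
  apply: continuous_measurable_fun => t; apply: cvgV.
    by rewrite expf_neq0// gt_eqF// ltr_wpDr.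
  apply: (@continuous_comp _ _ _ (fun t : R => 1 + `|t|) (fun u : R => u ^+ 2)).
    by apply: cvgD; [exact: cvg_cst|exact: norm_continuous].
  exact: exprn_continuous.
exact: (@measurable_tnth _ mR n i).
Qed.

(** Unfolding: the integral of B h over R^n is the integral over one cell of B
    times the periodization S of h, because the cells are the translates of the
    cube and B takes the same values on all of them. *)
Section unfolding.
Variables (B h S : W -> R[i]) (C : R).
Hypotheses (pB : zperiodic B) (mB : cmeasurable setT B) (iB : cintegrable mu cube B).
Hypotheses (mh : cmeasurable setT h) (hC : forall x, normc (h x) <= C * weight x).
Variables (M : n.-tuple int -> R) (c : R).
Hypotheses (hM : summable_weight M) (c0 : 0 <= c).
Hypothesis hS : forall x (J : {fset n.-tuple int}), cube x ->
  normc (\sum_(z <- J) h (addt x (intr_tuple z)) - S x) <= c * tail M J.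

Let bound_ge0 : 0 <= C.
Proof.
have := le_trans (normc_ge0 _) (hC [tuple 0 | i < n]).
by rewrite pmulr_lge0// weight_gt0.
Qed.

Lemma unfolding_integrable : cintegrable mu setT (fun x => B x * h x).
Proof.
pose G (x : W) := norm1 (B x) * norm1 (h x).
have mn f : cmeasurable setT f -> measurable_fun setT (fun x : W => norm1 (f x)).
  by move=> [f1 f2]; apply: measurable_funD; exact: measurableT_comp.
have mG : measurable_fun setT G by apply: measurable_funM; exact: mn.
have iG : mu.-integrable setT (fun x => (G x)%:E).
  apply/integrableP; split; first exact/measurable_EFinP.
  have [_ [K hK]] := @summable_weight_int R n.
  set b := \int[mu]_(x in cube) norm1 (B x).
  apply: (@le_lt_trans _ _ (2 * C * 4 ^+ n * b * K)%:E); last exact: ltry.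
  under eq_integral do rewrite /= ger0_norm ?mulr_ge0 ?addr_ge0//.
  apply: ge0_integral_cells_le => [|x|J]; first exact/measurable_EFinP.
    by rewrite lee_fin mulr_ge0// addr_ge0.
  have iN : mu.-integrable cube (fun x => (norm1 (B x))%:E).
    by apply: integrable_norm1; [exact: measurable_cube|].
  apply: (@le_trans _ _ (\sum_(z <- J)
      (2 * C * 4 ^+ n * b * weight (intr_tuple z))%:E)%E); last first.
    rewrite sumEFin lee_fin -mulr_sumr ler_wpM2l// !mulr_ge0 ?exprn_ge0//.
    by apply: Rintegral_ge0 => x _; rewrite addr_ge0.
  apply: lee_sum => z _.
  have iC : mu.-integrable cube (fun x => (2 * C * 4 ^+ n * weight (intr_tuple z) * norm1 (B x))%:E).
    by apply: (integrableZl measurable_cube _ iN).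
  apply: (@le_trans _ _ (\int[mu]_(x in cube)
     (2 * C * 4 ^+ n * weight (intr_tuple z) * norm1 (B x))%:E)%E).
    apply: ge0_le_integral; first exact: measurable_cube.
    - by move=> x _; rewrite lee_fin mulr_ge0// addr_ge0.
    - apply: measurable_funTS; apply/measurable_EFinP.
      exact: (measurableT_comp mG (measurable_addt (intr_tuple z))).
    - exact: measurable_int iC.
    - move=> x cx; rewrite lee_fin /G pB mulrC ler_wpM2r ?addr_ge0//.
      apply: (@le_trans _ _ (2 * normc (h (addt x (intr_tuple z))))).
        by rewrite mulr_natl mulr2n lerD ?le_Re_normc ?le_Im_normc.
      rewrite -!mulrA ler_pM2l//; apply: le_trans (hC _) _.
      rewrite ler_wpM2l//; apply: weight_addt_le => i; exact: cube_le1.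
  rewrite -[leLHS]fineK; last exact: (integrable_fin_num measurable_cube iC).
  rewrite lee_fin -/(Rintegral mu cube _) RintegralZl//; last exact: measurable_cube.
  by rewrite mulrAC.
apply: (cintegrable_dominated measurableT _ iG); first exact: cmeasurableM.
by move=> x _; rewrite normcM ler_pM ?normc_ge0 ?normc_le_ReIm.
Qed.

Lemma unfolding : cint mu setT (fun x => B x * h x) = mean (fun x => B x * S x).
Proof.
have [J [Jnd Jex]] := fset_exhaust.
have iBh := unfolding_integrable.
have mcell z : cmeasurable setT (fun x : W => (\1_(cell z) x)%:C : R[i]).
  split; last exact: measurable_cst.
  by apply: measurable_indic; exact: measurable_cell.
pose F k (x : W) := \sum_(z <- J k) (\1_(cell z) x)%:C * (B x * h x).
have Fcell k (x : W) : \sum_(z <- J k) (\1_(cell z) x)%:C =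
    (floor_tuple x \in J k)%:R :> R[i].
  rewrite (eq_bigr (fun z => if z == floor_tuple x then 1 else 0)) => [|z _]; last first.
    rewrite indicE /cell; case: eqVneq => [->|zx]; first by rewrite mem_set.
    by rewrite memNset//= => e; rewrite e eqxx in zx.
  case: (boolP (floor_tuple x \in J k)) => xJ.
    by rewrite (big_fsetD1 _ xJ)/= eqxx big1_seq ?addr0// => z /andP[_];
       rewrite !inE => /andP[/negbTE -> _].
  rewrite big1_seq// => z /andP[_ zJ]; case: eqVneq => // e.
  by rewrite -e zJ in xJ.
have [||||_ cF] := @cint_cvg _ _ _ mu setT measurableT F (fun x => B x * h x)
   (fun x => norm1 (B x * h x)).
- move=> k; apply: cmeasurable_sum => z; apply: cmeasurableM => //.
  exact: cmeasurableM.
- exact: integrable_norm1.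
- move=> k x _; rewrite /F -mulr_suml Fcell; case: (_ \in _).
    by rewrite mul1r normc_le_ReIm.
  by rewrite mul0r normc0 addr_ge0.
- move=> x _ e e0; have [k hk] := Jex (floor_tuple x).
  exists k => k' kk'; rewrite /F -mulr_suml Fcell.
  by rewrite (fsubsetP (Jnd _ _ kk') _ hk) mul1r subrr normc0.
apply: (cvgc_unique cF).
have iz z : cintegrable mu cube (fun x => B x * h (addt x (intr_tuple z))).
  apply: (cintegrable_bounded measurable_cube (c := C * (4 ^+ n * weight (intr_tuple z)))) => //.
    apply: (cmeasurableS measurableT) => //; exact: cmeasurable_addt.
  move=> x cx; apply: le_trans (hC _) _; rewrite ler_wpM2l//.
  by apply: weight_addt_le => i; exact: cube_le1.
have e k : cint mu setT (F k) =
    \sum_(z <- J k) cint mu cube (fun x => B x * h (addt x (intr_tuple z))).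
  rewrite cint_sum//; last first.
    move=> z; apply: (@eq_cintegrable _ _ _ mu setT measurableT
      (fun x => B x * h x * (\1_(cell z) x)%:C)); first by move=> x _; rewrite mulrC.
    apply: (cintegrable_bounded measurableT (c := 1) iBh (mcell z)) => x _.
    by rewrite normc_real indicE; case: (_ \in _); rewrite ?normr0 ?normr1.
  apply: eq_bigr => z _; rewrite -cint_indic.
  have [|_ ->] := @cint_addt R n (intr_tuple z) (cell z) (fun x => B x * h x)
    (measurable_cell z) (cmeasurableM mB mh).
    rewrite cell_addt; apply: eq_cintegrable (iz z); first exact: measurable_cube.
    by move=> x _; rewrite pB.
  by rewrite cell_addt; apply: eq_cint => x _; rewrite pB.
have mtr z : cmeasurable cube (fun x : W => h (addt x (intr_tuple z))).
  by apply: (cmeasurableS measurableT) => //; exact: cmeasurable_addt.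
have hs J' := cint_dominated_sum measurable_cube hM c0 mtr hS J' iB.
set b := 2 * (c * \int[mu]_(x in cube) norm1 (B x)) in hs.
move=> eps eps0.
have b0 : 0 <= b by rewrite !mulr_ge0// Rintegral_ge0// => x _; rewrite addr_ge0.
have b1 : 0 < b + 1 by rewrite ltr_wpDl.
have [J0 hJ0] := tail_small hM (divr_gt0 eps0 b1).
have [k hk] : exists k, (J0 `<=` J k)%fset.
  have /boolp.choice[f hf] := Jex.
  exists (\max_(z <- J0) f z); apply/fsubsetP => z zJ0.
  apply: (fsubsetP (Jnd _ _ _) _ (hf z)).
  by rewrite (big_rem z)//= leq_maxl.
exists k => k' kk'; rewrite e; apply: le_lt_trans (hs _) _.
apply: (@lt_le_trans _ _ ((b + 1) * (eps / (b + 1)))); last first.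
  by rewrite mulrC divfK ?gt_eqF.
apply: (@le_lt_trans _ _ ((b + 1) * tail M (J k'))).
  by rewrite ler_wpM2r ?tail_ge0// lerDl.
rewrite ltr_pM2l//; apply/hJ0/(fsubset_trans hk)/Jnd => //.
Qed.

End unfolding.
End periodic.

Arguments cube {R n}.

(** * Characters *)

Section expi2pi_theory.
Context {R : realType}.
Implicit Types s t : R.

Lemma expi2pi0 : expi2pi (0 : R) = 1.
Proof. by rewrite /expi2pi mulr0 cos0 sin0. Qed.

Lemma expi2piD s t : expi2pi (s + t) = expi2pi s * expi2pi t.
Proof.
apply/eqP; rewrite eq_complex cReM cImM /= mulrDr cosD sinD eqxx/=.
by rewrite addrC.
Qed.

Lemma normc_expi2pi t : normc (expi2pi t) = 1.
Proof. by rewrite /= cos2Dsin2 sqrtr1. Qed.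

Lemma expi2pi_neq0 t : expi2pi t != 0.
Proof.
by apply/eqP => /(congr1 (@normc R))/eqP; rewrite normc_expi2pi normc0 oner_eq0.
Qed.

Lemma expi2piN t : expi2pi (- t) = (expi2pi t)^-1.
Proof.
by apply: (mulIf (expi2pi_neq0 t)); rewrite -expi2piD addNr expi2pi0 mulVf// expi2pi_neq0.
Qed.

Lemma expi2pi_half : expi2pi (1 / 2 : R) = -1.
Proof.
rewrite /expi2pi (_ : 2 * pi * (1 / 2) = pi); last by field.
by rewrite cospi sinpi; apply/eqP; rewrite eq_complex /= oppr0 !eqxx.
Qed.

Lemma expi2pi_int (z : int) : expi2pi (z%:~R : R) = 1.
Proof.
have e1 : expi2pi (1 : R) = 1.
  rewrite (_ : 1 = 1 / 2 + 1 / 2 :> R); last by field.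
  by rewrite expi2piD expi2pi_half mulrNN mulr1.
have en (k : nat) : expi2pi (k%:R : R) = 1.
  elim: k => [|k IH]; first exact: expi2pi0.
  by rewrite -addn1 natrD expi2piD IH e1 mulr1.
by case: z => k; rewrite ?NegzE ?mulrNz ?expi2piN en ?invr1.
Qed.

Lemma continuous_expi2pi t e : 0 < e ->
  exists2 d, 0 < d & forall s, `|s - t| < d -> normc (expi2pi s - expi2pi t) < e.
Proof.
move=> e0; have e2 : 0 < e / 2 by rewrite divr_gt0.
have c0 : {for t, continuous (fun s : R => 2 * pi * s)} by exact: mulrl_continuous.
have cc := continuous_comp c0 (@continuous_cos R _).
have cs := continuous_comp c0 (@continuous_sin R _).
move/cvgrPdist_lt: cc => /(_ _ e2)/nbhs_ballP[d1 d10 h1].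
move/cvgrPdist_lt: cs => /(_ _ e2)/nbhs_ballP[d2 d20 h2].
exists (Num.min d1 d2) => [|s]; first by rewrite lt_min d10.
rewrite lt_min => /andP[s1 s2]; apply: le_lt_trans (normc_le_ReIm _) _.
rewrite [e]splitr ltrD//; [have := h1 s|have := h2 s]; rewrite /ball/= distrC.
  by move=> /(_ s1); rewrite distrC.
by move=> /(_ s2); rewrite distrC.
Qed.

End expi2pi_theory.

Section continuous_tuple_theory.
Context {R : realType}.
Variable n : nat.
Implicit Types (f g : n.-tuple R -> R[i]) (x y : n.-tuple R) (z m : n.-tuple int).

Lemma continuous_tuple_cst (c : R[i]) : @continuous_tuple R n (fun=> c).
Proof. by move=> x e e0; exists 1 => // y _; rewrite subrr normc0. Qed.

Lemma continuous_tupleD f g : continuous_tuple f -> continuous_tuple g ->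
  continuous_tuple (fun x => f x + g x).
Proof.
move=> cf cg x e e0; have e2 : 0 < e / 2 by rewrite divr_gt0.
have [d1 d10 h1] := cf x _ e2; have [d2 d20 h2] := cg x _ e2.
exists (Num.min d1 d2) => [|y hy]; first by rewrite lt_min d10.
rewrite opprD addrACA (le_lt_trans (le_normcD _ _))// [e]splitr ltrD//.
  by apply: h1 => i; have := hy i; rewrite lt_min => /andP[].
by apply: h2 => i; have := hy i; rewrite lt_min => /andP[].
Qed.

Lemma continuous_tupleZ c f : continuous_tuple f -> continuous_tuple (fun x => c * f x).
Proof.
move=> cf x e e0; have c1 : 0 < normc c + 1 by rewrite ltr_wpDl ?normc_ge0.
have [d d0 h] := cf x _ (divr_gt0 e0 c1); exists d => // y /h.
rewrite -mulrBr normcM ltr_pdivlMr// mulrC; apply: le_lt_trans.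
by rewrite ler_wpM2r ?normc_ge0// lerDl.
Qed.

Lemma continuous_tuple_sum I (s : seq I) (F : I -> n.-tuple R -> R[i]) :
  (forall i, continuous_tuple (F i)) -> continuous_tuple (fun x => \sum_(i <- s) F i x).
Proof.
move=> hF; elim: s => [|i s IH].
  by under eq_fun do rewrite big_nil; exact: continuous_tuple_cst.
by under eq_fun do rewrite big_cons; exact: continuous_tupleD.
Qed.

Lemma continuous_tuple_addt f y : continuous_tuple f ->
  continuous_tuple (fun x => f (addt x y)).
Proof.
move=> cf x e e0; have [d d0 h] := cf (addt x y) e e0; exists d => // x' hx'.
by apply: h => i; rewrite !tnth_mktuple opprD addrACA subrr addr0.
Qed.

(** The constant may depend on the point x around which continuity is tested, as
    a locally uniform approximation is enough. *)
Lemma continuous_dominated_sum (I : choiceType) (M : I -> R)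
    (F : I -> n.-tuple R -> R[i]) (S : n.-tuple R -> R[i]) (c : n.-tuple R -> R) :
  summable_weight M -> (forall x, 0 <= c x) -> (forall t, continuous_tuple (F t)) ->
  (forall x y (J : {fset I}), (forall i, `|tnth y i - tnth x i| < 1) ->
     normc (\sum_(t <- J) F t y - S y) <= c x * tail M J) ->
  continuous_tuple S.
Proof.
move=> hM c0 cF FS x e e0; have e3 : 0 < e / 3 by rewrite divr_gt0.
have c1 : 0 < c x + 1 by rewrite ltr_wpDl.
have [J /(_ J (fsubset_refl _)) hJ] := tail_small hM (divr_gt0 e3 c1).
have near y : (forall i, `|tnth y i - tnth x i| < 1) ->
    normc (\sum_(t <- J) F t y - S y) < e / 3.
  move=> /(FS _ _ J)/le_lt_trans; apply.
  move: hJ; rewrite ltr_pdivlMr// mulrC; apply: le_lt_trans.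
  by rewrite ler_wpM2r ?tail_ge0// lerDl.
have [d d0 hd] := continuous_tuple_sum J cF x e3.
exists (Num.min d 1) => [|y hy]; first by rewrite lt_min d0 ltr01.
have h1 : normc (S y - \sum_(t <- J) F t y) < e / 3.
  by rewrite normcB near// => i; have := hy i; rewrite lt_min => /andP[].
have h2 : normc (\sum_(t <- J) F t x - S x) < e / 3.
  by rewrite near// => i; rewrite subrr normr0.
have h3 : normc (\sum_(t <- J) F t y - \sum_(t <- J) F t x) < e / 3.
  by apply: hd => i; have := hy i; rewrite lt_min => /andP[].
have := le_normcB (S y) (\sum_(t <- J) F t y) (S x).
have := le_normcB (\sum_(t <- J) F t y) (\sum_(t <- J) F t x) (S x).
lra.
Qed.

Definition zaddt z m : n.-tuple int := [tuple tnth z i + tnth m i | i < n].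
Definition zoppt z : n.-tuple int := [tuple - tnth z i | i < n].
Definition zerot : n.-tuple int := [tuple 0 | i < n].

Definition dot m x : R := \sum_(i < n) (tnth m i)%:~R * tnth x i.

Definition chr m x : R[i] := expi2pi (dot m x).

Lemma dot_addt m x y : dot m (addt x y) = dot m x + dot m y.
Proof.
by rewrite -big_split; apply: eq_bigr => i _; rewrite tnth_mktuple mulrDr.
Qed.

Lemma dot_int m z : dot m (intr_tuple z) = (\sum_(i < n) tnth m i * tnth z i)%:~R.
Proof.
by rewrite rmorph_sum; apply: eq_bigr => i _; rewrite tnth_mktuple rmorphM.
Qed.

Lemma chr_addt m x y : chr m (addt x y) = chr m x * chr m y.
Proof. by rewrite /chr dot_addt expi2piD. Qed.

Lemma chr_zaddt m m' x : chr (zaddt m m') x = chr m x * chr m' x.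
Proof.
rewrite /chr -expi2piD -big_split; congr expi2pi.
by apply: eq_bigr => i _; rewrite tnth_mktuple intrD mulrDl.
Qed.

Lemma chr_zoppt m x : chr (zoppt m) x = (chr m x)^-1.
Proof.
rewrite /chr -expi2piN; congr expi2pi; rewrite /dot -sumrN.
by apply: eq_bigr => i _; rewrite tnth_mktuple mulrNz mulNr.
Qed.

Lemma chr_zerot x : chr zerot x = 1.
Proof.
rewrite /chr /dot big1 ?expi2pi0// => i _.
by rewrite tnth_mktuple mul0r.
Qed.

Lemma normc_chr m x : normc (chr m x) = 1.
Proof. exact: normc_expi2pi. Qed.

Lemma chr_zperiodic m : zperiodic (chr m).
Proof. by move=> x z; rewrite chr_addt /chr dot_int expi2pi_int mulr1. Qed.

Lemma zaddt_oppK m m' : (zaddt m (zoppt m') == zerot) = (m == m').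
Proof.
apply/eqP/eqP => [h|->]; apply: eq_from_tnth => i; last first.
  by rewrite !tnth_mktuple subrr.
have := congr1 (fun t => tnth t i) h; rewrite !tnth_mktuple => /eqP.
by rewrite subr_eq0 => /eqP.
Qed.

Lemma continuous_chr m : continuous_tuple (chr m).
Proof.
move=> x e e0; have [d d0 h] := continuous_expi2pi (dot m x) e0.
pose K : R := \sum_(i < n) `|(tnth m i)%:~R| + 1.
have K0 : 0 < K by rewrite ltr_wpDl// sumr_ge0.
exists (d / K) => [|y hy]; first exact: divr_gt0.
apply: h; rewrite -sumrB; apply: le_lt_trans (ler_norm_sum _ _ _) _.
apply: (@le_lt_trans _ _ (\sum_(i < n) `|(tnth m i)%:~R| * (d / K))).
  by apply: ler_sum => i _; rewrite -mulrBr normrM ler_wpM2l// ltW.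
rewrite -mulr_suml mulrA ltr_pdivrMr// mulrC ltr_pM2l//.
by rewrite /K ltrDl.
Qed.

End continuous_tuple_theory.

(** * Fourier series and Poisson summation *)

Section fourier.
Context {R : realType}.
Local Notation mR := (measurableTypeR R).
Variable n : nat.
Local Notation W := (n.-tuple mR).
Local Notation mu := (@lebesgue_tuple R n).
Implicit Types (B h S : W -> R[i]) (x y : n.-tuple R) (z m : n.-tuple int).

Lemma cmeasurable_chr m : cmeasurable setT (chr m : W -> R[i]).
Proof. by apply: cmeasurable_continuous; exact: continuous_chr. Qed.

Lemma weight_translation_le x y : weight (addt x y) <=
  4 ^+ n * \prod_(i < n) (1 + `|tnth x i|) ^+ 2 * weight y.
Proof.
rewrite -[n in 4 ^+ n]card_ord -prodr_const -!big_split/=.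
apply: ler_prod => i _; rewrite tnth_mktuple (ltW (weight1_gt0 _))/= /weight1.
set a := tnth x i; set b := tnth y i.
have h1 : 0 < 1 + `|a + b| by rewrite ltr_wpDr.
have h2 : 0 < 1 + `|b| by rewrite ltr_wpDr.
have h3 : 0 < 1 + `|a| by rewrite ltr_wpDr.
rewrite ler_pdivlMr ?exprn_gt0// mulrC ler_pdivrMr ?exprn_gt0//.
rewrite (_ : 4 * _ * _ = (2 * (1 + `|a|) * (1 + `|a + b|)) ^+ 2); last by ring.
apply: lerXn2r; rewrite ?nnegrE ?mulr_ge0 ?(ltW h1) ?(ltW h2) ?(ltW h3)//.
have h4 : `|b| <= `|a + b| + `|a|.
  by rewrite -[b in leLHS](addKr a) addrC (le_trans (ler_normD _ _))// normrN.
have := mulr_ge0 (normr_ge0 a) (normr_ge0 (a + b)); have := normr_ge0 (a + b).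
have := normr_ge0 a; nra.
Qed.

(** The sum over the integral translates converges uniformly on bounded sets,
    since a translation changes the weight by a bounded factor there. *)
Lemma periodization h (C : R) : (forall x, normc (h x) <= C * weight x) ->
  exists S : W -> R[i], forall x (J : {fset n.-tuple int}),
   normc (\sum_(z <- J) h (addt x (intr_tuple z)) - S x) <=
   (2 * (C * (4 ^+ n * \prod_(i < n) (1 + `|tnth x i|) ^+ 2))) *
     tail (fun z => weight (intr_tuple z : n.-tuple R)) J.
Proof.
move=> hC.
have C0 : 0 <= C.
  have := le_trans (normc_ge0 _) (hC [tuple 0 | i < n]).
  by rewrite pmulr_lge0// weight_gt0.
suff /boolp.choice[S hS] : forall x : W, exists l : R[i], forall J : {fset n.-tuple int},
   normc (\sum_(z <- J) h (addt x (intr_tuple z)) - l) <=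
   (2 * (C * (4 ^+ n * \prod_(i < n) (1 + `|tnth x i|) ^+ 2))) *
     tail (fun z => weight (intr_tuple z : n.-tuple R)) J by exists S.
move=> x; set c := 4 ^+ n * _.
have c0 : 0 <= c by rewrite mulr_ge0 ?exprn_ge0 ?prodr_ge0// => i _; rewrite exprn_ge0.
have hM := @summable_weight_int R n.
have hM' : summable_weight (fun z : n.-tuple int => (C * c) * weight (intr_tuple z)).
  apply: (summable_weight_bound hM (mulr_ge0 C0 c0)) => z.
  by rewrite lexx (mulr_ge0 (mulr_ge0 C0 c0) (ltW (weight_gt0 _))).
have [z|l hl] := @dominated_sum _ _ _ (fun z => h (addt x (intr_tuple z))) hM'.
  apply: le_trans (hC _) _; rewrite -mulrA ler_wpM2l//.
  exact: weight_translation_le.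
exists l => J; apply: le_trans (hl J) _.
rewrite -mulrA ler_pM2l//; apply: tailZ_le => //; exact: mulr_ge0.
Qed.

Lemma unfolding_sum B h S (C : R) : zperiodic B -> cmeasurable setT B ->
  cintegrable mu cube B -> cmeasurable setT h ->
  (forall x, normc (h x) <= C * weight x) ->
  (forall x, cube x -> has_sum setT (fun z => h (addt x (intr_tuple z))) (S x)) ->
  cintegrable mu setT (fun x => B x * h x) /\
  cint mu setT (fun x => B x * h x) = mean (fun x => B x * S x).
Proof.
move=> pB mB iB mh hC hS.
have hM := @summable_weight_int R n.
have [P hP] := periodization hC.
have C0 : 0 <= C.
  have := le_trans (normc_ge0 _) (hC [tuple 0 | i < n]).
  by rewrite pmulr_lge0// weight_gt0.
have bnd x : cube x -> \prod_(i < n) (1 + `|tnth x i|) ^+ 2 <= 4 ^+ n :> R.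
  move=> cx; rewrite -[n in leRHS]card_ord -prodr_const; apply: ler_prod => i _.
  rewrite exprn_ge0/= ?addr_ge0// (_ : 4 = 2 ^+ 2); last by ring.
  by apply: lerXn2r; rewrite ?nnegrE ?addr_ge0//; have := cube_le1 i cx; lra.
have prod0 x : 0 <= \prod_(i < n) (1 + `|tnth x i|) ^+ 2 :> R.
  by apply: prodr_ge0 => i _; rewrite exprn_ge0// addr_ge0.
have PS x : cube x -> P x = S x.
  move=> cx; apply: has_sum_unique (hS x cx); apply: tail_has_sum (hP x) => //.
  by rewrite !mulr_ge0// exprn_ge0.
have S' x (J : {fset n.-tuple int}) : cube x ->
   normc (\sum_(z <- J) h (addt x (intr_tuple z)) - S x) <=
   2 * (C * (4 ^+ n * 4 ^+ n)) * tail (fun z => weight (intr_tuple z : n.-tuple R)) J.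
  move=> cx; rewrite -PS//; apply: le_trans (hP x J) _.
  rewrite ler_wpM2r ?tail_ge0// ler_pM2l// ler_wpM2l// ler_wpM2l ?exprn_ge0//.
  exact: bnd.
split; first exact: (unfolding_integrable pB mB iB mh hC).
by apply: (unfolding pB mB iB mh hC hM _ S'); rewrite !mulr_ge0// exprn_ge0.
Qed.

(** Unfold P against the indicator of a translated cube, whose integral translates
    sum to 1. *)
Lemma mean_addt P y : zperiodic P -> cmeasurable setT P -> cintegrable mu cube P ->
  mean (fun x => P (addt x y)) = mean P.
Proof.
move=> pP mP iP.
pose h (x : W) : R[i] := (\1_(cube (n := n)) (addt x (oppt y)))%:C.
have mc := @measurable_cube R n.
have mh : cmeasurable setT h.
  apply: (@cmeasurable_addt R n (oppt y) (fun x => (\1_cube x)%:C)).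
  by split; [exact: measurable_indic|exact: measurable_cst].
have hC x : normc (h x) <= (4 ^+ n / weight y) * weight x.
  rewrite /h normc_real indicE; case: (boolP (_ \in _)) => [/set_mem cx|_]; last first.
    by rewrite normr0 !mulr_ge0 ?exprn_ge0 ?invr_ge0// ltW// weight_gt0.
  rewrite normr1 mulrAC ler_pdivlMr ?weight_gt0// mul1r.
  have <- : addt (oppt (addt x (oppt y))) x = y.
    by apply: eq_from_tnth => i; rewrite !tnth_mktuple; ring.
  apply: weight_addt_le => i; rewrite tnth_mktuple normrN; exact: cube_le1.
have hS x : cube x -> has_sum setT (fun z => h (addt x (intr_tuple z))) 1.
  move=> _; set x' := addt x (oppt y).
  pose z0 := zoppt (floor_tuple x').
  have e z : addt (addt x (intr_tuple z)) (oppt y) = addt x' (intr_tuple z).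
    by apply: eq_from_tnth => i; rewrite !tnth_mktuple; ring.
  have <- : h (addt x (intr_tuple z0)) = 1.
    rewrite /h e indicE mem_set//.
    rewrite (_ : intr_tuple z0 = oppt (intr_tuple (floor_tuple x'))); first exact: cube_floor.
    by apply: eq_from_tnth => i; rewrite !tnth_mktuple mulrNz.
  apply: has_sum_single => // z _ zz0; rewrite /h e indicE memNset//= => cx.
  case/eqP: zz0; apply: eq_from_tnth => i; have := cx i.
  rewrite /z0 !tnth_mktuple/= in_itv/= => /andP[c0 c1].
  apply/eqP; rewrite -eqr_oppLR eq_sym; apply/eqP/floor_def.
  by rewrite intrD mulrNz; apply/andP; split; lra.
have [i1 e1] := unfolding_sum pP mP iP mh hC hS.
have -> : mean P = mean (fun x => P x * 1).
  by apply: eq_cint => x _; rewrite mulr1.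
rewrite -[RHS]e1; have [_ <-] := tint_addt y i1.
rewrite /mean cint_indic; apply: eq_cint => x _.
by rewrite mulrC /h addtK.
Qed.

Lemma cintegrable_cube_bounded h (K : R) : cmeasurable cube h ->
  (forall x, cube x -> normc (h x) <= K) -> cintegrable mu cube h.
Proof.
by move=> mh hK; exact: (cintegrable_dominated (@measurable_cube R n) mh (integrable_cube_cst n K)).
Qed.

Lemma cintegrable_cube_chr m : cintegrable mu cube (chr m : W -> R[i]).
Proof.
apply: (@cintegrable_cube_bounded _ 1) => [|x _]; last by rewrite normc_chr.
by apply: (cmeasurableS measurableT) => //; exact: cmeasurable_chr.
Qed.

(** A nontrivial character changes sign under a half period in one direction,
    whereas its mean is invariant under translation. *)
Lemma mean_chr m : mean (chr m : W -> R[i]) = (m == zerot n)%:R.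
Proof.
case: eqVneq => [->|m0].
  rewrite /mean (@eq_cint _ _ _ _ _ _ (fun=> 1)); last by move=> x _; rewrite chr_zerot.
  by congr (_ +i* _); rewrite /= Rintegral_cube_cst.
have [i mi] : exists i, tnth m i != 0.
  apply/existsP; apply: contraNT m0; rewrite negb_exists => /forallP h.
  apply/eqP/eq_from_tnth => i; rewrite tnth_mktuple; apply/eqP.
  by have := h i; rewrite negbK.
pose y : n.-tuple R := [tuple if j == i then (2 * (tnth m i)%:~R)^-1 else 0 | j < n].
have my : chr m y = -1.
  rewrite -expi2pi_half; congr expi2pi; rewrite /dot (bigD1 i)//= big1 ?addr0.
    rewrite tnth_mktuple eqxx; field; rewrite intr_eq0 mi.
    by [].
  by move=> j ji; rewrite tnth_mktuple (negbTE ji) mulr0.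
have := mean_addt y (@chr_zperiodic R n m) (cmeasurable_chr m) (cintegrable_cube_chr m).
have -> : mean (fun x => chr m (addt x y)) = - mean (chr m : W -> R[i]).
  rewrite -mulN1r -(cintZ (@measurable_cube R n)); last exact: cintegrable_cube_chr.
  by apply: eq_cint => x _; rewrite chr_addt my mulrC.
by move/eqP; rewrite eqNr => /eqP.
Qed.

(** A continuous periodic function all of whose Fourier coefficients vanish is
    orthogonal to every trigonometric polynomial. The powers of eps + peak, where
    peak is the product of the (1 + cos (2 pi (x_i - y_i))) / 2, are positive, and
    they grow exponentially only close to the translates of y, which forces the
    value at y to be 0. *)
Section uniqueness.
Variables (G : W -> R[i]) (K : R) (y : n.-tuple R).
Hypotheses (cG : continuous_tuple (G : n.-tuple R -> R[i])) (pG : zperiodic G).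
Hypothesis hK : forall x, cube x -> normc (G x) <= K.
Hypothesis hG : forall m, mean (fun x => G x * chr m x) = 0.
Hypothesis cy : cube y.

(** Orthogonality to all the products of q with a character, and not to q alone, is
    what survives multiplication of q by a cosine. *)
Definition annihilated (q : W -> R) := [/\ measurable_fun setT q,
  exists L, forall x, `|q x| <= L &
  forall m, mean (fun x => G x * (q x)%:C * chr m x) = 0].

Let mG : cmeasurable setT G. Proof. exact: cmeasurable_continuous. Qed.

Let K0 : 0 <= K. Proof. exact: le_trans (normc_ge0 _) (hK cy). Qed.

Let mcube := @measurable_cube R n.

Lemma annihilated_integrable q m : annihilated q ->
  cintegrable mu cube (fun x => G x * (q x)%:C * chr m x).
Proof.
move=> [mq [L hL] _]; apply: (@cintegrable_cube_bounded _ (K * L * 1)).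
  apply: (cmeasurableS measurableT) => //; apply: cmeasurableM; last exact: cmeasurable_chr.
  by apply: cmeasurableM => //; split => //; exact: measurable_cst.
move=> x cx; rewrite !normcM normc_chr normc_real.
by rewrite ler_wpM2r// ler_pM ?normc_ge0 ?hK.
Qed.

Lemma annihilated1 : annihilated (fun=> 1).
Proof.
split=> [||m]; [exact: measurable_cst|by exists 1 => x; rewrite normr1|].
by rewrite -[RHS](hG m); apply: eq_cint => x _; rewrite mulr1.
Qed.

Lemma annihilated_lin (a b : R) q q' : annihilated q -> annihilated q' ->
  annihilated (fun x => a * q x + b * q' x).
Proof.
move=> aq aq'; have [mq [L hL] hq] := aq; have [mq' [L' hL'] hq'] := aq'; split=> [||m].
- by apply: measurable_funD; apply: measurable_funM => //; exact: measurable_cst.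
- exists (`|a| * L + `|b| * L') => x; rewrite (le_trans (ler_normD _ _))// !normrM.
  by rewrite lerD// ler_wpM2l.
have -> : mean (fun x => G x * (a * q x + b * q' x)%:C * chr m x) =
    mean (fun x => a%:C * (G x * (q x)%:C * chr m x) +
                   b%:C * (G x * (q' x)%:C * chr m x)).
  by apply: eq_cint => x _; rewrite rmorphD !rmorphM/=; ring.
rewrite /mean cintD ?cintZ//; try exact: annihilated_integrable.
- by rewrite -!/(mean _) hq hq' !mulr0 addr0.
- by apply: cintegrableZ => //; exact: annihilated_integrable.
- by apply: cintegrableZ => //; exact: annihilated_integrable.
Qed.

Lemma annihilated_cos i q : annihilated q ->
  annihilated (fun x : W => cos (2 * pi * ((tnth x i : R) - tnth y i)) * q x).
Proof.
move=> aq; have [mq [L hL] hq] := aq; split=> [||m].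
- apply: measurable_funM => //.
  apply: (@measurableT_comp _ _ _ _ _ _ (fun t : R => cos (2 * pi * (t - tnth y i))) _
    (fun x : W => tnth x i)); last exact: (@measurable_tnth _ mR n i).
  apply: continuous_measurable_fun => t.
  apply: (@continuous_comp _ _ _ (fun t : R => 2 * pi * (t - tnth y i)) cos).
    by apply: cvgMr; apply: cvgD; [exact: cvg_id|exact: cvg_cst].
  exact: continuous_cos.
- exists L => x; rewrite normrM -[leRHS]mul1r ler_pM//; exact: cos_max.
pose d : n.-tuple int := [tuple (j == i)%:R | j < n].
have dE x : chr d x = expi2pi (tnth x i).
  congr expi2pi; rewrite /dot (bigD1 i)//= big1 ?addr0.
    by rewrite tnth_mktuple eqxx mul1r.
  by move=> j ji; rewrite tnth_mktuple (negbTE ji) mul0r.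
have cosE (t : R) : (cos (2 * pi * t))%:C = 2^-1 * (expi2pi t + expi2pi (- t)).
  rewrite [expi2pi (- t)]/expi2pi mulrN cosN sinN; apply/eqP; rewrite eq_complex.
  rewrite -(rmorph_nat (real_complex R) 2) -fmorphV cReM cImM /=.
  by apply/andP; split; apply/eqP; field.
have -> : mean (fun x : W => G x * (cos (2 * pi * ((tnth x i : R) - tnth y i)) * q x)%:C * chr m x) =
    mean (fun x => (2^-1 * expi2pi (- tnth y i)) * (G x * (q x)%:C * chr (zaddt m d) x) +
                   (2^-1 * expi2pi (tnth y i)) * (G x * (q x)%:C * chr (zaddt m (zoppt d)) x)).
  apply: eq_cint => x _; rewrite rmorphM/= cosE !chr_zaddt chr_zoppt dE -expi2piN.
  by rewrite opprB !expi2piD; ring.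
rewrite /mean cintD ?cintZ//; try exact: annihilated_integrable.
- by rewrite -!/(mean _) !hq !mulr0 addr0.
- by apply: cintegrableZ => //; exact: annihilated_integrable.
- by apply: cintegrableZ => //; exact: annihilated_integrable.
Qed.

Definition peak1 i (x : W) : R := (1 + cos (2 * pi * ((tnth x i : R) - tnth y i))) / 2.
Definition peak (x : W) : R := \prod_(i < n) peak1 i x.

Lemma peak1_itv i x : 0 <= peak1 i x <= 1.
Proof.
rewrite /peak1; set t := cos _; have h1 : t <= 1 by exact: cos_le1.
have h2 : -1 <= t by exact: cos_geN1.
by apply/andP; split; lra.
Qed.

Lemma annihilated_peak q : annihilated q -> annihilated (fun x => peak x * q x).
Proof.
move=> aq; rewrite /peak; elim: (index_enum _) => [|i s IH].
  by under eq_fun do rewrite big_nil mul1r.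
under eq_fun do rewrite big_cons -mulrA.
have := annihilated_lin 2^-1 2^-1 IH (annihilated_cos i IH).
by congr annihilated; apply/funext => x; rewrite /peak1; field.
Qed.

Lemma annihilated_power eps k : annihilated (fun x => (eps + peak x) ^+ k).
Proof.
elim: k => [|k IH]; first exact: annihilated1.
have := annihilated_lin eps 1 IH (annihilated_peak IH).
by congr annihilated; apply/funext => x; rewrite exprS; ring.
Qed.

(** A product of factors in [0, 1] that is close to 1 has all its factors close to
    1, and the cosine is close to 1 only near its periods. *)
Lemma peak_near d : 0 < d -> d < 1 / 2 ->
  exists2 eps, 0 < eps & forall x : W, 1 - 2 * eps < peak x ->
    exists z, forall i, `|(tnth x i : R) - (tnth z i)%:~R - tnth y i| < d.
Proof.
move=> d0 d1; pose kap : R := cos (2 * pi * d).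
have pi0 := pi_gt0 R.
have mem0 : (0 : R) \in `[0, pi] by rewrite in_itv/= lexx ltW.
have memd (t : R) : 0 <= t -> t <= 1 / 2 -> 2 * pi * t \in `[0, pi].
  move=> t0 t1; rewrite in_itv/= !mulr_ge0 ?(ltW pi0)//= mulrAC.
  by rewrite ger_pMl//; lra.
have kap1 : kap < 1.
  rewrite /kap -[ltRHS]cos0 ltr_cos//; last exact: memd _ (ltW d0) (ltW d1).
  by rewrite !mulr_gt0.
exists ((1 - kap) / 4) => [|x hx]; first by rewrite divr_gt0// subr_gt0.
exists [tuple Num.floor ((tnth x i : R) - tnth y i + 1 / 2) | i < n] => i.
rewrite tnth_mktuple; set t := (tnth x i : R) - tnth y i.
set k := Num.floor _; rewrite -addrA [- _ - _]addrC addrA -/t.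
have hi : 1 - 2 * ((1 - kap) / 4) < peak1 i x.
  apply: lt_le_trans hx _; rewrite /peak (bigD1 i)//= -[leRHS]mulr1.
  have /andP[b0 b1] := peak1_itv i x; rewrite ler_wpM2l//.
  by apply: prodr_ile1 => j _; exact: peak1_itv.
have hc : kap < cos (2 * pi * (t - k%:~R)).
  have -> : cos (2 * pi * (t - k%:~R)) = cos (2 * pi * t).
    have := expi2piD (t - k%:~R) k%:~R; rewrite expi2pi_int mulr1 subrK.
    by move=> /(congr1 (@complex.Re R)) /= ->.
  by move: hi; rewrite /peak1 -/t; set u := cos _; lra.
have /andP[k0 k1] := floor_itv (t + 1 / 2); rewrite -/k in k0 k1.
have tk : `|t - k%:~R| <= 1 / 2.
  by rewrite ler_norml; move: k1; rewrite intrD; move=> k1; apply/andP; split; lra.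
move: hc; rewrite /kap -[cos (2 * pi * (t - _))]cos_norm !normrM.
rewrite (ger0_norm (ltW pi0)) ger0_norm//.
rewrite ltr_cos; [|exact: memd|exact: memd _ (ltW d0) (ltW d1)].
by rewrite ltr_pM2l// mulr_gt0.
Qed.

Lemma prod_ge_1B (I : Type) (s : seq I) (F : I -> R) (d : R) :
  (forall i, 0 <= F i <= 1) -> (forall i, 1 - d <= F i) ->
  1 - (size s)%:R * d <= \prod_(i <- s) F i.
Proof.
move=> F01 Fd; elim: s => [|i s IH]; first by rewrite big_nil mul0r subr0.
rewrite big_cons/= -natr1 mulrDl mul1r.
have /andP[f0 f1] := F01 i; have := Fd i.
have p1 : \prod_(j <- s) F j <= 1 by apply: prodr_ile1 => j _.
have p0 : 0 <= \prod_(j <- s) F j by apply: prodr_ge0 => j _; case/andP: (F01 j).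
nra.
Qed.

Lemma bernoulli_ineq (e : R) k : 0 <= e -> 1 + k%:R * e <= (1 + e) ^+ k.
Proof.
move=> e0; elim: k => [|k IH]; first by rewrite mul0r addr0 expr0.
rewrite exprS -natr1 (le_trans _ (ler_wpM2l _ IH)) ?addr_ge0//.
by have : 0 <= k%:R :> R by []; nra.
Qed.

(** The box leaves y towards larger coordinates only, so that it stays in the cube
    even if y lies on its boundary. *)
Lemma peak_box eps : 0 < eps -> exists2 eta, 0 < eta &
  let Q := [set x : W | forall i, `[tnth y i, tnth y i + eta[%classic (tnth x i : R)] in
  Q `<=` cube /\ forall x, Q x -> 1 - eps <= peak x.
Proof.
move=> eps0; pose d := eps / n.+1%:R.
have d0 : 0 < d by rewrite divr_gt0.
have [eta0 eta00 h0] : exists2 e, 0 < e & forall t : R, `|t| < e -> 1 - 2 * d < cos (2 * pi * t).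
  have c0 : {for 0, continuous (fun s : R => 2 * pi * s)} by exact: mulrl_continuous.
  have := continuous_comp c0 (@continuous_cos R _).
  move/cvgrPdist_lt => /(_ (2 * d)); rewrite /= mulr0 cos0.
  move=> /(_ (mulr_gt0 (ltr0Sn _ 1) d0))/nbhs_ballP[e e0 he]; exists e => // t te.
  have : `|1 - cos (2 * pi * t)| < 2 * d by apply: he; rewrite /ball/= sub0r normrN.
  by rewrite ltr_norml => /andP[_]; lra.
pose eta := \big[Num.min/eta0]_(i < n) (1 - tnth y i).
have eta_gt0 : 0 < eta.
  rewrite /eta; elim/big_ind : _ => //; first by move=> a b a0 b0; rewrite lt_min a0.
  by move=> i _; have := cy i; rewrite /= in_itv/= subr_gt0 => /andP[].
exists eta => //=; split=> x Qx.
  move=> i; have := Qx i; have := cy i; rewrite /= !in_itv/= => /andP[y0 y1] /andP[x0 x1].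
  rewrite (le_trans y0 x0)/=; apply: lt_le_trans x1 _.
  by rewrite addrC -lerBrDr; apply: bigmin_le_cond.
have := @prod_ge_1B _ (index_enum 'I_n) (peak1 ^~ x) d (fun i => peak1_itv i x).
have -> : size (index_enum 'I_n) = n by rewrite -sum1_size sum_nat_const card_ord muln1.
move=> h; apply: (le_trans _ (h _)) => [|i].
  rewrite lerD2l lerN2 /d mulrA ler_pdivrMr// mulrC ler_pM2l//.
  by rewrite ler_nat.
have := Qx i; rewrite /= in_itv/= => /andP[x0 x1].
have : 1 - 2 * d < cos (2 * pi * ((tnth x i : R) - tnth y i)).
  apply: h0; rewrite ger0_norm ?subr_ge0// ltrBlDl; apply: lt_le_trans x1 _.
  by rewrite lerD2l; apply: bigmin_le_id.
by rewrite /peak1; set u := cos _; lra.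
Qed.

(** If G y were 1, then Re G would be at least 1/2 wherever eps + peak can exceed 1.
    The k-th power of eps + peak is orthogonal to G, its integral over the box grows
    like (1 + eps / 2)^k, and where it is at most 1 it contributes at least - K:
    this is impossible for large k. *)
Lemma annihilated_neq1 : G y <> 1.
Proof.
move=> Gy1.
have [d0 d00 hd0] := cG y (divr_gt0 (@ltr01 R) (ltr0Sn R 1)).
pose d := Num.min d0 (1 / 4).
have d_gt0 : 0 < d by rewrite lt_min d00 divr_gt0.
have d_lt : d < 1 / 2 by rewrite gt_min; apply/orP; right; lra.
have [eps eps0 heps] := peak_near d_gt0 d_lt.
have near x : 1 - 2 * eps < peak x -> 1 / 2 < complex.Re (G x).
  move=> /heps[z hz]; rewrite -(pG x (zoppt z)).
  have : normc (G (addt x (intr_tuple (zoppt z))) - G y) < 1 / 2.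
    apply: hd0 => i; rewrite !tnth_mktuple mulrNz; apply: lt_le_trans (hz i) _.
    by rewrite ge_min lexx.
  move=> /(le_lt_trans (le_Re_normc _)); rewrite Gy1 cReD /= ltr_norml => /andP[+ _].
  lra.
have [eta eta0 [Qcube Qpeak]] := peak_box (divr_gt0 eps0 (ltr0Sn R 1)).
set Q := mkset _ in Qcube Qpeak.
have mQ : measurable (Q : set W).
  by apply: (@measurable_box R n (fun i => `[tnth y i, tnth y i + eta[%classic)) => i.
have muQ : mu Q = (eta ^+ n)%:E.
  rewrite (@lebesgue_tuple_box R n (fun i => `[tnth y i, tnth y i + eta[%classic))//.
  rewrite (eq_bigr (fun=> eta%:E)) => [|i _].
    by rewrite prodEFin prodr_const card_ord.
  rewrite lebesgue_measure_itv/= lte_fin ltrDl eta0.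
  by rewrite -EFinD addrAC subrr add0r.
pose T (x : W) := eps + peak x.
have T0 x : 0 < T x by rewrite ltr_pwDl// prodr_ge0// => i _; case/andP: (peak1_itv i x).
pose e2 := 1 + eps / 2.
have e20 : 0 < e2 by rewrite addr_gt0// divr_gt0.
pose low k (x : W) := 2^-1 * e2 ^+ k * \1_Q x - K.
have main k : 2^-1 * e2 ^+ k * eta ^+ n - K <= 0.
  have := (annihilated_power eps k); case=> _ _ /(_ (zerot n)).
  have := annihilated_integrable (zerot n) (annihilated_power eps k).
  rewrite /mean /cint => -[i1 _] /(congr1 (@complex.Re R))/= e0.
  have iQ : mu.-integrable cube (fun x => (\1_Q x)%:E).
    apply: (le_integrable mcube _ _ (integrable_cube_cst n 1)).
      by apply/measurable_EFinP; exact: measurable_indic.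
    move=> x _; rewrite /= lee_fin indicE; case: (_ \in _) => //.
    by rewrite normr0 normr1.
  have il : mu.-integrable cube (fun x => (low k x)%:E).
    rewrite /low; under eq_fun do rewrite EFinB EFinM.
    apply: integrableB => //; [exact: integrableZl|exact: integrable_cube_cst].
  have -> : 2^-1 * e2 ^+ k * eta ^+ n - K = \int[mu]_(x in cube) low k x.
    rewrite /low RintegralB//; last exact: integrable_cube_cst.
      rewrite Rintegral_cube_cst RintegralZl//; congr (_ * _ - _).
      by rewrite /Rintegral integral_indic// (setIidl Qcube) [X in fine X]muQ.
    exact: (integrableZl mcube _ iQ).
  rewrite -[leRHS]e0; apply: le_Rintegral => // x cx.
  rewrite chr_zerot mulr1 cReM /= mulr0 subr0 -/(T x) /low indicE.
  have hGx := le_trans (le_Re_normc _) (hK cx).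
  have Tk0 : 0 < T x ^+ k by rewrite exprn_gt0.
  case: (ltP (1 - 2 * eps) (peak x)) => hb.
    have hR := near _ hb.
    apply: (@le_trans _ _ (2^-1 * T x ^+ k)); last first.
      by rewrite ler_wpM2r ?(ltW Tk0)//; move: hR; lra.
    case: (boolP (x \in Q)) => [/set_mem/Qpeak xQ|_]; last first.
      by rewrite mulr0 sub0r (@le_trans _ _ 0) ?oppr_le0// mulr_ge0 ?invr_ge0 ?(ltW Tk0).
    rewrite mulr1 lerBlDr (@le_trans _ _ (2^-1 * T x ^+ k)) ?lerDl//.
    rewrite ler_pM2l ?invr_gt0// lerXn2r ?nnegrE ?(ltW e20) ?(ltW (T0 x))//.
    by rewrite /e2 /T; move: xQ; lra.
  rewrite memNset ?mulr0 ?sub0r; last by move=> /Qpeak; lra.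
  have T1 : T x ^+ k <= 1 by rewrite exprn_ile1// ?(ltW (T0 x))// /T; move: hb; lra.
  move: hGx; rewrite ler_norml => /andP[g1 _].
  apply: (@le_trans _ _ (- K * T x ^+ k)).
    by rewrite mulNr lerN2 ler_piMr.
  by rewrite ler_wpM2r// ltW.
pose c := 2^-1 * eta ^+ n.
have c0 : 0 < c by rewrite mulr_gt0 ?invr_gt0 ?exprn_gt0.
pose k := (Num.truncn (K / c / (eps / 2))).+1.
have := main k; rewrite mulrAC -/c subr_le0; apply/negP; rewrite -ltNge.
apply: (@lt_le_trans _ _ (c * (1 + k%:R * (eps / 2)))); last first.
  by rewrite ler_pM2l// bernoulli_ineq// ltW// divr_gt0.
rewrite mulrC -ltr_pdivrMr// ltr_pwDl// -ler_pdivrMr ?divr_gt0// ltW//.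
by rewrite /k; have := truncnS_gt (K / c / (eps / 2)).
Qed.

End uniqueness.

Lemma fourier_uniqueness (G : W -> R[i]) (K : R) y :
  continuous_tuple (G : n.-tuple R -> R[i]) -> zperiodic G ->
  (forall x, cube x -> normc (G x) <= K) ->
  (forall m, mean (fun x => G x * chr m x) = 0) -> cube y -> G y = 0.
Proof.
move=> cG pG hK hG cy; apply/eqP/negPn/negP => Gy0.
have mG : cmeasurable setT G by exact: cmeasurable_continuous.
apply: (@annihilated_neq1 (fun x => (G y)^-1 * G x) (normc (G y)^-1 * K) y) => //.
- exact: continuous_tupleZ.
- by move=> x z /=; rewrite pG.
- by move=> x cx; rewrite normcM ler_wpM2l ?normc_ge0// hK.
- move=> m; have -> : mean (fun x => (G y)^-1 * G x * chr m x) =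
    mean (fun x => (G y)^-1 * (G x * chr m x)).
    by apply: eq_cint => x _; rewrite mulrA.
  rewrite /mean cintZ; [by rewrite -/(mean _) hG mulr0|exact: measurable_cube|].
  apply: (@cintegrable_cube_bounded _ (K * 1)) => [|x cx].
    apply: (cmeasurableS measurableT) => //; apply: cmeasurableM => //.
    exact: cmeasurable_chr.
  by rewrite normcM normc_chr !mulr1 hK.
- by rewrite mulVf.
Qed.

End fourier.

Section poisson.
Context {R : realType}.
Local Notation mR := (measurableTypeR R).
Variable n : nat.
Local Notation W := (n.-tuple mR).
Local Notation mu := (@lebesgue_tuple R n).
Local Notation wz := (fun z : n.-tuple int => weight (intr_tuple z : n.-tuple R)).
Implicit Types (B h S : W -> R[i]) (x y : n.-tuple R) (z m : n.-tuple int).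

Let mcube := @measurable_cube R n.

(** The Fourier transform of h at the integral point - m. *)
Definition coef h m := cint mu setT (fun x => chr m x * h x).

Lemma has_sum_zperiodic h S :
  (forall x, has_sum setT (fun z => h (addt x (intr_tuple z))) (S x)) -> zperiodic S.
Proof.
move=> hS x z; apply: has_sum_unique (hS (addt x (intr_tuple z))) _.
have zK z' : zaddt (zoppt z) (zaddt z z') = z'.
  by apply: eq_from_tnth => i; rewrite !tnth_mktuple addKr.
have zK' z' : zaddt z (zaddt (zoppt z) z') = z'.
  by apply: eq_from_tnth => i; rewrite !tnth_mktuple addNKr.
apply: (@has_sum_reindex _ _ _ setT (zaddt (zoppt z)) (zaddt z) setT) => //.
apply: eq_has_sum (hS x) => z' _ /=; congr h; apply: eq_from_tnth => i.
by rewrite !tnth_mktuple intrD mulrNz; ring.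
Qed.

Section poisson_formula.
Variables (h S : W -> R[i]) (C C' : R).
Hypotheses (ch : continuous_tuple (h : n.-tuple R -> R[i])).
Hypothesis hC : forall x, normc (h x) <= C * weight x.
Hypothesis hC' : forall m, normc (coef h m) <= C' * wz m.
Hypothesis hS : forall x, has_sum setT (fun z => h (addt x (intr_tuple z))) (S x).

Let mh : cmeasurable setT h. Proof. exact: cmeasurable_continuous. Qed.

Let C0 : 0 <= C.
Proof.
have := le_trans (normc_ge0 _) (hC [tuple 0 | i < n]).
by rewrite pmulr_lge0// weight_gt0.
Qed.

Let C'0 : 0 <= C'.
Proof.
have := le_trans (normc_ge0 _) (hC' (zerot n)).
by rewrite pmulr_lge0// weight_gt0.
Qed.

Let growth x : R := \prod_(i < n) (1 + `|tnth x i|) ^+ 2.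

Let growth_ge0 x : 0 <= growth x.
Proof. by apply: prodr_ge0 => i _; rewrite exprn_ge0// addr_ge0. Qed.

Let hM := @summable_weight_int R n.

Let S_bound x (J : {fset n.-tuple int}) :
  normc (\sum_(z <- J) h (addt x (intr_tuple z)) - S x) <=
  2 * (C * (4 ^+ n * growth x)) * tail wz J.
Proof.
have [P hP] := periodization hC.
rewrite (_ : S x = P x); first exact: hP.
apply: has_sum_unique (hS x) _; apply: tail_has_sum (hP x) => //.
by rewrite mulr_ge0// mulr_ge0// mulr_ge0 ?exprn_ge0//; exact: growth_ge0.
Qed.

Let continuous_S : continuous_tuple (S : n.-tuple R -> R[i]).
Proof.
pose c x := 2 * (C * (4 ^+ n * \prod_(i < n) (2 + `|tnth x i|) ^+ 2)).
apply: (@continuous_dominated_sum R n _ wz (fun z x => h (addt x (intr_tuple z))) S c) => //.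
- move=> x; rewrite /c !mulr_ge0 ?exprn_ge0//; apply: prodr_ge0 => i _.
  by apply: exprn_ge0; rewrite addr_ge0.
- by move=> z; exact: continuous_tuple_addt.
move=> x y J xy; apply: le_trans (S_bound y J) _.
rewrite ler_wpM2r ?tail_ge0// ler_pM2l// ler_wpM2l// ler_wpM2l ?exprn_ge0//.
apply: ler_prod => i _; rewrite exprn_ge0/= ?addr_ge0//.
apply: lerXn2r; rewrite ?nnegrE ?addr_ge0//.
have := xy i; have := lerB_dist (tnth y i) (tnth x i); lra.
Qed.

Let fourier_sum : exists Q : W -> R[i], forall x (J : {fset n.-tuple int}),
  normc (\sum_(m <- J) coef h m * chr (zoppt m) x - Q x) <= 2 * C' * tail wz J.
Proof.
suff /boolp.choice[Q hQ] : forall x : W, exists l : R[i], forall J : {fset n.-tuple int},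
   normc (\sum_(m <- J) coef h m * chr (zoppt m) x - l) <= 2 * C' * tail wz J by exists Q.
move=> x.
have hM' : summable_weight (fun z : n.-tuple int => C' * wz z).
  apply: (summable_weight_bound hM C'0) => z.
  by rewrite lexx mulr_ge0// ltW// weight_gt0.
have [m|l hl] := @dominated_sum _ _ _ (fun m => coef h m * chr (zoppt m) x) hM'.
  by rewrite normcM normc_chr mulr1.
by exists l => J; apply: le_trans (hl J) _; rewrite -mulrA ler_pM2l// tailZ_le.
Qed.

Let coef_S m : mean (fun x => chr m x * S x) = coef h m.
Proof.
have [_ <-//] := unfolding_sum (@chr_zperiodic R n m) (cmeasurable_chr m)
  (cintegrable_cube_chr m) mh hC (fun x _ => hS x).
Qed.

(** The periodization S and the sum Q of its Fourier series are continuous and have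
    the same Fourier coefficients, hence they coincide. *)
Lemma fourier_series_bound x (J : {fset n.-tuple int}) : cube x ->
  normc (\sum_(m <- J) coef h m * chr (zoppt m) x - S x) <= 2 * C' * tail wz J.
Proof.
have [Q hQ] := fourier_sum.
suff QS : forall y, cube y -> S y - Q y = 0.
  by move=> cx; rewrite (subr0_eq (QS x cx)).
have hQ' x' : has_sum setT (fun m => coef h m * chr (zoppt m) x') (Q x').
  by apply: (tail_has_sum hM _ (hQ x')); rewrite mulr_ge0.
have cQ : continuous_tuple (Q : n.-tuple R -> R[i]).
  apply: (@continuous_dominated_sum R n _ wz (fun m x => coef h m * chr (zoppt m) x)
    Q (fun=> 2 * C')) => //.
  - by move=> _; rewrite mulr_ge0.
  - by move=> m; apply: continuous_tupleZ; exact: continuous_chr.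
have cG : continuous_tuple (fun x => S x - Q x : R[i]).
  under eq_fun do rewrite -mulN1r; apply: continuous_tupleD => //.
  exact: continuous_tupleZ.
have mQ : cmeasurable setT Q by exact: cmeasurable_continuous.
have mS : cmeasurable setT S by exact: cmeasurable_continuous.
pose KS := 2 * (C * (4 ^+ n * 4 ^+ n)) * tail wz fset0.
pose KQ := 2 * C' * tail wz fset0.
have S_le x' : cube x' -> normc (S x') <= KS.
  move=> cx'; have := S_bound x' fset0; rewrite big_seq_fset0 sub0r normcN.
  move/le_trans; apply; rewrite ler_wpM2r ?tail_ge0// ler_pM2l// ler_wpM2l//.
  rewrite ler_wpM2l ?exprn_ge0//.
  rewrite -[n in leRHS]card_ord -prodr_const; apply: ler_prod => i _.
  rewrite exprn_ge0/= ?addr_ge0// (_ : 4 = 2 ^+ 2); last by ring.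
  by apply: lerXn2r; rewrite ?nnegrE ?addr_ge0//; have := cube_le1 i cx'; lra.
have Q_le x' : normc (Q x') <= KQ.
  by have := hQ x' fset0; rewrite big_seq_fset0 sub0r normcN.
move=> y cy; apply: (@fourier_uniqueness R n (fun x => S x - Q x) (KS + KQ) y) => //.
- move=> x' z; rewrite (has_sum_zperiodic hS); congr (_ - _).
  apply: has_sum_unique (hQ' _) _; apply: eq_has_sum (hQ' x') => m _.
  by rewrite (@chr_zperiodic R n).
- move=> x' cx'; rewrite (le_trans (le_normcD _ _))// normcN lerD// ?Q_le//.
  exact: S_le.
move=> m.
have iS : cintegrable mu cube (fun x => chr m x * S x).
  apply: (@cintegrable_cube_bounded _ _ _ KS) => [|x' cx'].
    apply: (cmeasurableS measurableT) => //; apply: cmeasurableM => //.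
    exact: cmeasurable_chr.
  by rewrite normcM normc_chr mul1r S_le.
have iQ : cintegrable mu cube (fun x => chr m x * Q x).
  apply: (@cintegrable_cube_bounded _ _ _ KQ) => [|x' cx'].
    apply: (cmeasurableS measurableT) => //; apply: cmeasurableM => //.
    exact: cmeasurable_chr.
  by rewrite normcM normc_chr mul1r Q_le.
have -> : mean (fun x => (S x - Q x) * chr m x) =
    mean (fun x => chr m x * S x - chr m x * Q x).
  by apply: eq_cint => x' _; rewrite -mulrBr mulrC.
rewrite /mean cintB// -!/(mean _) coef_S; apply/eqP; rewrite subr_eq0; apply/eqP.
have mF k : cmeasurable cube (fun x : W => coef h k * chr (zoppt k) x).
  apply: cmeasurableM; first exact: cmeasurable_cst.
  by apply: (cmeasurableS measurableT) => //; exact: cmeasurable_chr.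
have C20 : 0 <= 2 * C' by rewrite mulr_ge0.
have := has_sum_cint mcube hM C20 mF (fun x' J _ => hQ x' J) (cintegrable_cube_chr m).
move=> hs; apply: (has_sum_unique _ hs).
have term k : cint mu cube (fun x => chr m x * (coef h k * chr (zoppt k) x)) =
    coef h k * (m == k)%:R.
  rewrite -zaddt_oppK -mean_chr /mean -cintZ//; last exact: cintegrable_cube_chr.
  by apply: eq_cint => x' _; rewrite chr_zaddt mulrCA.
rewrite -[coef h m]mulr1 -[1]/(true%:R) -[true](eqxx m) -term.
apply: (@has_sum_single _ _ _ (fun k => cint mu cube (fun x => chr m x * (coef h k * chr (zoppt k) x)))) => // k _ km.
by rewrite term eq_sym (negbTE km) mulr0.
Qed.

(** The Poisson summation formula: evaluate the Fourier series of the periodization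
    at 0. *)
Lemma poisson_summation : has_sum setT (coef h) (S [tuple 0 | i < n]).
Proof.
apply: (@tail_has_sum _ _ wz _ _ (2 * C')) => // [|J]; first by rewrite mulr_ge0.
have c0 : cube ([tuple 0 | i < n] : n.-tuple R).
  by move=> i; rewrite /= tnth_mktuple in_itv/= lexx ltr01.
have := fourier_series_bound J c0; congr (normc (_ - _) <= _).
apply: eq_bigr => m _; rewrite chr_zoppt (_ : chr m _ = 1) ?invr1 ?mulr1//.
by rewrite /chr /dot big1 ?expi2pi0// => i _; rewrite tnth_mktuple mulr0.
Qed.

(** Unfold, then integrate B against the uniformly convergent Fourier series of the
    periodization of h. *)
Lemma pairing B : zperiodic B -> cmeasurable setT B -> cintegrable mu cube B ->
  cintegrable mu setT (fun x => B x * h x) /\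
  has_sum setT (fun m => coef h m * mean (fun x => B x * chr (zoppt m) x))
    (cint mu setT (fun x => B x * h x)).
Proof.
move=> pB mB iB; have [i1 ->] := unfolding_sum pB mB iB mh hC (fun x _ => hS x).
split=> //.
have mF k : cmeasurable cube (fun x : W => coef h k * chr (zoppt k) x).
  apply: cmeasurableM; first exact: cmeasurable_cst.
  by apply: (cmeasurableS measurableT) => //; exact: cmeasurable_chr.
have C20 : 0 <= 2 * C' by rewrite mulr_ge0.
have := has_sum_cint mcube hM C20 mF (fun x' J => @fourier_series_bound x' J) iB.
apply: eq_has_sum => m _; rewrite /mean -cintZ//.
  by apply: eq_cint => x _; rewrite mulrCA.
apply: (cintegrable_bounded mcube (c := 1) iB) => [|x _]; last by rewrite normc_chr.
by apply: (cmeasurableS measurableT) => //; exact: cmeasurable_chr.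
Qed.

End poisson_formula.
End poisson.

(** * Periodic functions with prescribed Fourier coefficients *)

Lemma cvg_summable_increments (R : realType) (s v : nat -> R) (g : R) :
  (forall k, `|s k.+1 - s k| <= v k) -> (forall k, \sum_(0 <= j < k) v j <= g) ->
  cvgn s.
Proof.
move=> sv vg.
have v0 k : 0 <= v k by exact: le_trans (normr_ge0 _) (sv k).
have cv : cvgn (series v).
  apply: nondecreasing_is_cvgn; first by apply: nondecreasing_series => k _ _.
  by exists g => _ [k _ <-]; exact: vg.
have ct : cvgn (series (telescope s)).
  apply: normed_cvg; apply: series_le_cvg cv => k //=; exact: sv.
rewrite (funext (eq_sum_telescope s)); apply: is_cvgD => //; exact: is_cvg_cst.
Qed.

Lemma cint_ae_eq d (T : measurableType d) (R : realType)
    (mu : {measure set T -> \bar R}) (D : set T) (f g : T -> R[i]) : measurable D ->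
  cmeasurable D f -> cmeasurable D g -> {ae mu, forall x, D x -> f x = g x} ->
  cint mu D f = cint mu D g.
Proof.
move=> mD [f1 f2] [g1 g2] fg; congr (_ +i* _); congr fine; apply: ae_eq_integral => //.
- exact/measurable_EFinP.
- exact/measurable_EFinP.
- by apply: filterS fg => x h Dx; rewrite h.
- exact/measurable_EFinP.
- exact/measurable_EFinP.
- by apply: filterS fg => x h Dx; rewrite h.
Qed.

Section riesz_fischer.
Context {R : realType}.
Local Notation mR := (measurableTypeR R).
Variable n : nat.
Local Notation W := (n.-tuple mR).
Local Notation mu := (@lebesgue_tuple R n).
Implicit Types (x y : n.-tuple R) (z m : n.-tuple int) (J : {fset n.-tuple int}).
Variable a : n.-tuple int -> R[i].

Let mcube := @measurable_cube R n.

(** A partial sum of the Fourier series with coefficients a. *)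
Definition tpoly J (x : W) : R[i] := \sum_(m <- J) a m * chr m x.

Lemma cmeasurable_tpoly J : cmeasurable setT (tpoly J).
Proof.
apply: cmeasurable_sum => m; apply: cmeasurableM; first exact: cmeasurable_cst.
exact: cmeasurable_chr.
Qed.

Lemma normc_tpoly_le J x : normc (tpoly J x) <= \sum_(m <- J) normc (a m).
Proof.
apply: le_trans (normc_sum _ _) _; apply: ler_sum => m _.
by rewrite normcM normc_chr mulr1.
Qed.

Lemma zperiodic_tpoly J : zperiodic (tpoly J).
Proof. by move=> x z; apply: eq_bigr => m _; rewrite (@chr_zperiodic R n). Qed.

Lemma cintegrable_tpolyM J m : cintegrable mu cube (fun x => tpoly J x * chr m x).
Proof.
apply: (@cintegrable_cube_bounded _ _ _ (\sum_(m <- J) normc (a m))) => [|x _].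
  apply: (cmeasurableS measurableT) => //; apply: cmeasurableM.
    exact: cmeasurable_tpoly.
  exact: cmeasurable_chr.
by rewrite normcM normc_chr mulr1 normc_tpoly_le.
Qed.

Lemma mean_tpoly J k : mean (fun x => tpoly J x * chr (zoppt k) x) =
  if k \in J then a k else 0.
Proof.
have ic m : cintegrable mu cube (fun x => a m * (chr m x * chr (zoppt k) x)).
  apply: cintegrableZ => //; apply: (@cintegrable_cube_bounded _ _ _ 1) => [|x _].
    by apply: (cmeasurableS measurableT) => //; apply: cmeasurableM; exact: cmeasurable_chr.
  by rewrite normcM !normc_chr mulr1.
have -> : mean (fun x => tpoly J x * chr (zoppt k) x) =
    cint mu cube (fun x => \sum_(m <- J) a m * (chr m x * chr (zoppt k) x)).
  by apply: eq_cint => x _; rewrite mulr_suml; apply: eq_bigr => m _; rewrite mulrA.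
rewrite cint_sum//.
have term m : cint mu cube (fun x => a m * (chr m x * chr (zoppt k) x)) =
    if m == k then a m else 0.
  transitivity (a m * (m == k)%:R); last by case: (m == k); rewrite ?mulr1 ?mulr0.
  rewrite -zaddt_oppK -mean_chr /mean -cintZ//; last exact: cintegrable_cube_chr.
  by apply: eq_cint => x _; rewrite chr_zaddt.
under eq_bigr do rewrite term.
case: (boolP (k \in J)) => kJ.
  rewrite (big_fsetD1 _ kJ)/= eqxx big1_seq ?addr0// => m /andP[_].
  by rewrite !inE => /andP[/negbTE ->].
by rewrite big1_seq// => m /andP[_ mJ]; case: eqVneq => // mk; rewrite -mk mJ in kJ.
Qed.

Lemma conjc_chr m x : (chr m x)^*%C = chr (zoppt m) x.
Proof. by rewrite chr_zoppt /chr -expi2piN /expi2pi mulrN cosN sinN. Qed.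

Lemma conjcD (z w : R[i]) : (z + w)^*%C = z^*%C + w^*%C.
Proof. exact: rmorphD. Qed.

Lemma conjcM (z w : R[i]) : (z * w)^*%C = z^*%C * w^*%C.
Proof. exact: rmorphM. Qed.

Lemma sqr_normcE (u : R[i]) : ((normc u) ^+ 2)%:C = u * u^*%C.
Proof.
case: u => s t; rewrite /= sqr_sqrtr ?addr_ge0 ?sqr_ge0//; apply/eqP.
by rewrite eq_complex cReM cImM /=; apply/andP; split; apply/eqP; ring.
Qed.

Lemma parseval_finite J :
  \int[mu]_(x in cube) (normc (tpoly J x)) ^+ 2 = \sum_(m <- J) (normc (a m)) ^+ 2.
Proof.
have -> : \int[mu]_(x in cube) (normc (tpoly J x)) ^+ 2 =
    complex.Re (mean (fun x => tpoly J x * (tpoly J x)^*%C)).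
  by rewrite /mean /cint /=; apply: eq_Rintegral => x _; rewrite -sqr_normcE.
have -> : mean (fun x => tpoly J x * (tpoly J x)^*%C) =
    cint mu cube (fun x => \sum_(k <- J) (a k)^*%C * (tpoly J x * chr (zoppt k) x)).
  apply: eq_cint => x _; rewrite {2}/tpoly (big_morph _ conjcD (conjc0 R)) mulr_sumr.
  by apply: eq_bigr => k _; rewrite conjcM conjc_chr mulrCA.
rewrite cint_sum//; last by move=> k; apply: cintegrableZ => //; exact: cintegrable_tpolyM.
rewrite cRe_sum; apply: eq_big_seq => k kJ.
rewrite cintZ//; last exact: cintegrable_tpolyM.
by rewrite -/(mean _) mean_tpoly kJ mulrC -sqr_normcE.
Qed.

Lemma measurable_normc D (h : W -> R[i]) : cmeasurable D h ->
  measurable_fun D (fun x => (normc (h x)) ^+ 2).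
Proof.
move=> [h1 h2].
rewrite (_ : (fun _ => _) = fun x => complex.Re (h x) ^+ 2 + complex.Im (h x) ^+ 2).
  by apply: measurable_funD; exact: measurable_funX.
by apply/funext => x; case: (h x) => s t /=; rewrite sqr_sqrtr// addr_ge0 ?sqr_ge0.
Qed.

(** The inequality 2 |u| <= e + |u|^2 / e, integrated, bounds the mean of the
    modulus by the mean of its square, which the coefficients control. *)
Lemma mean_norm1_tpoly J (e : R) : 0 < e -> \sum_(m <- J) (normc (a m)) ^+ 2 <= e ^+ 2 ->
  \int[mu]_(x in cube) norm1 (tpoly J x) <= 2 * e.
Proof.
move=> e0 he.
have iN : mu.-integrable cube (fun x => (norm1 (tpoly J x))%:E).
  apply: integrable_norm1 => //.
  apply: (@cintegrable_cube_bounded _ _ _ (\sum_(m <- J) normc (a m))) => [|x _].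
    by apply: (cmeasurableS measurableT) => //; exact: cmeasurable_tpoly.
  exact: normc_tpoly_le.
have i2 : mu.-integrable cube (fun x => ((normc (tpoly J x)) ^+ 2)%:E).
  apply: (le_integrable mcube _ _ (integrable_cube_cst n ((\sum_(m <- J) normc (a m)) ^+ 2))).
    apply: measurable_funTS; apply/measurable_EFinP; apply: measurable_normc.
    exact: cmeasurable_tpoly.
  move=> x _; rewrite /= lee_fin !ger0_norm ?sqr_ge0//.
  have := normc_tpoly_le J x; have := normc_ge0 (tpoly J x) => u0 u1.
  by apply: lerXn2r; rewrite ?nnegrE//; exact: le_trans u0 u1.
have i3 : mu.-integrable cube (fun x => (e + e^-1 * (normc (tpoly J x)) ^+ 2)%:E).
  under eq_fun do rewrite EFinD EFinM.
  by apply: integrableD => //; [exact: integrable_cube_cst|exact: integrableZl].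
apply: (@le_trans _ _ (\int[mu]_(x in cube) (e + e^-1 * (normc (tpoly J x)) ^+ 2))).
  apply: le_Rintegral => // x _.
  set u := tpoly J x; have := le_Re_normc u; have := le_Im_normc u => h1 h2.
  apply: (@le_trans _ _ (2 * normc u)); first by rewrite /norm1; lra.
  rewrite -subr_ge0 (_ : _ - _ = e^-1 * (normc u - e) ^+ 2).
    by rewrite mulr_ge0 ?sqr_ge0// invr_ge0 ltW.
  by field; exact: lt0r_neq0.
rewrite RintegralD//; [|exact: integrable_cube_cst|].
  rewrite Rintegral_cube_cst RintegralZl// parseval_finite.
  have : e^-1 * \sum_(m <- J) normc (a m) ^+ 2 <= e^-1 * e ^+ 2.
    by rewrite ler_pM2l ?invr_gt0.
  by rewrite expr2 mulKf ?gt_eqF//; lra.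
exact: (integrableZl mcube _ i2).
Qed.

Hypothesis ha : summable_weight (fun m => (normc (a m)) ^+ 2).

Lemma fast_exhaustion : exists J : nat -> {fset n.-tuple int},
  (forall k, (J k `<=` J k.+1)%fset) /\
  forall k, tail (fun m => (normc (a m)) ^+ 2) (J k) <= (2^-1 ^+ k) ^+ 2.
Proof.
have /boolp.choice[J0 hJ0] : forall k, exists J0 : {fset n.-tuple int},
    forall J, (J0 `<=` J)%fset ->
      tail (fun m => (normc (a m)) ^+ 2) J < (2^-1 ^+ k) ^+ 2.
  by move=> k; apply: tail_small => //; rewrite !exprn_gt0// invr_gt0.
exists (fun k => \bigcup_(i <- iota 0 k.+1) J0 i)%fset; split=> k.
  apply/fsubsetP => m /bigfcupP[i /andP[ik _] mi].
  apply/bigfcupP; exists i => //; rewrite andbT mem_iota add0n.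
  by move: ik; rewrite mem_iota add0n => /andP[_ /ltnW].
apply/ltW/hJ0/fsubsetP => m mk; apply/bigfcupP; exists k => //.
by rewrite andbT mem_iota add0n ltnSn.
Qed.

(** Along partial sums whose tails decrease geometrically, the increments have a
    summable mean. Their sum G is integrable, so finite almost everywhere; where it
    is finite the partial sums converge, and G dominates the convergence. *)
Lemma riesz_fischer : exists B : W -> R[i], [/\ zperiodic B, cmeasurable setT B,
  cintegrable mu cube B & forall m, mean (fun x => B x * chr (zoppt m) x) = a m].
Proof.
have [J [Jnd Jtail]] := fast_exhaustion.
have tpolyD k x : tpoly (J k.+1) x - tpoly (J k) x = tpoly (J k.+1 `\` J k)%fset x.
  rewrite /tpoly [X in X - _](big_fsetID _ (mem (J k)))/=.
  rewrite (_ : [fset x in J k.+1 | x \in J k]%fset = J k).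
    rewrite addrAC subrr add0r; apply: eq_fbigl => t.
    by rewrite !inE andbC.
  by apply/fsetP => t; rewrite !inE; apply/andb_idl => /(fsubsetP (Jnd k)).
pose v k (x : W) := norm1 (tpoly (J k.+1 `\` J k)%fset x).
have v0 k x : 0 <= v k x by rewrite /v addr_ge0.
have mv k : measurable_fun setT (v k).
  have [t1 t2] := cmeasurable_tpoly (J k.+1 `\` J k)%fset.
  by apply: measurable_funD; exact: measurableT_comp.
have iv k : \int[mu]_(x in cube) v k x <= 2 * 2^-1 ^+ k.
  apply: mean_norm1_tpoly; first by rewrite exprn_gt0// invr_gt0.
  apply: le_trans (Jtail k).
  rewrite /tail lerBrDr; apply: (@le_trans _ _ (\sum_(m <- J k.+1) normc (a m) ^+ 2)).
    rewrite [leRHS](big_fsetID _ (mem (J k)))/=.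
    rewrite (_ : [fset x in J k.+1 | x \in J k]%fset = J k).
      rewrite [leRHS]addrC lerD2r le_eqVlt; apply/orP; left; apply/eqP/eq_fbigl => t.
      by rewrite !inE andbC.
    by apply/fsetP => t; rewrite !inE; apply/andb_idl => /(fsubsetP (Jnd k)).
  by rewrite -subr_ge0; exact: tail_ge0.
pose G (x : W) : \bar R := (\sum_(k <oo) (v k x)%:E)%E.
have mG : measurable_fun setT G.
  have h0 k (x : W) : setT x -> predT k -> (0 <= (v k x)%:E)%E by rewrite lee_fin.
  have h1 k : predT k -> measurable_fun setT (fun x : W => (v k x)%:E).
    by move=> _; exact/measurable_EFinP.
  exact: (ge0_emeasurable_sum h0 h1).
have G0 x : (0 <= G x)%E by apply: nneseries_ge0 => k _ _; rewrite lee_fin.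
have ivE k : (\int[mu]_(x in cube) (v k x)%:E <= (2 * 2^-1 ^+ k)%:E)%E.
  have i1 : mu.-integrable cube (fun x => (v k x)%:E).
    apply: integrable_norm1 => //.
    apply: (@cintegrable_cube_bounded _ _ _ (\sum_(m <- (J k.+1 `\` J k)%fset) normc (a m))).
      by apply: (cmeasurableS measurableT) => //; exact: cmeasurable_tpoly.
    by move=> x _; exact: normc_tpoly_le.
  rewrite -[leLHS]fineK; last exact: integrable_fin_num.
  by rewrite lee_fin; exact: iv.
have iG : mu.-integrable cube G.
  apply/integrableP; split; first exact: measurable_funTS.
  under eq_integral do rewrite gee0_abs//.
  rewrite /G integral_nneseries//; last 2 first.
  - by move=> k; apply: measurable_funTS; exact/measurable_EFinP.
  - by move=> k x _; rewrite lee_fin.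
  apply: (@le_lt_trans _ _ 4%:E); last exact: ltry.
  apply: lime_le.
    by apply: is_cvg_ereal_nneg_natsum => k _; apply: integral_ge0 => x _; rewrite lee_fin.
  apply: nearW => K; apply: (@le_trans _ _ (\sum_(0 <= k < K) (2 * 2^-1 ^+ k)%:E)%E).
    exact: lee_sum.
  rewrite sumEFin lee_fin (_ : \sum_(0 <= k < K) _ = 4 - 4 * 2^-1 ^+ K).
    by rewrite gerBl mulr_ge0// exprn_ge0// invr_ge0.
  elim: K => [|K IH]; first by rewrite big_geq// expr0; ring.
  by rewrite big_nat_recr//= IH exprS; field.
pose fin x := G x \is a fin_num.
pose S k (x : W) := tpoly (J k) x.
have part k x : fin x -> \sum_(0 <= j < k) v j x <= fine (G x).
  move=> fx; rewrite -lee_fin fineK// -sumEFin.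
  by apply: nneseries_lim_ge => j _ _; rewrite lee_fin.
have cS x : fin x -> cvgn (fun k => complex.Re (S k x)) /\ cvgn (fun k => complex.Im (S k x)).
  move=> fx; split; apply: (@cvg_summable_increments _ _ (v ^~ x) (fine (G x))).
  - move=> k; rewrite (_ : _ - _ = complex.Re (S k.+1 x - S k x)).
      by rewrite /S tpolyD lerDl.
    by rewrite cReD; case: (S k x).
  - by move=> k; exact: part.
  - move=> k; rewrite (_ : _ - _ = complex.Im (S k.+1 x - S k x)).
      by rewrite /S tpolyD lerDr.
    by rewrite cImD; case: (S k x).
  - by move=> k; exact: part.
(* G is periodic, so setting B to 0 where G is infinite makes B periodic
   everywhere and not only almost everywhere. *)
pose B (x : W) : R[i] := if fin x then
  limn (fun k => complex.Re (S k x)) +i* limn (fun k => complex.Im (S k x)) else 0.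
pose F : set W := [set x | fin x].
have mF : measurable F.
  by rewrite -[F]setTI; exact: emeasurable_fin_num.
pose h k (x : W) := (\1_F x)%:C * S k x.
have mh k : cmeasurable setT (h k).
  apply: cmeasurableM; last exact: cmeasurable_tpoly.
  by split; [exact: measurable_indic|exact: measurable_cst].
have hB x : cvgc (h ^~ x) (B x).
  rewrite /h /B indicE; case: (boolP (fin x)) => fx; last first.
    rewrite memNset//; last exact/negP.
    by move=> e e0; exists 0 => k _; rewrite mul0r subrr normc0.
  rewrite mem_set//; have [c1 c2] := cS x fx.
  by apply: cvgc_ReIm; under eq_fun do rewrite mul1r.
have mB : cmeasurable setT B by apply: (cmeasurable_cvg mh) => x _; exact: hB.
pose K := \sum_(m <- J 0) normc (a m).
have h_le k x : normc (h k x) <= K + fine (G x).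
  rewrite /h indicE; case: (boolP (fin x)) => fx; last first.
    rewrite memNset; last exact/negP.
    rewrite mul0r normc0 addr_ge0 ?fine_ge0//.
    by apply: sumr_ge0 => m _; exact: normc_ge0.
  rewrite mem_set// mul1r.
  have -> : S k x = S 0%N x + \sum_(0 <= j < k) (S j.+1 x - S j x).
    by rewrite telescope_sumr// addrC subrK.
  apply: le_trans (le_normcD _ _) (lerD _ _); first exact: normc_tpoly_le.
  apply: le_trans (normc_sum _ _) (le_trans (ler_sum _ _) (part k x fx)) => j _.
  by rewrite /S tpolyD; exact: normc_le_ReIm.
have iK : mu.-integrable cube (fun x => (K + fine (G x))%:E).
  under eq_fun do rewrite EFinD; apply: integrableD => //.
    exact: integrable_cube_cst.
  apply: (le_integrable mcube _ _ iG) => [|x _].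
    apply: measurable_funTS; apply/measurable_EFinP.
    by apply: measurableT_comp => //; exact: fine_measurable.
  by case: (G x) => [r| |] //=; rewrite ?normr0 ?leey.
have hmB m : cvgc (fun k => mean (fun x => h k x * chr (zoppt m) x))
    (mean (fun x => B x * chr (zoppt m) x)).
  have [||||//] := @cint_cvg _ _ _ mu cube mcube (fun k x => h k x * chr (zoppt m) x)
    (fun x => B x * chr (zoppt m) x) (fun x => K + fine (G x)).
  - move=> k; apply: (cmeasurableS measurableT) => //; apply: cmeasurableM => //.
    exact: cmeasurable_chr.
  - exact: iK.
  - by move=> k x _; rewrite normcM normc_chr mulr1.
  - move=> x _ e e0; have [k0 hk0] := hB x e e0; exists k0 => k /hk0.
    by rewrite -mulrBl normcM normc_chr mulr1.
exists B; split=> //.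
- move=> x z; have vz k : v k (addt x (intr_tuple z)) = v k x.
    by rewrite /v zperiodic_tpoly.
  have Gz : G (addt x (intr_tuple z)) = G x by apply: eq_eseriesr => k _; rewrite vz.
  rewrite /B /fin Gz /S.
  by under eq_fun do rewrite zperiodic_tpoly; under [X in _ +i* limn X]eq_fun do rewrite zperiodic_tpoly.
- have [|||//|//] := @cint_cvg _ _ _ mu cube mcube h B (fun x => K + fine (G x)).
  + by move=> k; apply: (cmeasurableS measurableT).
  + exact: iK.
  + by move=> k x _; exact: h_le.
move=> m; apply: (cvgc_unique (hmB m)) => e e0.
have [k0] := ltr_add_invr (y := 0) (x := e) e0; rewrite add0r => hk0.
exists k0 => k kk0.
have -> : mean (fun x => h k x * chr (zoppt m) x) = mean (fun x => S k x * chr (zoppt m) x).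
  apply: cint_ae_eq => //.
  - apply: (cmeasurableS measurableT) => //; apply: cmeasurableM => //.
    exact: cmeasurable_chr.
  - apply: (cmeasurableS measurableT) => //; apply: cmeasurableM.
      exact: cmeasurable_tpoly.
    exact: cmeasurable_chr.
  have := integrable_ae mcube iG; apply: filterS => x hx cx.
  by rewrite /h indicE mem_set ?mul1r//; exact: hx.
rewrite mean_tpoly; case: (boolP (m \in J k)) => mJ; first by rewrite subrr normc0.
rewrite sub0r normcN.
have : normc (a m) ^+ 2 <= (2^-1 ^+ k) ^+ 2.
  apply: le_trans (Jtail k); rewrite /tail lerBrDr.
  apply: (@le_trans _ _ (\sum_(t <- (m |` J k)%fset) normc (a t) ^+ 2)).
    by rewrite big_fsetU1.
  by rewrite -subr_ge0; exact: tail_ge0.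
rewrite ler_sqr ?nnegrE ?normc_ge0 ?exprn_ge0 ?invr_ge0//.
move/le_lt_trans; apply; apply: le_lt_trans hk0.
rewrite exprVn lef_pV2 ?posrE ?exprn_gt0// -natrX ler_nat.
exact: leq_ltn_trans kk0 (ltn_expl k (ltnSn 1)).
Qed.

End riesz_fischer.

(** * The lattice and its dual in coordinates *)

Section lattice.
Context {R : realType} {VQ : vectType rat}.
Local Notation V := 'rV[R]_(\dim {:VQ}).
Local Notation U := 'Hom(V, R^o).
Variables (Lambda : set VQ) (n : nat) (b : n.-tuple VQ).
Hypothesis hb : lattice_basis Lambda b.
Implicit Types (x : n.-tuple R) (z : n.-tuple int) (v : V) (gamma : U).

Local Notation es := (@extend_scalars R VQ).
Local Notation lc := (lattice_coord b : n.-tuple R -> V).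

Lemma extend_scalarsD (u w : VQ) : es (u + w) = es u + es w.
Proof. by apply/rowP => i; rewrite !mxE linearD rmorphD. Qed.

Lemma extend_scalarsZ (q : rat) (u : VQ) : es (q *: u) = ratr q *: es u.
Proof. by apply/rowP => i; rewrite !mxE linearZ rmorphM. Qed.

Lemma extend_scalars0 : es 0 = 0.
Proof. by rewrite -(scale0r (0 : VQ)) extend_scalarsZ rmorph0 scale0r. Qed.

Lemma extend_scalars_sum (I : Type) (r : seq I) (F : I -> VQ) :
  es (\sum_(i <- r) F i) = \sum_(i <- r) es (F i).
Proof. exact: (big_morph _ extend_scalarsD extend_scalars0). Qed.

Lemma extend_scalarsMz (u : VQ) (z : int) : es (u *~ z) = z%:~R *: es u.
Proof. by rewrite -scaler_int extend_scalarsZ ratr_int. Qed.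

Lemma extend_scalars_vbasis (j : 'I_(\dim {:VQ})) :
  es (tnth (vbasis {:VQ}) j) = delta_mx 0 j.
Proof.
apply/rowP => i; rewrite !mxE (tnth_nth 0) coord_free ?(basis_free (vbasisP _))//.
by rewrite eqxx/= eq_sym; case: eqVneq => //= _; rewrite ?rmorph1 ?rmorph0.
Qed.

(** The inverse of [lattice_coord b]. *)
Definition coords v : n.-tuple R :=
  [tuple \sum_j v 0 j * ratr (coord b i (tnth (vbasis {:VQ}) j)) | i < n].

Let basis_b : basis_of {:VQ} b. Proof. by case: hb. Qed.

Lemma lattice_coordD x y : lc (addt x y) = lc x + lc y.
Proof.
by rewrite /lattice_coord -big_split; apply: eq_bigr => i _; rewrite tnth_mktuple scalerDl.
Qed.

Lemma coordsK v : lc (coords v) = v.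
Proof.
rewrite /lattice_coord; under eq_bigr do rewrite tnth_mktuple scaler_suml.
rewrite exchange_big/= [RHS]row_sum_delta; apply: eq_bigr => j _.
rewrite -extend_scalars_vbasis -[in RHS](_ : \sum_i coord b i (tnth (vbasis {:VQ}) j) *: b`_i = tnth (vbasis {:VQ}) j).
  rewrite extend_scalars_sum scaler_sumr; apply: eq_bigr => i _.
  by rewrite extend_scalarsZ scalerA (tnth_nth 0 b).
exact/esym/(coord_basis basis_b (memvf _)).
Qed.

Lemma coords_sum (I : Type) (r : seq I) (a : I -> R) (w : I -> V) i :
  tnth (coords (\sum_(k <- r) a k *: w k)) i = \sum_(k <- r) a k * tnth (coords (w k)) i.
Proof.
rewrite tnth_mktuple; under eq_bigr do rewrite summxE mulr_suml.
rewrite exchange_big; apply: eq_bigr => k _; rewrite tnth_mktuple mulr_sumr.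
by apply: eq_bigr => j _; rewrite mxE mulrA.
Qed.

Lemma coords_extend (u : VQ) i : tnth (coords (es u)) i = ratr (coord b i u).
Proof.
rewrite [in RHS](coord_basis (vbasisP {:VQ}) (memvf u)) linear_sum rmorph_sum.
rewrite tnth_mktuple; apply: eq_bigr => j _; rewrite mxE -rmorphM linearZ.
by rewrite (tnth_nth 0).
Qed.

Lemma lattice_coordK x : coords (lc x) = x.
Proof.
apply: eq_from_tnth => i; rewrite coords_sum (bigD1 i)//= big1 => [|k ki].
  rewrite coords_extend (tnth_nth 0 b) coord_free ?(basis_free basis_b)//.
  by rewrite eqxx rmorph1 mulr1 addr0.
rewrite coords_extend (tnth_nth 0 b) coord_free ?(basis_free basis_b)//.
by rewrite (negbTE ki) rmorph0 mulr0.
Qed.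

Definition lattice_point z : VQ := \sum_(i < n) tnth b i *~ tnth z i.

Lemma extend_lattice_point z : es (lattice_point z) = lc (intr_tuple z).
Proof.
rewrite extend_scalars_sum; apply: eq_bigr => i _.
by rewrite extend_scalarsMz tnth_mktuple.
Qed.

Lemma lattice_point_mem z : Lambda (lattice_point z).
Proof. by case: hb => _ ->; exists (fun i => tnth z i). Qed.

(** The coordinates of a lattice point are integers; the floor only casts them. *)
Definition lattice_index (l : VQ) : n.-tuple int :=
  [tuple Num.floor (tnth (coords (es l)) i) | i < n].

Lemma lattice_pointK z : lattice_index (lattice_point z) = z.
Proof.
apply: eq_from_tnth => i; rewrite tnth_mktuple extend_lattice_point lattice_coordK.
by rewrite tnth_mktuple intrKfloor.
Qed.

Lemma lattice_indexK l : Lambda l -> lattice_point (lattice_index l) = l.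
Proof.
case: hb => _ -> [z _ <-].
rewrite (_ : \sum_(i < n) _ = lattice_point [tuple z i | i < n]); first by rewrite lattice_pointK.
by apply: eq_bigr => i _; rewrite tnth_mktuple.
Qed.

Lemma has_sum_lattice (F : VQ -> R[i]) l :
  has_sum setT (fun z => F (lattice_point z)) l -> has_sum Lambda F l.
Proof.
apply: (@has_sum_reindex _ _ _ Lambda lattice_point lattice_index setT) => //.
- by move=> z _; exact: lattice_point_mem.
- by move=> z _; exact: lattice_pointK.
- by move=> l' /lattice_indexK.
Qed.

Definition dual_fun z (v : V) : R^o := \sum_(i < n) (tnth z i)%:~R * tnth (coords v) i.

Fact dual_fun_linear z : linear (dual_fun z).
Proof.
move=> c u v; rewrite /dual_fun scaler_sumr -big_split; apply: eq_bigr => i _ /=.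
have := coords_sum [:: (c, u); (1, v)] fst snd i; rewrite !big_cons !big_nil /=.
by rewrite !addr0 scale1r mul1r => ->; rewrite /GRing.scale/=; ring.
Qed.

HB.instance Definition _ z := GRing.isLinear.Build R V R^o _ (dual_fun z) (dual_fun_linear z).

Definition dual_point z : U := linfun (dual_fun z).

Lemma dual_pointE z x : (dual_point z (lc x) : R) = dot z x.
Proof. by rewrite lfunE /= /dual_fun lattice_coordK. Qed.

Lemma expi2pi_dual_point z x : expi2pi (dual_point z (lc x) : R) = chr z x.
Proof. by rewrite dual_pointE. Qed.

Lemma dual_point_mem z : dual_lattice Lambda (dual_point z).
Proof.
move=> l /lattice_indexK <-; rewrite extend_lattice_point dual_pointE dot_int.
exact: intr_int.
Qed.

Definition dual_index gamma : n.-tuple int :=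
  [tuple Num.floor (gamma (es (tnth b i)) : R) | i < n].

Lemma dual_pointK z : dual_index (dual_point z) = z.
Proof.
apply: eq_from_tnth => i; rewrite tnth_mktuple lfunE /= /dual_fun.
rewrite (bigD1 i)//= big1 => [|j ji].
  rewrite coords_extend (tnth_nth 0 b) coord_free ?(basis_free basis_b)//.
  by rewrite eqxx rmorph1 mulr1 addr0 intrKfloor.
rewrite coords_extend (tnth_nth 0 b) coord_free ?(basis_free basis_b)//.
by rewrite eq_sym (negbTE ji) rmorph0 mulr0.
Qed.

Lemma dual_indexK gamma : dual_lattice Lambda gamma -> dual_point (dual_index gamma) = gamma.
Proof.
move=> hg; apply/lfunP => v; rewrite -(coordsK v) dual_pointE.
rewrite /lattice_coord linear_sum; apply: eq_bigr => i _; rewrite linearZ /= mulrC.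
rewrite [tnth (dual_index _) i]tnth_mktuple floorK//.
rewrite (_ : tnth b i = lattice_point [tuple (j == i)%:Z | j < n]).
  exact/hg/lattice_point_mem.
rewrite /lattice_point (bigD1 i)//= big1 => [|j ji]; first by rewrite tnth_mktuple eqxx addr0.
by rewrite tnth_mktuple (negbTE ji).
Qed.

Lemma has_sum_dual (A : set U) (F : U -> R[i]) l : A `<=` dual_lattice Lambda ->
  has_sum [set z | A (dual_point z)] (fun z => F (dual_point z)) l -> has_sum A F l.
Proof.
move=> AD; apply: (@has_sum_reindex _ _ _ A dual_point dual_index) => //.
- by move=> g Ag /=; rewrite dual_indexK//; exact: AD.
- by move=> z _; exact: dual_pointK.
- by move=> g /AD/dual_indexK.
Qed.

Lemma has_sum_dual_inv (A : set U) (F : U -> R[i]) l : A `<=` dual_lattice Lambda ->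
  has_sum A F l -> has_sum [set z | A (dual_point z)] (fun z => F (dual_point z)) l.
Proof.
move=> AD h.
apply: (@has_sum_reindex _ _ _ _ dual_index dual_point A) => //.
- by move=> g Ag /=; rewrite dual_indexK//; exact: AD.
- by move=> g /AD/dual_indexK.
- by move=> z _; exact: dual_pointK.
by apply: eq_has_sum h => g Ag /=; rewrite dual_indexK//; exact: AD.
Qed.

Lemma integral_dvE (h : V -> R[i]) :
  integral_dv b h = cint (lebesgue_tuple n) setT (fun x => h (lc x)).
Proof. by []. Qed.

End lattice.

(** * Smooth and rapidly decreasing functions *)

Section directional.
Context {R : realType} {V : normedModType R}.
Implicit Types (g : V -> R) (f : V -> R[i]) (v phi : V).

(** Dominated convergence needs a sequence of increments: k.+1^-1 is chosen. *)
Lemma derive_quotient g v phi : derivable g v phi -> forall e, 0 < e ->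
  exists K, forall k, (K <= k)%N ->
    `|k.+1%:R * (g (v + k.+1%:R^-1 *: phi) - g v) - 'D_phi g v| < e.
Proof.
move=> dg e e0; have : (fun h : R => h^-1 *: ((g \o shift v) (h *: phi) - g v)) @ 0^' -->
    'D_phi g v by exact: dg.
move/cvgrPdist_lt => /(_ e e0); rewrite near_withinE => /nbhs_ballP[d /= d0 hd].
have [K] := ltr_add_invr (y := 0) (x := d) d0; rewrite add0r => hK.
exists K => k Kk; have k0 : 0 < k.+1%:R^-1 :> R by rewrite invr_gt0.
have kd : k.+1%:R^-1 < d.
  by apply: le_lt_trans hK; rewrite lef_pV2 ?posrE// ler_nat ltnS.
have := hd k.+1%:R^-1; rewrite /ball/= sub0r normrN gtr0_norm//.
move=> /(_ kd (lt0r_neq0 k0)); rewrite distrC invrK; congr (`| _ - _| < _).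
by rewrite [v + _]addrC.
Qed.

Lemma mean_value_line g v phi (t : R) : (forall w, derivable g w phi) -> 0 < t ->
  exists2 s, 0 <= s <= t & g (v + t *: phi) - g v = t * 'D_phi g (v + s *: phi).
Proof.
move=> dg t0; pose G (s : R) := g (v + s *: phi).
have GE (s : R) : (fun h : R => h^-1 *: ((G \o shift s) (h *: 1) - G s)) =
    (fun h : R => h^-1 *: ((g \o shift (v + s *: phi)) (h *: phi) - g (v + s *: phi))).
  apply/funext => h; rewrite /G /= /shift/= [h *: 1]mulr1 scalerDl addrCA.
  by [].
have Gd (s : R) : is_derive s (1 : R) G ('D_phi g (v + s *: phi)).
  by apply: DeriveDef; [rewrite /derivable GE; exact: dg|rewrite /derive GE].
have cG : {within `[0, t], continuous G}.
  by apply: derivable_within_continuous => s _; have [] := Gd s.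
have [s s0t] := MVT t0 (fun s _ => Gd s) cG.
rewrite /G scale0r addr0 subr0 mulrC => ->; exists s => //.
by move: s0t; rewrite in_itv/= => /andP[/ltW -> /ltW ->].
Qed.

Lemma derivecs_derivec vs phi f : derivecs vs (derivec phi f) = derivecs (rcons vs phi) f.
Proof. by rewrite /derivecs foldr_rcons. Qed.

Lemma schwartz_derivec phi f : schwartz f -> schwartz (derivec phi f).
Proof.
move=> [sf rf]; split=> [vs x|vs]; rewrite derivecs_derivec; first exact: sf.
exact: rf.
Qed.

Lemma schwartz_derivecs vs f : schwartz f -> schwartz (derivecs vs f).
Proof. by elim: vs => // phi vs IH /IH; exact: schwartz_derivec. Qed.

Lemma derivec_quotient phi f v : smooth f ->
  cvgc (fun k => k.+1%:R%:C * (f (v + k.+1%:R^-1 *: phi) - f v)) (derivec phi f v).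
Proof.
move=> sf e e0; have e2 : 0 < e / 2 by rewrite divr_gt0.
have [d1 d2] := sf [::] v.
have [K1 h1] := derive_quotient (diff_derivable (v := phi) d1) e2.
have [K2 h2] := derive_quotient (diff_derivable (v := phi) d2) e2.
exists (maxn K1 K2) => k; rewrite geq_max => /andP[k1 k2].
apply: le_lt_trans (normc_le_ReIm _) _; rewrite [e]splitr ltrD//.
  have := h1 _ k1; congr (`| _ | < _); rewrite cReD cReM /= mul0r subr0.
  by rewrite cReD; congr (_ * (_ + _) - _); case: (f v).
have := h2 _ k2; congr (`| _ | < _); rewrite cImD cImM /= mul0r addr0.
by rewrite cImD; congr (_ * (_ + _) - _); case: (f v).
Qed.

(** The mean value theorem gives two intermediate points, one for the real and one
    for the imaginary part. *)
Lemma normc_increment phi f v (t : R) : smooth f -> 0 < t ->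
  exists s1 s2, [/\ 0 <= s1 <= t, 0 <= s2 <= t &
    normc (f (v + t *: phi) - f v) <=
    t * (normc (derivec phi f (v + s1 *: phi)) + normc (derivec phi f (v + s2 *: phi)))].
Proof.
move=> sf t0.
have [s1 s1t e1] := mean_value_line v (fun w => diff_derivable (v := phi) (sf [::] w).1) t0.
have [s2 s2t e2] := mean_value_line v (fun w => diff_derivable (v := phi) (sf [::] w).2) t0.
exists s1, s2; split=> //; apply: le_trans (normc_le_ReIm _) _; rewrite mulrDr lerD//.
  rewrite (_ : complex.Re _ = t * 'D_phi (fun y => complex.Re (f y)) (v + s1 *: phi)).
    by rewrite normrM (gtr0_norm t0) ler_pM2l//; exact: (le_Re_normc (derivec phi f _)).
  by rewrite -[RHS]e1 /derivecs /= cReD; case: (f v).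
rewrite (_ : complex.Im _ = t * 'D_phi (fun y => complex.Im (f y)) (v + s2 *: phi)).
  by rewrite normrM (gtr0_norm t0) ler_pM2l//; exact: (le_Im_normc (derivec phi f _)).
by rewrite -[RHS]e2 /derivecs /= cImD; case: (f v).
Qed.

Lemma smooth_continuous f v e : smooth f -> 0 < e ->
  exists2 d, 0 < d & forall w, `|w - v| < d -> normc (f w - f v) < e.
Proof.
move=> sf e0; have e2 : 0 < e / 2 by rewrite divr_gt0.
have [d1 d2] := sf [::] v.
have := differentiable_continuous d1; move/cvgrPdist_lt => /(_ _ e2)/nbhs_ballP[r1 r10 h1].
have := differentiable_continuous d2; move/cvgrPdist_lt => /(_ _ e2)/nbhs_ballP[r2 r20 h2].
exists (Num.min r1 r2) => [|w]; first by rewrite lt_min r10.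
rewrite lt_min => /andP[w1 w2]; apply: le_lt_trans (normc_le_ReIm _) _.
have b1 : ball v r1 w by rewrite -ball_normE /ball_/= distrC.
have b2 : ball v r2 w by rewrite -ball_normE /ball_/= distrC.
rewrite [e]splitr ltrD//.
  by have := h1 _ b1; rewrite /= distrC; congr (`| _ | < _); rewrite cReD; case: (f v).
by have := h2 _ b2; rewrite /= distrC; congr (`| _ | < _); rewrite cImD; case: (f v).
Qed.

End directional.

Lemma derivecs_support {R : realType} {V : normedModType R} (f : V -> R[i]) (M : R) vs :
  (forall x, M < `|x| -> f x = 0) -> forall x, M < `|x| -> derivecs vs f x = 0.
Proof.
elim: vs => // phi vs IH f0 x Mx.
have near0 : \near x, derivecs vs f x = 0.
  apply/nbhs_ballP; exists (`|x| - M) => [|y]; first by rewrite /= subr_gt0.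
  rewrite -ball_normE /ball_/= => xy; apply: IH => //.
  have := lerB_dist x y; lra.
have D0 (g : V -> R) : (\near x, g x = 0) -> 'D_phi g x = 0.
  by move/(@near_eq_derive _ _ _ g (cst 0)) => ->; rewrite derive_cst.
by rewrite /derivecs /= /derivec !D0//; apply: filterS near0 => y; rewrite /derivecs => ->.
Qed.

Lemma cvgcM_cst {R : realType} (u : nat -> R[i]) (l c : R[i]) :
  cvgc u l -> cvgc (fun k => u k * c) (l * c).
Proof.
move=> h e e0; have c1 : 0 < normc c + 1 by rewrite ltr_wpDl ?normc_ge0.
have [K hK] := h _ (divr_gt0 e0 c1); exists K => k /hK.
rewrite -mulrBl normcM ltr_pdivlMr//; apply: le_lt_trans.
by rewrite ler_wpM2l ?normc_ge0// lerDl.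
Qed.

Lemma expi2pi_quotient {R : realType} (s : R) :
  cvgc (fun k => k.+1%:R%:C * (expi2pi (- (k.+1%:R^-1 * s)) - 1)) (0 -i* (2 * pi * s)).
Proof.
move=> e e0; have e2 : 0 < e / 2 by rewrite divr_gt0.
pose c : R := - (2 * pi * s).
have dl : is_derive (0 : R) (1 : R) (fun t : R => c * t) c.
  by apply: (is_derive_eq (is_deriveZ c (is_derive_id (0 : R) (1 : R)))); rewrite /GRing.scale/= mulr1.
have dc : is_derive (0 : R) (1 : R) (fun t : R => cos (c * t)) 0.
  have := is_derive1_comp (is_derive_cos _) dl.
  by move/is_derive_eq; apply; rewrite mulr0 sin0 oppr0 mul0r.
have ds : is_derive (0 : R) (1 : R) (fun t : R => sin (c * t)) c.
  have := is_derive1_comp (is_derive_sin _) dl.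
  by move/is_derive_eq; apply; rewrite mulr0 cos0 mul1r.
have [K1 h1] := derive_quotient (@ex_derive _ _ _ _ _ _ _ dc) e2.
have [K2 h2] := derive_quotient (@ex_derive _ _ _ _ _ _ _ ds) e2.
rewrite !derive_val in h1 h2.
exists (maxn K1 K2) => k; rewrite geq_max => /andP[k1 k2].
have E : 2 * pi * - (k.+1%:R^-1 * s) = c * (0 + k.+1%:R^-1 *: 1).
  by rewrite add0r /GRing.scale/= mulr1 /c; ring.
apply: le_lt_trans (normc_le_ReIm _) _; rewrite [e]splitr ltrD//.
  have := h1 _ k1; congr (`| _ | < _); rewrite cReD cReM /expi2pi E /=.
  by rewrite mulr0 cos0 mul0r !subr0.
have := h2 _ k2; congr (`| _ | < _); rewrite cImD cImM /expi2pi E /=.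
by rewrite mulr0 sin0 mul0r !addr0 opprK.
Qed.

Lemma integrable_weight {R : realType} n : (@lebesgue_tuple R n).-integrable setT
  (fun x : n.-tuple (measurableTypeR R) => (weight (x : n.-tuple R))%:E).
Proof.
have m1 : cmeasurable setT ((fun=> 1) : n.-tuple (measurableTypeR R) -> R[i]).
  exact: cmeasurable_cst.
have mw : cmeasurable setT (fun x : n.-tuple (measurableTypeR R) =>
    (weight (x : n.-tuple R))%:C : R[i]).
  by split; [exact: measurable_weight|exact: measurable_cst].
have ic : cintegrable (@lebesgue_tuple R n) cube (fun=> 1).
  apply: (@cintegrable_cube_bounded R n _ 1) => [|x _]; last by rewrite normc1.
  exact: cmeasurable_cst.
have := @unfolding_integrable R n (fun=> 1) _ 1 _ m1 ic mw.
move=> /(_ (fun _ _ => erefl)) -[x|+ _].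
  by rewrite normc_real mul1r ger0_norm// ltW// weight_gt0.
by under eq_fun do rewrite mul1r.
Qed.

Section schwartz_lattice.
Context {R : realType} {VQ : vectType rat}.
Local Notation V := 'rV[R]_(\dim {:VQ}).
Local Notation mR := (measurableTypeR R).
Variables (Lambda : set VQ) (n : nat) (b : n.-tuple VQ).
Hypothesis hb : lattice_basis Lambda b.
Local Notation W := (n.-tuple mR).
Local Notation mu := (@lebesgue_tuple R n).
Implicit Types (x y : n.-tuple R) (m z : n.-tuple int) (f : V -> R[i]) (phi : V).

Local Notation es := (@extend_scalars R VQ).
Local Notation lc := (lattice_coord b : n.-tuple R -> V).

Lemma norm_entry_le (v : V) j : `|v 0 j| <= `|v|.
Proof.
rewrite [X in _ <= X]mx_normrE.
exact: (le_bigmax _ (fun ij : 'I_1 * 'I_(\dim {:VQ}) => `|v ij.1 ij.2|) (0, j)).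
Qed.

Lemma coords_bound : exists2 K : R, 0 < K & forall (v : V) i, `|tnth (coords b v) i| <= K * `|v|.
Proof.
pose c i j : R := `|ratr (coord b i (tnth (vbasis {:VQ}) j))|.
have c0 i j : 0 <= c i j by exact: normr_ge0.
exists (1 + \sum_i \sum_j c i j) => [|v i].
  by rewrite ltr_pwDl// sumr_ge0// => i _; rewrite sumr_ge0.
rewrite tnth_mktuple (le_trans (ler_norm_sum _ _ _))//.
apply: (@le_trans _ _ (\sum_j c i j * `|v|)).
  by apply: ler_sum => j _; rewrite normrM mulrC ler_wpM2l// norm_entry_le.
rewrite -mulr_suml ler_wpM2r// ler_wpDl// (bigD1 i)//= lerDl.
by rewrite sumr_ge0// => k _; rewrite sumr_ge0.
Qed.

(** Each factor (1 + |x_i|)^2 of the inverse of the weight is at most a constant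
    times (1 + |v|)^2, so decay of order 2 n in the norm is enough. *)
Lemma schwartz_weight f : schwartz f -> exists C, forall x, normc (f (lc x)) <= C * weight x.
Proof.
move=> [_ /(_ [::]) rf]; have [K K0 hK] := coords_bound.
have real_bound k : exists M, forall v, normc (f v) * `|v| ^+ k <= M.
  by have [M hM] := rf k; exists M => v; have := hM v; rewrite -lecR rmorphM.
have [M0 hM0] := real_bound 0%N; have [M1 hM1] := real_bound (n + n)%N.
exists (2 ^+ (n + n) * (M0 + K ^+ (n + n) * M1)) => x.
set v := lc x; have wE : weight x = (\prod_(i < n) (1 + `|tnth x i|) ^+ 2)^-1.
  by rewrite -prodfV.
rewrite wE ler_pdivlMr; last first.
  by apply: prodr_gt0 => i _; rewrite exprn_gt0// ltr_wpDr.
apply: (@le_trans _ _ (normc (f v) * (1 + K * `|v|) ^+ (n + n))).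
  rewrite ler_wpM2l ?normc_ge0// exprD -exprMn -[n in leRHS]card_ord -prodr_const.
  apply: ler_prod => i _; rewrite exprn_ge0/= ?addr_ge0// -expr2.
  apply: lerXn2r; rewrite ?nnegrE ?addr_ge0 ?mulr_ge0 ?(ltW K0)// lerD2l.
  by have := hK v i; rewrite /v (lattice_coordK hb).
apply: (@le_trans _ _ (normc (f v) * (2 ^+ (n + n) * (1 + (K * `|v|) ^+ (n + n))))).
  rewrite ler_wpM2l ?normc_ge0//; set a := K * `|v|.
  have a0 : 0 <= a by rewrite mulr_ge0// ltW.
  have [a1|a1] := lerP a 1.
    apply: (@le_trans _ _ (2 ^+ (n + n))).
      by apply: lerXn2r; rewrite ?nnegrE ?addr_ge0//; lra.
    by rewrite ler_peMr ?exprn_ge0// lerDl exprn_ge0.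
  apply: (@le_trans _ _ (2 ^+ (n + n) * a ^+ (n + n))).
    by rewrite -exprMn; apply: lerXn2r; rewrite ?nnegrE ?addr_ge0 ?mulr_ge0//; lra.
  by rewrite ler_wpM2l ?exprn_ge0// lerDr.
rewrite mulrCA ler_pM2l ?exprn_gt0// mulrDr mulr1 lerD//.
  by have := hM0 v; rewrite expr0 mulr1.
by rewrite exprMn mulrCA ler_wpM2l ?exprn_ge0 ?(ltW K0).
Qed.

Lemma continuous_tuple_smooth f : smooth f -> continuous_tuple (fun x => f (lc x)).
Proof.
move=> sf x e e0; have [d d0 hd] := smooth_continuous (lc x) sf e0.
pose K : R := 1 + \sum_(i < n) `|es (tnth b i)|.
have K0 : 0 < K by rewrite ltr_pwDl// sumr_ge0.
exists (d / K) => [|y hy]; first exact: divr_gt0.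
apply: hd; rewrite /lattice_coord -sumrB; apply: le_lt_trans (ler_norm_sum _ _ _) _.
apply: (@le_lt_trans _ _ (\sum_(i < n) (d / K) * `|es (tnth b i)|)).
  by apply: ler_sum => i _; rewrite -scalerBl normrZ ler_wpM2r// ltW.
rewrite -mulr_sumr mulrAC ltr_pdivrMr// ltr_pM2l//.
by rewrite /K ltrDr.
Qed.

Lemma schwartz_cmeasurable f : smooth f -> cmeasurable setT (fun x : W => f (lc x)).
Proof. by move=> sf; apply: cmeasurable_continuous; exact: continuous_tuple_smooth. Qed.

Lemma schwartz_cintegrable f m : schwartz f ->
  cintegrable mu setT (fun x : W => chr m x * f (lc x)).
Proof.
move=> hf; have [C hC] := schwartz_weight hf.
apply: (@cintegrable_dominated _ _ _ mu setT measurableT _ (fun x : W => C * weight x)).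
- apply: cmeasurableM; first exact: cmeasurable_chr.
  by apply: schwartz_cmeasurable; case: hf.
- by apply: (integrableZl measurableT C (integrable_weight n)).
- by move=> x _; rewrite normcM normc_chr mul1r.
Qed.

Lemma coef_bounded f : schwartz f -> exists K, forall m, normc (coef (fun x : W => f (lc x)) m) <= K.
Proof.
move=> hf; have [C hC] := schwartz_weight hf.
exists (2 * \int[mu]_x (C * weight (x : n.-tuple R))) => m.
apply: le_normc_cint => //.
- exact: schwartz_cintegrable.
- by apply: (integrableZl measurableT C (integrable_weight n)).
- by move=> x _; rewrite normcM normc_chr mul1r.
Qed.

Definition scalet (c : R) x : n.-tuple R := [tuple c * tnth x i | i < n].

Lemma lattice_coordZ c x : lc (scalet c x) = c *: lc x.
Proof.
by rewrite /lattice_coord scaler_sumr; apply: eq_bigr => i _; rewrite tnth_mktuple scalerA.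
Qed.

Lemma chr_opp_scalet m c x : chr m (oppt (scalet c x)) = expi2pi (- (c * dot m x)).
Proof.
congr expi2pi; rewrite /dot mulr_sumr -sumrN; apply: eq_bigr => i _.
by rewrite !tnth_mktuple; ring.
Qed.

(** Translating f along phi multiplies the coefficients of f by characters of
    the translation; the difference quotients are dominated because f is
    rapidly decreasing, so the limit may be taken under the integral. *)
Lemma coef_derivec f phi m : schwartz f ->
  coef (fun x : W => derivec phi f (lc x)) m =
  (0 -i* (2 * pi * dot m (coords b phi))) * coef (fun x : W => f (lc x)) m.
Proof.
move=> hf; have sf : smooth f by case: hf.
have hdf := schwartz_derivec phi hf; have [C hC] := schwartz_weight hdf.
set y := coords b phi; pose yk k := scalet k.+1%:R^-1 y.
have lcy s x : lc (addt x (scalet s y)) = lc x + s *: phi.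
  by rewrite lattice_coordD lattice_coordZ (coordsK hb).
have C0 : 0 <= C.
  have := hC [tuple 0 | i < n]; set x := (X in weight X); rewrite -ler_pdivrMr ?weight_gt0//.
  by apply: le_trans; rewrite divr_ge0 ?normc_ge0// ltW// weight_gt0.
pose D : R := 2 * (C * (4 ^+ n * \prod_(i < n) (1 + `|tnth y i|) ^+ 2)).
pose F k (x : W) := chr m x * (k.+1%:R%:C * (f (lc (addt x (yk k))) - f (lc x))).
have mf : cmeasurable setT (fun x : W => f (lc x)) by exact: schwartz_cmeasurable.
have mc : cmeasurable setT (fun x : W => chr m x : R[i]) by exact: cmeasurable_chr.
have mfk k : cmeasurable setT (fun x : W => f (lc (addt x (yk k)))).
  exact: (cmeasurable_addt (yk k) mf).
have mF k : cmeasurable setT (F k).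
  apply: cmeasurableM => //; apply: cmeasurableM; first exact: cmeasurable_cst.
  apply: cmeasurableD => //; under eq_fun do rewrite -mulN1r.
  by apply: cmeasurableM => //; exact: cmeasurable_cst.
have shift_le s x : 0 <= s <= 1 ->
    normc (derivec phi f (lc x + s *: phi)) <= C * (4 ^+ n * \prod_(i < n) (1 + `|tnth y i|) ^+ 2) * weight x.
  move=> /andP[s0 s1]; rewrite -lcy -mulrA (le_trans (hC _))// ler_wpM2l// addtC.
  apply: le_trans (weight_translation_le _ _) _; rewrite ler_wpM2r ?(ltW (weight_gt0 _))//.
  rewrite ler_wpM2l ?exprn_ge0//; apply: ler_prod => i _; rewrite exprn_ge0 ?addr_ge0//=.
  apply: lerXn2r; rewrite ?nnegrE ?addr_ge0// lerD2l tnth_mktuple normrM ger0_norm//.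
  by rewrite ler_piMl.
have bF k x : setT x -> normc (F k x) <= D * weight x.
  move=> _; rewrite /F normcM normc_chr mul1r normcM normc_real ger0_norm// lcy.
  have k0 : 0 < k.+1%:R^-1 :> R by rewrite invr_gt0.
  have [s1 [s2 [/andP[h1 h1'] /andP[h2 h2']]]] := normc_increment phi (lc x) sf k0.
  rewrite -ler_pdivlMl// => /le_trans; apply.
  have k1 : k.+1%:R^-1 <= 1 :> R by rewrite invf_le1// ler1n.
  rewrite ler_pM2l// /D -mulrA mulr_natl mulr2n lerD// shift_le// ?h1 ?h2 /=.
    exact: le_trans h1' k1.
  exact: le_trans h2' k1.
have cF x : setT x -> cvgc (F ^~ x) (chr m x * derivec phi f (lc x)).
  move=> _; rewrite [_ * derivec _ _ _]mulrC.
  rewrite (_ : F ^~ x = fun k => k.+1%:R%:C * (f (lc x + k.+1%:R^-1 *: phi) - f (lc x)) * chr m x).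
    by apply: cvgcM_cst; exact: derivec_quotient.
  by apply/funext => k; rewrite /F lcy mulrC.
have iD : mu.-integrable setT (fun x : W => (D * weight (x : n.-tuple R))%:E).
  by apply: (integrableZl measurableT D (integrable_weight n)).
have [_ lim1] := cint_cvg measurableT mF iD bF cF.
apply: (cvgc_unique lim1).
rewrite (_ : (fun j => cint mu setT (F j)) = fun k =>
  k.+1%:R%:C * (expi2pi (- (k.+1%:R^-1 * dot m y)) - 1) * coef (fun x : W => f (lc x)) m).
  exact/cvgcM_cst/expi2pi_quotient.
apply/funext => k.
have i1 := schwartz_cintegrable m hf.
pose G (x : W) := chr m x * f (lc x).
have mG : cmeasurable setT G by exact: cmeasurableM.
have iG : cintegrable mu setT G by [].
have i2 : cintegrable mu setT (fun x : W => G (addt x (yk k))).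
  exact: (tint_addt (yk k) iG).1.
rewrite (_ : cint mu setT (F k) = cint mu setT (fun x : W =>
   k.+1%:R%:C * (chr m (oppt (yk k)) * G (addt x (yk k)) - G x))).
  rewrite cintZ//; last by apply: cintegrableB => //; exact: cintegrableZ.
  rewrite cintB//; last exact: cintegrableZ.
  rewrite cintZ// (tint_addt (yk k) iG).2 chr_opp_scalet -mulrA; congr (_ * _).
  by rewrite mulrBl mul1r.
apply: eq_cint => x _; rewrite /F /G chr_addt mulrCA; congr (_ * _).
have : chr m (oppt (yk k)) * chr m (yk k) = 1 :> R[i].
  rewrite -chr_addt /chr /dot big1 ?expi2pi0// => i _.
  by rewrite tnth_mktuple [tnth (oppt _) _]tnth_mktuple addNr mulr0.
by move=> e; rewrite mulrBr mulrA [_ * (_ * chr _ _)]mulrCA e mulr1.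
Qed.

Lemma coef_derivecs f vs m : schwartz f ->
  coef (fun x : W => derivecs vs f (lc x)) m =
  \prod_(phi <- vs) (0 -i* (2 * pi * dot m (coords b phi))) * coef (fun x : W => f (lc x)) m.
Proof.
move=> hf; elim: vs => [|phi vs IH]; first by rewrite big_nil mul1r.
by rewrite big_cons -mulrA -IH; apply: coef_derivec; exact: schwartz_derivecs.
Qed.

Lemma dot_coords_basis m i : dot m (coords b (es (tnth b i)) : n.-tuple R) = (tnth m i)%:~R.
Proof.
have fb : free b by case: hb => /basis_free.
rewrite /dot (bigD1 i)//= big1 => [|j ji].
  by rewrite coords_extend (tnth_nth 0 b) coord_free// eqxx rmorph1 mulr1 addr0.
by rewrite coords_extend (tnth_nth 0 b) coord_free// eq_sym (negbTE ji) rmorph0 mulr0.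
Qed.

(** Deriving twice along each basis vector on which m does not vanish gains the
    square of every nonzero entry of m. *)
Lemma coef_decay f : schwartz f -> exists C,
  forall m, normc (coef (fun x : W => f (lc x)) m) <= C * weight (intr_tuple m).
Proof.
move=> hf; pose vs (A : {set 'I_n}) :=
  flatten [seq [:: es (tnth b i); es (tnth b i)] | i <- enum A].
have /boolp.choice[K hK] : forall A : {set 'I_n}, exists K : R, forall m,
    normc (coef (fun x : W => derivecs (vs A) f (lc x)) m) <= K.
  by move=> A; exact/coef_bounded/schwartz_derivecs.
exists (\sum_A `|K A|) => m; pose A : {set 'I_n} := [set i | tnth m i != 0]%SET.
have wE : weight (intr_tuple m) = (\prod_(i < n) (1 + `|(tnth m i)%:~R|) ^+ 2)^-1 :> R.
  by rewrite -prodfV; apply: eq_bigr => i _; rewrite tnth_mktuple.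
rewrite wE ler_pdivlMr; last first.
  by apply: prodr_gt0 => i _; rewrite exprn_gt0// ltr_wpDr.
apply: (@le_trans _ _ (K A)); last first.
  by rewrite (bigD1 A)//= (le_trans (ler_norm _))// lerDl sumr_ge0.
apply: le_trans (hK A m); rewrite coef_derivecs// normcM mulrC ler_wpM2r ?normc_ge0//.
rewrite normc_prod /vs big_flatten big_map/= (bigID (mem A))/=.
rewrite [X in _ * X]big1 => [|i]; last first.
  by rewrite inE negbK => /eqP ->; rewrite normr0 addr0 expr1n.
rewrite mulr1 big_enum/=; apply: ler_prod => i; rewrite inE => mi.
rewrite exprn_ge0 ?addr_ge0//= !big_cons big_nil mulr1 dot_coords_basis.
set t := (tnth m i)%:~R : R.
have t1 : 1 <= `|t| by rewrite -intr_norm ler1z; move: mi; rewrite -normr_gt0.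
rewrite expr0n/= add0r sqrtr_sqr normrN !normrM (gtr0_norm (pi_gt0 R)) ger0_norm//.
rewrite -expr2; apply: lerXn2r; rewrite ?nnegrE ?addr_ge0// ?mulr_ge0 ?pi_ge0//.
have p2 := pi_ge2 R; nra.
Qed.

(** A derivative of a test function is continuous and vanishes outside a
    compact ball. *)
Lemma test_function_schwartz (f : V -> R[i]) : test_function f -> schwartz f.
Proof.
move=> [sf [M0 hM0]]; split=> // vs k.
pose M := `|M0|; have M_ge0 : 0 <= M by exact: normr_ge0.
have supp (x : V) : M < `|x| -> derivecs vs f x = 0.
  by move=> /(le_lt_trans (ler_norm _)); exact: derivecs_support.
pose A : set V := closed_ball_ Num.norm (0 : V) M.
have cA : compact A.
  apply: bounded_closed_compact; last exact: closed_closed_ball_.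
  exists M; split=> [|y My v]; first exact: num_real.
  by rewrite /A /closed_ball_/= sub0r normrN => /le_trans; apply; exact: ltW.
have bnd (g : V -> R) : (forall x : V, differentiable g (nbhs x)) -> exists N : R, forall x : V, A x -> `|g x| <= N.
  move=> dg; have cg : {within A, continuous g}.
    by apply: continuous_subspaceT => x; exact/differentiable_continuous.
  have [N [_ hN]] := compact_bounded (continuous_compact cg cA).
  exists (N + 1) => x Ax; apply: hN; first by rewrite ltrDl.
  by exists x.
have [N1 h1] := bnd _ (fun v => (sf vs v).1); have [N2 h2] := bnd _ (fun v => (sf vs v).2).
exists ((`|N1| + `|N2|) * M ^+ k) => v.
have [Mv|vM] := ltP M `|v|.
  by rewrite supp// normr0 mul0r -[0]/(0%:C) lecR mulr_ge0 ?addr_ge0 ?exprn_ge0 ?normr_ge0.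
have Av : A v by rewrite /A /closed_ball_/= sub0r normrN.
rewrite -rmorphM lecR ler_pM ?normc_ge0 ?exprn_ge0//; last first.
  by apply: lerXn2r; rewrite ?nnegrE.
apply: le_trans (normc_le_ReIm _) _; rewrite lerD//.
  exact: le_trans (h1 _ Av) (ler_norm _).
exact: le_trans (h2 _ Av) (ler_norm _).
Qed.
End schwartz_lattice.

(** * A smooth partition of unity *)

Section cdiff.
Context {R : realType} {V : normedModType R}.
Implicit Types (g h : V -> R) (x phi : V).

(** Differentiability to order n, by recursion on n, so that stability under sums,
    products and compositions follows by induction for all directions at once. *)
Fixpoint cdiff n g : Prop :=
  if n is k.+1 then (forall x, differentiable g x) /\ forall phi, cdiff k ('D_phi g)
  else True.

Lemma cdiffW n g : cdiff n.+1 g -> cdiff n g.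
Proof. by elim: n g => // n IH g [dg hg]; split=> // phi; exact/IH/hg. Qed.

Lemma cdiff_cst n (c : R) : cdiff n (fun=> c).
Proof.
elim: n c => // n IH c; split=> [x|phi]; first exact: differentiable_cst.
rewrite (_ : 'D_phi _ = fun=> 0); first exact: IH.
by apply/funext => x; exact: derive_cst.
Qed.

Lemma cdiffD n g h : cdiff n g -> cdiff n h -> cdiff n (fun x => g x + h x).
Proof.
elim: n g h => // n IH g h [dg hg] [dh hh]; split=> [x|phi].
  exact: differentiableD.
rewrite (_ : 'D_phi _ = fun x => 'D_phi g x + 'D_phi h x).
  by apply: IH; [exact: hg|exact: hh].
by apply/funext => x; apply: deriveD; exact: diff_derivable.
Qed.

Lemma cdiffM n g h : cdiff n g -> cdiff n h -> cdiff n (fun x => g x * h x).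
Proof.
elim: n g h => // n IH g h [dg hg] [dh hh]; split=> [x|phi].
  exact: differentiableM.
rewrite (_ : 'D_phi _ = fun x => g x * 'D_phi h x + h x * 'D_phi g x).
  have cg : cdiff n g by apply: cdiffW; split.
  have ch : cdiff n h by apply: cdiffW; split.
  by apply: cdiffD; apply: IH => //; [exact: hh|exact: hg].
by apply/funext => x; apply: deriveM; exact: diff_derivable.
Qed.

Lemma cdiffZ n (c : R) g : cdiff n g -> cdiff n (fun x => c * g x).
Proof. by apply: cdiffM; exact: cdiff_cst. Qed.

Lemma cdiffB n g h : cdiff n g -> cdiff n h -> cdiff n (fun x => g x - h x).
Proof.
by move=> hg hh; under eq_fun do rewrite -mulN1r; apply: cdiffD => //; exact: cdiffZ.
Qed.

Lemma cdiff_sum n (I : Type) (r : seq I) (g : I -> V -> R) :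
  (forall i, cdiff n (g i)) -> cdiff n (fun x => \sum_(i <- r) g i x).
Proof.
move=> hg; elim: r => [|i r IH].
  by under eq_fun do rewrite big_nil; exact: cdiff_cst.
by under eq_fun do rewrite big_cons; exact: cdiffD.
Qed.

Lemma cdiff_prod n (I : Type) (r : seq I) (g : I -> V -> R) :
  (forall i, cdiff n (g i)) -> cdiff n (fun x => \prod_(i <- r) g i x).
Proof.
move=> hg; elim: r => [|i r IH].
  by under eq_fun do rewrite big_nil; exact: cdiff_cst.
by under eq_fun do rewrite big_cons; exact: cdiffM.
Qed.

Lemma smooth_cdiff (g h : V -> R) : (forall n, cdiff n g) -> (forall n, cdiff n h) ->
  smooth (fun x => g x +i* h x).
Proof.
move=> hg hh vs; pose f x := g x +i* h x.
suff H n : cdiff n (fun x => complex.Re (derivecs vs f x)) /\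
    cdiff n (fun x => complex.Im (derivecs vs f x)).
  by move=> x; have [[c1 _] [c2 _]] := H 1%N; split; [exact: c1|exact: c2].
elim: vs n => [n|phi vs IH n]; first by split; [exact: hg|exact: hh].
by have [[_ h1] [_ h2]] := IH n.+1; split; [exact: h1|exact: h2].
Qed.

End cdiff.

Lemma derive_line {R : realType} (h : R -> R) (x phi : R) : differentiable h x ->
  'D_phi h x = phi * 'D_1 h x.
Proof.
by move=> dh; rewrite !deriveE// -{1}[phi]mulr1 -[phi * 1]/(phi *: 1) linearZ.
Qed.

Lemma cdiff_derive1 {R : realType} n (h h' : R -> R) :
  (forall x : R, is_derive x (1 : R) h (h' x)) -> cdiff n h' -> cdiff n.+1 h.
Proof.
move=> hh ch'; have dh x : differentiable h x.
  by apply/derivable1_diffP; have [] := hh x.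
split=> // phi; rewrite (_ : 'D_phi _ = fun x => phi * h' x); first exact: cdiffZ.
by apply/funext => x; rewrite derive_line// derive_val.
Qed.

Lemma cdiff_comp {R : realType} {V : normedModType R} n (h : R -> R) (g : V -> R) :
  cdiff n h -> cdiff n g -> cdiff n (fun x => h (g x)).
Proof.
elim: n h g => // n IH h g [dh hh] [dg hg]; split=> [x|phi].
  exact: differentiable_comp.
rewrite (_ : 'D_phi _ = fun x => 'D_1 h (g x) * 'D_phi g x).
  apply: cdiffM; last exact: hg.
  by apply: (IH ('D_1 h)); [exact: hh|apply: cdiffW; split].
apply/funext => x; rewrite deriveE; last exact: differentiable_comp.
rewrite (diff_comp (dg x) (dh (g x))) /= -deriveE// -deriveE// derive_line//.
by rewrite mulrC.
Qed.

Lemma cdiff_id {R : realType} n : cdiff n (fun x : R => x).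
Proof.
case: n => // n; apply: (@cdiff_derive1 _ _ _ (fun=> 1)).
exact: cdiff_cst.
Qed.

Lemma cdiff_trig {R : realType} n : cdiff n (@cos R) /\ cdiff n (@sin R).
Proof.
elim: n => // n [hc hs]; split.
  apply: (@cdiff_derive1 _ _ _ (fun x => - sin x)).
  by under eq_fun do rewrite -mulN1r; exact: cdiffZ.
exact: cdiff_derive1 hc.
Qed.

Section flat.
Context {R : realType}.
Implicit Types (x : R) (k n : nat).

(** The derivatives of the flat function [flat 0] are combinations of the
    functions of this family. *)
Definition flat k x : R := if 0 < x then x ^- k * expR (- x^-1) else 0.

(** The flat functions vanish to second order at 0, because the exponential of x^-1
    dominates the power k + 2 of x^-1. *)
Lemma flat_le k x : `|flat k x| <= (k.+2)`!%:R * x ^+ 2.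
Proof.
rewrite /flat; case: ltP => x0; last by rewrite normr0 mulr_ge0 ?sqr_ge0.
rewrite ger0_norm; last by rewrite mulr_ge0 ?expR_ge0// invr_ge0 exprn_ge0// ltW.
have h : (k.+2)`!%:R * expR x^-1 >= x^-1 ^+ k.+2 :> R.
  rewrite -ler_pdivrMl ?ltr0n ?fact_gt0// mulrC.
  have := @expR_ge1Dxn R x^-1 k.+1; rewrite invr_ge0 (ltW x0) => /(_ isT).
  by apply: le_trans; rewrite lerDr.
rewrite expRN ler_pdivrMr ?expR_gt0// -mulrA [x ^+ 2 * _]mulrC mulrA.
rewrite -ler_pdivrMr ?exprn_gt0//; apply: le_trans h.
by rewrite -exprVn -exprVn -exprD addn2.
Qed.

Lemma is_derive_flat k x : is_derive x 1 (flat k) (- k%:R * flat k.+1 x + flat k.+2 x).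
Proof.
have [x0|x0|x0] := ltgtP x 0.
- rewrite /flat !ltNge !(ltW x0)/= mulr0 addr0.
  apply: (@near_eq_is_derive _ _ _ (cst 0)).
  near=> y; rewrite ltNge ifF//; apply/negbF; near: y; exact: lt_le_nbhsl.
- have xn : x != 0 by rewrite gt_eqF.
  have d1 : is_derive x (1 : R) (fun y : R => y^-1) (- x ^- 2).
    by apply: (is_derive_eq (is_deriveV xn (is_derive_id _ _))); rewrite /GRing.scale/= mulr1.
  have d2 := is_deriveX k d1.
  have d3 := is_derive1_comp (is_derive_expR _) (is_deriveN d1).
  have d4 := is_deriveM d2 d3.
  have near_eq : \forall y \near x, ((fun y : R => y^-1) ^+ k * (expR \o (- (fun y : R => y^-1)))) y = flat k y.
    near=> y; rewrite /flat ifT.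
      by rewrite exprfctE -exprVn.
    by rewrite -oppr_lt0; near: y; apply: Nlt_nbhsl; rewrite oppr_lt0.
  apply: (is_derive_eq (near_eq_is_derive near_eq d4)).
  rewrite /flat x0 /GRing.scale/=.
  rewrite exprfctE -!exprVn; move: (x^-1) (expR _) => u E.
  case: k {d2 d4 near_eq} => [|k] /=; rewrite ?exprS ?expr0; ring.
rewrite /flat x0 !ltxx mulr0 addr0.
have lim0 : (fun h : R => h^-1 *: ((flat k \o shift 0) (h *: 1) - flat k 0)) @ 0^' --> (0 : R).
  apply/cvgrPdist_lt => e e0; rewrite near_withinE; apply/nbhs_ballP.
  have C0 : 0 < (k.+2)`!%:R :> R by rewrite ltr0n fact_gt0.
  exists (e / (k.+2)`!%:R) => [|h]; first exact: divr_gt0.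
  rewrite /ball/= !sub0r !normrN ltr_pdivlMr// => hd h0.
  rewrite [h *: 1]mulr1 addr0 /flat ltxx subr0 -/(flat k h) normrM.
  rewrite normfV ltr_pdivrMl ?normr_gt0//; apply: le_lt_trans (flat_le k h) _.
  rewrite -real_normK ?num_real// expr2 mulrCA ltr_pM2l ?normr_gt0//.
  by rewrite mulrC.
by apply: DeriveDef; [apply/cvg_ex; exists 0|apply: cvg_lim].
Unshelve. all: by end_near.
Qed.

Lemma cdiff_flat n k : cdiff n (flat k).
Proof.
elim: n k => // n IH k; apply: (cdiff_derive1 (is_derive_flat k)).
by apply: cdiffD => //; exact: cdiffZ.
Qed.

(** For x <= 0 the inner term e exp (-1 / (1 - x)) is at least 1, so that the outer
    flat function is taken at a nonpositive point and vanishes; for x >= 1 the inner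
    term is 0, and the outer one is e exp (-1) = 1. *)
Definition smooth_step x : R := expR 1 * flat 0 (1 - expR 1 * flat 0 (1 - x)).

Lemma flat0 k x : x <= 0 -> flat k x = 0.
Proof. by rewrite /flat ltNge => ->. Qed.

Lemma flat_ge1 x : 1 <= x -> 1 <= expR 1 * flat 0 x.
Proof.
move=> x1; have x0 : 0 < x by exact: lt_le_trans x1.
rewrite /flat x0 expr0 invr1 mul1r -expRD -[X in X <= _]expR0 ler_expR subr_ge0.
by rewrite invf_le1.
Qed.

Lemma smooth_step_le0 x : x <= 0 -> smooth_step x = 0.
Proof.
move=> x0; rewrite /smooth_step [flat 0 (1 - _)]flat0 ?mulr0//.
by rewrite subr_le0 flat_ge1// lerBrDr gerDl.
Qed.

Lemma smooth_step_ge1 x : 1 <= x -> smooth_step x = 1.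
Proof.
move=> x1; rewrite /smooth_step [flat 0 (1 - x)]flat0 ?subr_le0//.
by rewrite mulr0 subr0 /flat ltr01 expr0 invr1 mul1r -expRD subrr expR0.
Qed.

Lemma cdiff_smooth_step n : cdiff n smooth_step.
Proof.
apply: cdiffZ; apply: (cdiff_comp (h := flat 0)); first exact: cdiff_flat.
apply: cdiffB; first exact: cdiff_cst.
apply: cdiffZ; apply: (cdiff_comp (h := flat 0)); first exact: cdiff_flat.
by apply: cdiffB; [exact: cdiff_cst|exact: cdiff_id].
Qed.

Definition smooth_bump x : R := smooth_step x - smooth_step (x - 1).

Lemma cdiff_smooth_bump n : cdiff n smooth_bump.
Proof.
apply: cdiffB; first exact: cdiff_smooth_step.
apply: (cdiff_comp (h := smooth_step)); first exact: cdiff_smooth_step.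
by apply: cdiffB; [exact: cdiff_id|exact: cdiff_cst].
Qed.

Lemma smooth_bump_support x : (x <= 0) || (2 <= x) -> smooth_bump x = 0.
Proof.
move=> /orP[x0|x2]; rewrite /smooth_bump.
  by rewrite !smooth_step_le0 ?subrr// subr_le0; lra.
by rewrite !smooth_step_ge1 ?subrr//; lra.
Qed.

(** On the unit interval only two translates of the bump are nonzero, and
    their sum telescopes. *)
Lemma smooth_bump_sum x : 0 <= x < 1 -> smooth_bump x + smooth_bump (x + 1) = 1.
Proof.
move=> /andP[x0 x1]; rewrite /smooth_bump addrK [smooth_step (x - 1)]smooth_step_le0; last by lra.
by rewrite [smooth_step (x + 1)]smooth_step_ge1 ?lerDr//; ring.
Qed.

End flat.

Section partition_of_unity.
Context {R : realType} {VQ : vectType rat}.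
Local Notation V := 'rV[R]_(\dim {:VQ}).
Local Notation mR := (measurableTypeR R).
Variables (Lambda : set VQ) (n : nat) (b : n.-tuple VQ).
Hypothesis hb : lattice_basis Lambda b.
Local Notation W := (n.-tuple mR).
Implicit Types (x : n.-tuple R) (z k : n.-tuple int) (v : V).

Local Notation es := (@extend_scalars R VQ).
Local Notation lc := (lattice_coord b : n.-tuple R -> V).

Lemma cdiff_coords N i : cdiff N (fun v : V => tnth (coords b v) i).
Proof.
under eq_fun do rewrite tnth_mktuple; apply: cdiff_sum => j.
apply: cdiffM; last exact: cdiff_cst.
case: N => // N; split=> [v|phi]; first exact: differentiable_coord.
rewrite (_ : 'D_phi _ = fun=> phi 0 j); first exact: cdiff_cst.
apply/funext => v; apply: cvg_lim => //; apply: cvg_near_cst.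
rewrite near_withinE; near=> h => h0.
by rewrite /= /shift/= !mxE addrK scalerA mulVf// scale1r.
Unshelve. all: by end_near.
Qed.

Definition lattice_bump v : R := \prod_(i < n) smooth_bump (tnth (coords b v) i).

(** Times a smooth function whose integral translates sum to 1, a character becomes
    a test function without changing its pairings with periodic functions. *)
Definition bump_chr k : V -> R[i] := fun v => (lattice_bump v)%:C * expi2pi (dot k (coords b v)).

Lemma bump_chrE k x : bump_chr k (lc x) = (\prod_(i < n) smooth_bump (tnth x i))%:C * chr k x.
Proof. by rewrite /bump_chr /lattice_bump (lattice_coordK hb). Qed.

Lemma test_function_bump_chr k : test_function (bump_chr k).
Proof.
split.
  have cb N : cdiff N (fun v : V => lattice_bump v).
    apply: cdiff_prod => i; apply: (cdiff_comp (h := smooth_bump)); last exact: cdiff_coords.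
    exact: cdiff_smooth_bump.
  have cd N : cdiff N (fun v : V => 2 * pi * dot k (coords b v)).
    by apply: cdiffZ; apply: cdiff_sum => i; apply: cdiffZ; exact: cdiff_coords.
  have [cc cs] : (forall N, cdiff N (@cos R)) /\ forall N, cdiff N (@sin R).
    by split=> N; have [] := @cdiff_trig R N.
  rewrite (_ : bump_chr k = fun v : V => (lattice_bump v * cos (2 * pi * dot k (coords b v))) +i*
      (lattice_bump v * sin (2 * pi * dot k (coords b v)))).
    apply: smooth_cdiff => N; apply: cdiffM => //.
      exact: (cdiff_comp (h := cos)).
    exact: (cdiff_comp (h := sin)).
  apply/funext => v; apply/eqP; rewrite eq_complex cReM cImM /=.
  by rewrite !mul0r subr0 addr0 !eqxx.
exists (\sum_(i < n) 2 * `|es (tnth b i)|) => v; rewrite ltNge => /negP vM.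
suff [i hi] : exists i, smooth_bump (tnth (coords b v) i) = 0.
  by rewrite /bump_chr /lattice_bump (bigD1 i)//= hi !mul0r.
apply: contrapT => h; apply: vM.
rewrite -{1}(coordsK hb v); apply: le_trans (ler_norm_sum _ _ _) _.
apply: ler_sum => i _; rewrite normrZ ler_wpM2r//.
rewrite leNgt; apply/negP => h2; apply: h; exists i.
by apply: smooth_bump_support; move: h2; rewrite ltr_normr => /orP[]; lra.
Qed.

(** The bump is a product of functions of one coordinate, so its sum over the
    translates is a product of sums that are equal to 1. *)
Lemma has_sum_bump_chr k x : cube x ->
  has_sum setT (fun z => bump_chr k (lc (addt x (intr_tuple z)))) (chr k x).
Proof.
move=> cx.
(* The translates that meet the support are those by vectors of 0s and 1s. *)
pose t (f : {ffun 'I_n -> bool}) : n.-tuple int := [tuple (f i : nat)%:Z | i < n].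
pose F z := \prod_(i < n) smooth_bump (tnth x i + (tnth z i)%:~R).
have FE z : bump_chr k (lc (addt x (intr_tuple z))) = (F z)%:C * chr k x.
  rewrite bump_chrE.
  have -> : chr k (addt x (intr_tuple z)) = chr k x by exact: chr_zperiodic.
  have -> : \prod_(i < n) smooth_bump (tnth (addt x (intr_tuple z)) i) = F z.
    by apply: eq_bigr => i _; rewrite !tnth_mktuple.
  reflexivity.
have cxi i : 0 <= tnth x i < 1 by have := cx i; rewrite /= in_itv.
have t_inj : injective t.
  move=> f g /(congr1 (fun z => tnth z _)) fg; apply/ffunP => i.
  by have := fg i; rewrite !tnth_mktuple => -[]; case: (f i); case: (g i).
have F0 z : z \notin codom t -> F z = 0.
  move=> tz; have [i hi] : exists i, (tnth z i != 0) && (tnth z i != 1).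
    apply/existsP; apply: contraNT tz => /existsPn h.
    apply/codomP; exists [ffun i => tnth z i == 1]; apply: eq_from_tnth => i.
    rewrite tnth_mktuple ffunE; have := h i; rewrite negb_and !negbK.
    by case: eqVneq => [->|_] //=; case: eqVneq => // ->.
  rewrite /F (bigD1 i)//= smooth_bump_support ?mul0r//.
  have [|] := leP (tnth z i) (-1)%R => zi.
    have : (tnth z i)%:~R <= -1 :> R by rewrite -(ler_int R) in zi.
    by have := cxi i; lra.
  have zi2 : 2 <= tnth z i.
    by case/andP: hi; move: (tnth z i) zi => [[|[|m]]|[|m]].
  have : 2 <= (tnth z i)%:~R :> R by rewrite -(ler_int R) in zi2.
  by have := cxi i; lra.
have F1 : \sum_(f : {ffun 'I_n -> bool}) F (t f) = 1.
  rewrite (eq_bigr (fun f : {ffun 'I_n -> bool} =>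
    \prod_(i < n) smooth_bump (tnth x i + (f i : nat)%:R))) => [|f _].
    rewrite -(bigA_distr_bigA (fun i (c : bool) => smooth_bump (tnth x i + (c : nat)%:R))).
    apply: big1 => i _; rewrite big_bool/= addrC addr0.
    exact: smooth_bump_sum.
  by apply: eq_bigr => i _; rewrite tnth_mktuple.
move=> e e0; exists [fset t f | f in {: {ffun 'I_n -> bool}}]%fset; split=> // J JJ _.
under eq_bigr do rewrite FE.
rewrite -(big_fset_incl _ JJ) /=; last first.
  move=> z _ hz; rewrite F0 ?mul0r//; apply: contra hz => /codomP[f ->].
  by apply/imfsetP; exists f.
rewrite big_imfset/=; last by move=> f g _ _; exact: t_inj.
rewrite -mulr_suml -rmorph_sum/= big_enum/= F1 mul1r subrr normr0.
by rewrite ltcR.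
Qed.

End partition_of_unity.

(** * Bernoulli series and the Euler-Maclaurin formula *)

Section euler_maclaurin.
Context {R : realType} {VQ : vectType rat}.
Local Notation V := 'rV[R]_(\dim {:VQ}).
Local Notation U := 'Hom(V, R^o).
Local Notation mR := (measurableTypeR R).
Variables (Lambda : set VQ) (n : nat) (b : n.-tuple VQ).
Hypothesis hb : lattice_basis Lambda b.
Local Notation W := (n.-tuple mR).
Local Notation mu := (@lebesgue_tuple R n).
Implicit Types (x y : n.-tuple R) (m z k : n.-tuple int) (f g : V -> R[i]) (v phi : V) (gamma : U).

Local Notation es := (@extend_scalars R VQ).
Local Notation lc := (lattice_coord b : n.-tuple R -> V).
Local Notation dp := (@dual_point R VQ n b).

Lemma schwartz_periodization f : schwartz f ->
  exists S : W -> R[i], forall x, has_sum setT (fun z => f (lc (addt x (intr_tuple z)))) (S x).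
Proof.
move=> hf; have [C hC] := schwartz_weight hb hf.
have [S hS] := periodization hC; exists S => x.
apply: (tail_has_sum (summable_weight_int n) _ (hS x)).
have C0 : 0 <= C.
  have := le_trans (normc_ge0 _) (hC [tuple 0 | i < n]).
  by rewrite pmulr_lge0// weight_gt0.
rewrite !mulr_ge0 ?exprn_ge0//; apply: prodr_ge0 => i _.
by rewrite exprn_ge0// addr_ge0.
Qed.

(** The value at 0 of the periodization of f is the sum of f over the lattice. *)
Lemma schwartz_poisson f l : schwartz f ->
  has_sum setT (coef (fun x : W => f (lc x))) l -> has_sum Lambda (fun u => f (es u)) l.
Proof.
move=> hf hl; have [C hC] := schwartz_weight hb hf; have [C' hC'] := coef_decay hb hf.
have [S hS] := schwartz_periodization hf.
have cf : continuous_tuple (fun x => f (lc x)) by apply: continuous_tuple_smooth; case: hf.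
rewrite (has_sum_unique hl (poisson_summation cf hC hC' hS)).
apply: (has_sum_lattice hb); apply: eq_has_sum (hS [tuple 0 | i < n]) => z _.
rewrite extend_lattice_point; congr (f (lc _)).
by apply: eq_from_tnth => i; rewrite !tnth_mktuple add0r.
Qed.

Lemma schwartz_pairing (B : W -> R[i]) f : zperiodic B -> cmeasurable setT B ->
  cintegrable mu cube B -> schwartz f ->
  has_sum setT (fun m => coef (fun x : W => f (lc x)) m * mean (fun x => B x * chr (zoppt m) x))
    (cint mu setT (fun x => B x * f (lc x))).
Proof.
move=> pB mB iB hf; have [C hC] := schwartz_weight hb hf; have [C' hC'] := coef_decay hb hf.
have [S hS] := schwartz_periodization hf.
have cf : continuous_tuple (fun x => f (lc x)) by apply: continuous_tuple_smooth; case: hf.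
exact: (pairing cf hC hC' hS pB mB iB).2.
Qed.

(** The integral translates of the bump sum to 1, so the periodization of the test
    function is the character itself. *)
Lemma mean_bump_chr (B : W -> R[i]) k : zperiodic B -> cmeasurable setT B ->
  cintegrable mu cube B ->
  cint mu setT (fun x => B x * bump_chr b k (lc x)) = mean (fun x => B x * chr k x).
Proof.
move=> pB mB iB; have sg : schwartz (bump_chr b k : V -> R[i]).
  exact/test_function_schwartz/(test_function_bump_chr hb).
have [C hC] := schwartz_weight hb sg.
have mg : cmeasurable setT (fun x : W => bump_chr b k (lc x)).
  by apply: schwartz_cmeasurable; case: sg.
by have [] := unfolding_sum pB mB iB mg hC (fun x cx => has_sum_bump_chr hb k cx).
Qed.

Section series.
Variables (PhiQ : seq VQ) (s : {vspace V}).
Let Phi : seq V := [seq es q | q <- PhiQ].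
Hypothesis span_Phi : <<Phi>>%VS = fullv.

Let out := outside Phi s.
Let reg := [set z | regular_dual Lambda Phi s (dp z)].

Definition bernoulli_coef z : R[i] :=
  if z \in reg then (\prod_(phi <- out) (0 +i* (2 * pi * (dp z phi : R))))^-1 else 0.

Lemma dual_point_coords z v : (dp z v : R) = dot z (coords b v).
Proof. by rewrite lfunE. Qed.

Lemma common_denominator (rs : seq rat) :
  exists2 N : nat, (0 < N)%N & forall r, r \in rs -> N%:R * r \is a Num.int.
Proof.
elim: rs => [|r rs [N N0 hN]]; first by exists 1%N.
exists (N * `|denq r|)%N => [|q].
  by rewrite muln_gt0 N0 absz_gt0 denq_neq0.
rewrite natrM inE => /orP[/eqP ->|/hN]; last first.
  by rewrite mulrAC => h; apply: rpredM => //; exact: natr_int.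
rewrite -mulrA; apply: rpredM; first exact: natr_int.
rewrite -[r in _ * r]divq_num_den mulrCA natr_absz gtr0_norm ?denq_gt0//.
by rewrite mulfV ?mulr1 ?intr_int// intr_eq0 denq_neq0.
Qed.

Lemma integral_multiple : exists2 N : nat, (0 < N)%N &
  forall z phi, phi \in Phi -> N%:R * (dp z phi : R) \is a Num.int.
Proof.
have [N N0 hN] := common_denominator [seq coord b i q | q <- PhiQ, i <- enum 'I_n].
exists N => // z phi /mapP[q qP ->]; rewrite dual_point_coords /dot mulr_sumr.
apply: rpred_sum => i _; rewrite coords_extend mulrCA; apply: rpredM; first exact: intr_int.
have /hN : coord b i q \in [seq coord b i q | q <- PhiQ, i <- enum 'I_n].
  by apply: allpairs_f => //; rewrite mem_enum.
move/intrP => [c hc]; rewrite -(ratr_nat R) -rmorphM hc/= ratr_int.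
exact: intr_int.
Qed.

Lemma regular_dual_inj z z' : reg z -> reg z' ->
  (forall phi, phi \in out -> dp z phi = dp z' phi) -> z = z'.
Proof.
move=> [_ z0 _] [_ z'0 _] h.
have E phi : phi \in Phi -> dp z phi = dp z' phi.
  move=> hphi; case: (boolP (phi \in s)) => ps; first by rewrite z0// z'0.
  by apply: h; rewrite mem_filter ps.
rewrite -(dual_pointK (R := R) hb z) -(dual_pointK (R := R) hb z'); congr dual_index.
apply/lfunP => v; have : v \in <<Phi>>%VS by rewrite span_Phi memvf.
move=> hv; rewrite (coord_span (X := in_tuple Phi) hv) !linear_sum; apply: eq_bigr => i _.
by rewrite !linearZ/= E// mem_nth.
Qed.

(** On the regular points, the pairings with the vectors outside s are nonzero
    rationals with a common denominator, and they determine the point. The squares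
    of the coefficients are therefore bounded by distinct weights of integral points
    in dimension |Phi outside s|, times a constant. *)
Lemma summable_bernoulli_coef : summable_weight (fun z => normc (bernoulli_coef z) ^+ 2).
Proof.
have [N N0 hN] := integral_multiple.
have NR0 : 0 < N%:R :> R by rewrite ltr0n.
pose t z : (size out).-tuple int :=
  [tuple Num.floor (N%:R * (dp z (tnth (in_tuple out) j) : R)) | j < size out].
have outP phi : phi \in out -> phi \in Phi by rewrite mem_filter => /andP[].
have tE z j : (tnth (t z) j)%:~R = N%:R * (dp z (tnth (in_tuple out) j) : R).
  by rewrite tnth_mktuple floorK// hN// outP// mem_tnth.
split=> [z|]; first by rewrite exprn_ge0// normc_ge0.
exists (N%:R ^+ 2 ^+ size out * 4 ^+ size out) => J.
rewrite (bigID (fun z => z \in reg))/= [X in _ + X]big1 ?addr0 => [|z /negbTE hz]; last first.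
  by rewrite /bernoulli_coef hz normc0 expr0n.
apply: (@sum_inj_le _ _ _ _
  (fun c : (size out).-tuple int => N%:R ^+ 2 ^+ size out * weight (intr_tuple c)) _ _ t).
- by move=> c; rewrite mulr_ge0 ?exprn_ge0// ltW// weight_gt0.
- by move=> I; rewrite -mulr_sumr ler_wpM2l ?exprn_ge0// sum_weight_le.
- move=> z z' /set_mem hz /set_mem hz' e; apply: regular_dual_inj => // phi po.
  have [j ->] : exists j, phi = tnth (in_tuple out) j.
    by apply/tnthP.
  have := tE z j; rewrite e tE => /mulfI; rewrite (gt_eqF NR0) => /(_ isT) ->.
  by [].
move=> z /[dup] hz /set_mem[_ _ z0]; rewrite /bernoulli_coef hz.
rewrite normcV normc_prod -prodfV -prodrXl big_tnth.
have -> : N%:R ^+ 2 ^+ size out = \prod_(j < size out) N%:R ^+ 2 :> R.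
  by rewrite prodr_const card_ord.
rewrite -big_split/=; apply: ler_prod => j _.
rewrite exprn_ge0 ?invr_ge0 ?sqrtr_ge0//= [tnth (intr_tuple _) _]tnth_mktuple tE.
rewrite /weight1 expr0n/= add0r sqrtr_sqr !normrM (gtr0_norm (pi_gt0 R)).
rewrite (gtr0_norm NR0) ger0_norm//.
set d := `|_|; have d0 : 0 < d by rewrite normr_gt0; apply: z0; exact: mem_tnth.
have u1 : 1 <= N%:R * d.
  have : tnth (t z) j != 0.
    by rewrite -(intr_eq0 R) tE mulf_neq0 ?(gt_eqF NR0)// -normr_gt0.
  by rewrite -normr_gt0 gtz0_ge1 -(ler_int R) intr_norm tE normrM (gtr0_norm NR0).
have p2 := pi_ge2 R; have D0 : 0 < 2 * pi * d by rewrite !mulr_gt0// pi_gt0.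
rewrite ler_pdivlMr ?exprn_gt0// ?ltr_wpDr ?mulr_ge0 ?(ltW d0)// -exprMn.
apply: lerXn2r; rewrite ?nnegrE ?mulr_ge0 ?invr_ge0 ?(ltW D0) ?addr_ge0 ?mulr_ge0 ?(ltW d0)//.
by rewrite ler_pdivrMl//; nra.
Qed.

Lemma integral_bernoulli_term z g : schwartz g ->
  integral_dv b (fun v => bernoulli_term Phi s (dp z) v * g v) =
  (\prod_(phi <- out) (0 +i* (2 * pi * (dp z phi : R))))^-1 * coef (fun x : W => g (lc x)) z.
Proof.
move=> sg; rewrite integral_dvE /coef -cintZ//; last exact: (schwartz_cintegrable hb).
apply: eq_cint => x _; rewrite /bernoulli_term (expi2pi_dual_point hb).
by rewrite [_ / _]mulrC mulrA.
Qed.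

Lemma coordsD u v : coords b (u + v) = addt (coords b u) (coords b v).
Proof.
apply: eq_from_tnth => i; rewrite !tnth_mktuple -big_split; apply: eq_bigr => j _.
by rewrite mxE mulrDl.
Qed.

Lemma measurable_centered_box (M : R) : measurable [set x : W | forall i, `|tnth x i| <= M].
Proof.
rewrite (_ : [set x : W | _] = [set x : W | forall i, `[- M, M]%classic (tnth x i)]).
  by apply: (measurable_box (F := fun=> `[- M, M]%classic)) => i; exact: measurable_itv.
by apply/seteqP; split=> x /= h i; have := h i; rewrite /= in_itv/= ler_norml.
Qed.

(** Unfold against the indicator of the box, which a multiple of the weight bounds. *)
Lemma locally_integrable_zperiodic (B : W -> R[i]) : zperiodic B -> cmeasurable setT B ->
  cintegrable mu cube B -> locally_integrable_dv b (fun v => B (coords b v)).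
Proof.
move=> pB mB iB M; set D := [set x : W | _]; rewrite /=.
have mD : measurable D := measurable_centered_box M.
have mh : cmeasurable setT (fun x : W => (\1_D x)%:C : R[i]).
  by split; [exact: measurable_indic|exact: measurable_cst].
have hC x : normc ((\1_D x)%:C : R[i]) <= (1 + `|M|) ^+ 2 ^+ n * weight x.
  rewrite normc_real indicE; case: (boolP (x \in D)) => [/set_mem xD|_]; last first.
    by rewrite normr0 mulr_ge0 ?exprn_ge0 ?addr_ge0// ltW// weight_gt0.
  rewrite normr1 -[n in _ ^+ n]card_ord -prodr_const -big_split/=.
  apply: (@le_trans _ _ (\prod_(i in 'I_n) 1)); first by rewrite big1_eq.
  apply: ler_prod => i _; rewrite ler01/= /weight1 ler_pdivlMr; last first.
    by rewrite exprn_gt0// ltr_wpDr.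
  rewrite mul1r; apply: lerXn2r; rewrite ?nnegrE ?addr_ge0// lerD2l.
  exact: le_trans (xD i) (ler_norm _).
have [i1 i2] := unfolding_integrable pB mB iB mh hC.
split.
  apply/(integrable_mkcond _ mD); move: i1; congr (integrable _ _ _).
  apply/funext => x; rewrite /patch (lattice_coordK hb).
  by rewrite cReM/= mulr0 subr0 indicE; case: ifP => _; rewrite ?mulr1 ?mulr0.
apply/(integrable_mkcond _ mD); move: i2; congr (integrable _ _ _).
apply/funext => x; rewrite /patch (lattice_coordK hb).
by rewrite cImM/= mulr0 add0r indicE; case: ifP => _; rewrite ?mulr1 ?mulr0.
Qed.

Lemma has_sum_bernoulli_coef (B : W -> R[i]) g : zperiodic B -> cmeasurable setT B ->
  cintegrable mu cube B ->
  (forall k, mean (fun x => B x * chr (zoppt k) x) = bernoulli_coef k) -> schwartz g ->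
  has_sum reg (fun z => integral_dv b (fun v => bernoulli_term Phi s (dp z) v * g v))
    (cint mu setT (fun x => B x * g (lc x))).
Proof.
move=> pB mB iB hB sg; apply: has_sum_restrict.
apply: eq_has_sum (schwartz_pairing pB mB iB sg) => z _.
rewrite hB /bernoulli_coef; case: ifP => _; rewrite ?mulr0//.
by rewrite integral_bernoulli_term// mulrC.
Qed.

(** The square-summable coefficients are those of some periodic function, and the
    pairing of this function with a test function is the sum of the pairings of the
    terms of its Fourier series. *)
Lemma is_bernoulli_ex : exists B, is_bernoulli b Lambda Phi s B.
Proof.
have [B [pB mB iB hB]] := riesz_fischer summable_bernoulli_coef.
exists (fun v => B (coords b v)); split.
- move=> l v /(lattice_indexK (R := R) hb) <-.
  by rewrite coordsD extend_lattice_point (lattice_coordK hb).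
- exact: locally_integrable_zperiodic.
move=> g /test_function_schwartz sg; apply: (has_sum_dual hb); first by move=> gamma [].
rewrite integral_dvE.
rewrite (_ : cint _ _ _ = cint mu setT (fun x => B x * g (lc x))).
  exact: has_sum_bernoulli_coef.
by apply: eq_cint => x _; rewrite (lattice_coordK hb).
Qed.

(** Any representative of the series has the expected Fourier coefficients: paired
    with the product of the bump and the character of index - k, only the term of
    index k remains. *)
Section unique.
Variable B : V -> R[i].
Hypothesis hB : is_bernoulli b Lambda Phi s B.
Let B' : W -> R[i] := fun x => B (lc x).

Let pB : zperiodic B'.
Proof.
move=> x z; rewrite /B' lattice_coordD -extend_lattice_point.
by case: hB => h _ _; apply: h; exact: (lattice_point_mem hb).
Qed.

Let mB : cmeasurable setT B'.
Proof.
pose D (j : nat) := [set x : W | forall i, `|tnth x i| <= j%:R].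
have DT : setT = \bigcup_j D j.
  apply/esym/seteqP; split=> // x _.
  exists (Num.bound (\sum_(i < n) `|tnth x i|)) => // i.
  apply: le_trans (ltW (archi_boundP _)); last by rewrite sumr_ge0.
  by rewrite (bigD1 i)//= lerDl sumr_ge0.
have mD j : measurable (D j) := measurable_centered_box j%:R.
case: hB => _ h _; rewrite DT; split; apply/measurable_fun_bigcup => // j.
  by have [i1 _] := h j%:R; apply/measurable_EFinP; exact: measurable_int i1.
by have [_ i2] := h j%:R; apply/measurable_EFinP; exact: measurable_int i2.
Qed.

Let iB : cintegrable mu cube B'.
Proof.
have [i1 i2] : cintegrable mu [set x : W | forall i, `|tnth x i| <= 1] B'.
  by case: hB => _ /(_ 1) h _; exact: h.
have sub : cube `<=` [set x : W | forall i, `|tnth x i| <= 1].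
  by move=> x cx i; exact: cube_le1.
have mD := measurable_centered_box 1.
by split; apply: (integrableS mD) => //; exact: measurable_cube.
Qed.

Let meanB k : mean (fun x => B' x * chr (zoppt k) x) = bernoulli_coef k.
Proof.
rewrite -mean_bump_chr//.
rewrite (_ : cint _ _ _ = integral_dv b (fun v => B v * bump_chr b (zoppt k) v)); last by [].
have tg := test_function_bump_chr hb (R := R) (zoppt k).
have sg := test_function_schwartz tg.
case: hB => _ _ /(_ _ tg) /(has_sum_dual_inv hb) h.
have {}h : has_sum reg (fun z => integral_dv b (fun v => bernoulli_term Phi s (dp z) v *
    bump_chr b (zoppt k) v)) (integral_dv b (fun v => B v * bump_chr b (zoppt k) v)).
  by apply: h => gamma [].
apply: (has_sum_unique h).
have term z : integral_dv b (fun v => bernoulli_term Phi s (dp z) v * bump_chr b (zoppt k) v) =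
    (\prod_(phi <- out) (0 +i* (2 * pi * (dp z phi : R))))^-1 * (z == k)%:R.
  rewrite integral_bernoulli_term// /coef mean_bump_chr//; last exact: cintegrable_cube_chr.
  - rewrite -zaddt_oppK -mean_chr; congr (_ * _).
    by apply: eq_cint => x _; rewrite chr_zaddt.
  - exact: chr_zperiodic.
  - exact: cmeasurable_chr.
case: (boolP (k \in reg)) => kreg.
  have -> : bernoulli_coef k = integral_dv b
      (fun v => bernoulli_term Phi s (dp k) v * bump_chr b (zoppt k) v).
    by rewrite term eqxx mulr1 /bernoulli_coef kreg.
  apply: (has_sum_single (F := fun z => integral_dv b
    (fun v => bernoulli_term Phi s (dp z) v * bump_chr b (zoppt k) v))).
    exact: set_mem.
  by move=> z _ zk; rewrite term (negbTE zk) mulr0.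
rewrite /bernoulli_coef (negbTE kreg); apply: has_sum0 => z zreg.
rewrite term; case: eqVneq => [zk|_]; last by rewrite mulr0.
by move: kreg; rewrite -zk mem_set.
Qed.

(** Each derivative multiplies the coefficients of f by the opposite of the
    corresponding factor of the denominator. *)
Lemma is_bernoulli_pairing f : schwartz f ->
  has_sum reg (coef (fun x : W => f (lc x)))
    ((-1) ^+ size out * integral_dv b (fun v => B v * derivecs out f v)).
Proof.
move=> sf; have h := has_sum_bernoulli_coef pB mB iB meanB (schwartz_derivecs out sf).
apply: eq_has_sum (has_sumZ ((-1) ^+ size out) h) => z [_ _ zout].
rewrite integral_bernoulli_term; last exact: schwartz_derivecs.
rewrite (coef_derivecs hb)// !mulrA -[RHS]mul1r; congr (_ * _).
have sign (r : seq V) : \prod_(phi <- r) (0 -i* (2 * pi * dot z (coords b phi))) =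
    (-1) ^+ size r * \prod_(phi <- r) (0 +i* (2 * pi * (dp z phi : R))) :> R[i].
  elim: r => [|phi r IH]; first by rewrite !big_nil mulr1.
  rewrite !big_cons IH exprS mulrACA; congr (_ * _); rewrite dual_point_coords.
  by rewrite mulN1r; apply/eqP; rewrite eq_complex /= oppr0 !eqxx.
rewrite sign mulrACA -exprMn mulrNN mulr1 expr1n mul1r mulVf//.
rewrite prodf_seq_neq0; apply/allP => phi hphi /=.
by rewrite eq_complex/= eqxx/= !mulf_neq0 ?(gt_eqF (pi_gt0 R))// zout.
Qed.

End unique.

Lemma bernoulli_pairing f : schwartz f ->
  has_sum reg (coef (fun x : W => f (lc x)))
    ((-1) ^+ size out * integral_dv b (fun v => bernoulli b Lambda Phi s v * derivecs out f v)).
Proof. by move=> sf; apply: is_bernoulli_pairing => //; apply: xgetPex; exact: is_bernoulli_ex. Qed.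

End series.

Lemma finite_admissible (Phi : seq V) : finite_set (admissible Phi).
Proof.
pose F (m : (size Phi).-tuple bool) := <<mask m Phi>>%VS.
apply: (@sub_finite_set _ _ (F @` setT)); last exact/finite_image/finite_finset.
move=> s [X XPhi ->]; exists [tuple of map (mem X) (in_tuple Phi)] => //.
rewrite /F /= -filter_mask; apply: eq_span => v; rewrite mem_filter andb_idr//.
exact: XPhi.
Qed.

Definition killed gamma (Phi : seq V) : seq V := [seq phi <- Phi | (gamma phi : R) == 0].

(** Regularity puts the vectors of Phi killed by gamma into s; conversely, gamma
    vanishes on s and therefore kills the vectors of Phi that generate it. *)
Lemma regular_dual_admissible (Phi : seq V) gamma s : admissible Phi s ->
  regular_dual Lambda Phi s gamma -> s = <<killed gamma Phi>>%VS.
Proof.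
move=> [X XPhi sX] [_ gs gout]; apply/eqP; rewrite eqEsubv; apply/andP; split.
  rewrite sX; apply: sub_span => v vX; rewrite mem_filter XPhi// andbT.
  by rewrite gs// sX memv_span.
apply/span_subvP => v; rewrite mem_filter => /andP[/eqP gv vPhi].
by apply: contraT => vs; have := gout v; rewrite mem_filter vs vPhi gv eqxx => /(_ isT).
Qed.

Lemma regular_dual_span (Phi : seq V) gamma : dual_lattice Lambda gamma ->
  regular_dual Lambda Phi <<killed gamma Phi>>%VS gamma.
Proof.
move=> hg; split=> // [v|phi].
  move=> hv; rewrite (coord_span (X := in_tuple (killed gamma Phi)) hv).
  rewrite linear_sum big1// => i _; rewrite linearZ/=.
  have := mem_nth 0 (ltn_ord i); rewrite mem_filter => /andP[/eqP -> _].
  by rewrite scaler0.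
rewrite mem_filter => /andP[ps hphi]; apply: contra ps => g0.
by apply: memv_span; rewrite mem_filter g0.
Qed.

End euler_maclaurin.

Theorem theorem6p1 (R : realType) (VQ : vectType rat)
    (Lambda : set VQ) (n : nat) (b : n.-tuple VQ)
    (hb : lattice_basis Lambda b)
    (PhiQ : seq VQ)
    (Phi := [seq extend_scalars phi | phi <- PhiQ] : seq 'rV[R]_(\dim {:VQ}))
    (hPhi : <<Phi>>%VS = fullv)
    (f : 'rV[R]_(\dim {:VQ}) -> R[i]) (hf : schwartz f) :
  has_sum Lambda (fun l => f (extend_scalars l))
    (\sum_(s \in admissible Phi)
       (-1) ^+ size (outside Phi s) *
       integral_dv b (fun v =>
         bernoulli b Lambda Phi s v * derivecs (outside Phi s) f v)).
Proof.
have finA := finite_admissible Phi; rewrite fsbig_finite//.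
apply: (schwartz_poisson hb hf).
apply: (has_sum_bigcup (A := fun s => [set z | regular_dual Lambda Phi s (dual_point b z)])).
- exact: fset_uniq.
- move=> z _; exists <<killed (dual_point b z) Phi>>%VS; last first.
    exact/regular_dual_span/(dual_point_mem hb).
  rewrite in_fset_set// inE; exists (killed (dual_point b z) Phi) => // phi.
  by rewrite mem_filter => /andP[].
- by [].
- move=> s s' z; rewrite !in_fset_set// !inE => hs hs' hz hz'.
  by rewrite (regular_dual_admissible hs hz) -(regular_dual_admissible hs' hz').
- by move=> s _; exact: (bernoulli_pairing hb).
Qed.
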